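(* Consider the family $$\dot x=y-x^{2n_1}\tilde f(x),\qquad \dot y=\tilde\epsilon^{\,2n_1}\big(\tilde\epsilon^{\,2n_1-1}\tilde\lambda-x^{2n_1-1}\big)$$ with $n_1\ge1$ an integer, $0\le\tilde\epsilon\ll1$, $\tilde\lambda\sim0\in\mathbb R$, $\tilde f$ smooth and $\tilde f(0)>0$, and such that $f(x):=x^{2n_1}\tilde f(x)$ satisfies $f'(x)>0$ for $x>0$ and $f'(x)<0$ for $x<0$. Let $\sigma_\pm$, $s_c^\pm$, $\tilde I_\pm$, the segment $L$, the slow relation function $S_0:L\to T$, the buffer point $s_b^-$, the control curve $\tilde\lambda=\tilde\lambda_c(\tilde\epsilon)$ and the transition maps $S_{\tilde\epsilon}:L\to\sigma_+$ ($\tilde\epsilon>0$ small) be as in the context. Let $\mu_{\tilde\epsilon}$ and $\mu_0$ be Borel probability measures supported on $L$. The following statements hold. (a) If $-\tilde I_-(s_c^-)\le\tilde I_+(s_c^+)$ and if $\mu_{\tilde\epsilon}$ converges weakly to $\mu_0$ as $\tilde\epsilon\to0$, then $\mu_{\tilde\epsilon}S_{\tilde\epsilon}^{-1}$ converges weakly to $\mu_0S_0^{-1}$ as $\tilde\epsilon\to0$. (b) If $-\tilde I_-(s_c^-)>\tilde I_+(s_c^+)$ and if $\mu_{\tilde\epsilon}$ converges weakly to $\mu_0$ as $\tilde\epsilon\to0$, then $\mu_{\tilde\epsilon}S_{\tilde\epsilon}^{-1}$ converges weakly to $\mu_0\widetilde S_0^{-1}$ as $\tilde\epsilon\to0$,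 where $\widetilde S_0:L\to T\cap\,]-\infty,s_c^+]$ is the continuous function $$\widetilde S_0(s^-)=\begin{cases}S_0(s^-),& s^-\in L\cap\,]-\infty,s_b^-[,\\ s_c^+,& s^-\in L\cap[s_b^-,+\infty[.\end{cases}$$
   Context: Smooth means $C^\infty$. Measures are Borel measures on $\mathbb R$; $\mu$ is supported on a Borel set $A$ if $\mu(\mathbb R\setminus A)=0$. Weak convergence $\mu_{\tilde\epsilon}\to\mu_0$ means $\int\chi\,d\mu_{\tilde\epsilon}\to\int\chi\,d\mu_0$ for every bounded continuous $\chi:\mathbb R\to\mathbb R$. For a measure $\mu$ supported on $L$ and a measurable map $G$ on $L$, $\mu G^{-1}$ denotes the push-forward $\mu G^{-1}(A)=\mu(G^{-1}(A))$. **Sections.** For $\tilde\epsilon=0$ the critical curve is $\{y=f(x)\}$, with normally attracting branch $\gamma_-=\{y=f(x),x>0\}$, normally repelling branch $\gamma_+=\{y=f(x),x<0\}$ and contact point $p_0=(0,0)$; orbits of the fast subsystem ($\tilde\epsilon=0$) are horizontal. Let $\sigma_-$ (entry) and $\sigma_+$ (exit) be smooth sections transverse to the horizontal foliation, with end point $p_0$, parameterized by regular parameters $s^\pm\in[0,s_0^\pm]$, with $s^\pm=0$ corresponding to $p_0$. $\sigma_-\setminus\{p_0\}$ lies in the basin of attraction of $\gamma_-$ and $\sigma_+\setminus\{p_0\}$ lies, in backward time, in the basin of attraction of $\gamma_+$ (for the fast subsystem). Points of $\sigma_\pm$ are identified with their parameter values. **Slow divergence integrals.** For $s^-\in\,]0,s_0^-]$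 let $\omega_1(s^-)>0$ be the $x$-coordinate of the $\omega$-limit point on $\gamma_-$ of the fast orbit through $s^-\in\sigma_-$, and for $s^+\in\,]0,s_0^+]$ let $\alpha_1(s^+)<0$ be the $x$-coordinate of the $\alpha$-limit point on $\gamma_+$ of the fast orbit through $s^+\in\sigma_+$. Put $$\tilde I_-(s^-)=\int_{\omega_1(s^-)}^0\frac{f'(x)^2}{x^{2n_1-1}}dx<0,\qquad \tilde I_+(s^+)=\int_0^{\alpha_1(s^+)}\frac{f'(x)^2}{x^{2n_1-1}}dx>0.$$ **Slow relation function $S_0$.** Fix $s_c^-\in\,]0,s_0^-[$ and $s_c^+\in\,]0,s_0^+[$. (a) If $-\tilde I_-(s_c^-)\le\tilde I_+(s_c^+)$: $L$ is any segment (compact interval) contained in $]0,s_c^-[$, and $S_0:L\to T=S_0(L)\subset\,]0,s_c^+[$ is the smooth increasing function defined by $\tilde I_-(s^-)+\tilde I_+(S_0(s^-))=0$, $s^-\in L$. (b) If $-\tilde I_-(s_c^-)>\tilde I_+(s_c^+)$: the buffer point $s_b^-\in\,]0,s_c^-[$ is the unique point with $\tilde I_-(s_b^-)+\tilde I_+(s_c^+)=0$; $L$ is a segment contained in $]0,s_c^-[$ with $s_b^-$ in its interior, such that $S_0:L\to T=S_0(L)\subset\,]0,s_0^+]$, smooth and increasing, is again (well) defined by $\tilde I_-(s^-)+\tilde I_+(S_0(s^-))=0$, $s^-\in L$. Then $S_0(s_b^-)=s_c^+$. **Control curve and transition map.** $\tilde\lambda=\tilde\lambda_c(\tilde\epsilon)$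 is a smooth curve (control curve; it is known to exist) such that for every small $\tilde\epsilon>0$ the system with $\tilde\lambda=\tilde\lambda_c(\tilde\epsilon)$ has an orbit connecting $s_c^-\in\sigma_-$ with $s_c^+\in\sigma_+$. For small $\tilde\epsilon>0$, $S_{\tilde\epsilon}$ is the transition map from $L\subset\sigma_-$ to $\sigma_+$ along orbits (in positive time) of the system with $\tilde\lambda=\tilde\lambda_c(\tilde\epsilon)$; $S_{\tilde\epsilon}:L\to S_{\tilde\epsilon}(L)$ is a smooth diffeomorphism with $S_{\tilde\epsilon}'>0$. *)

(* Defs.v *)
From HB Require Import structures.
From mathcomp Require Import all_boot all_order all_algebra.
From mathcomp Require Import all_classical all_reals all_analysis.
Set Implicit Arguments.
Unset Strict Implicit.
Unset Printing Implicit Defensive.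
Import Order.TTheory GRing.Theory Num.Theory.
Import numFieldNormedType.Exports.
Local Open Scope classical_set_scope.
Local Open Scope ring_scope.

Definition smooth (R : realType) (g : R -> R) : Prop :=
  forall (k : nat) (x : R), derivable (derive1n k g) x 1.

(* Smoothness on a (typically closed) subset is smoothness up to the boundary,
   expressed by a smooth extension: [h] itself is unconstrained outside [A],
   and one-sided derivatives at end points are those of the extension. *)
Definition smooth_on (R : realType) (A : set R) (h : R -> R) : Prop :=
  exists2 g : R -> R, smooth g & (forall x, A x -> h x = g x).

(* A map that is smooth on [A] with positive derivative there; when [A] is a
   segment this is an increasing smooth diffeomorphism of [A] onto its image. *)
Definition increasing_diffeo_on (R : realType) (A : set R) (h : R -> R) : Prop :=
  exists2 g : R -> R, smooth g &
    (forall x, A x -> h x = g x /\ 0 < derive1 g x).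

Definition critical_graph (R : realType) (n : nat) (ftilde : R -> R) : R -> R :=
  fun x => x ^+ (2 * n) * ftilde x.

Definition slow_fast_field (R : realType) (n : nat) (ftilde : R -> R)
    (eps lambda : R) (p : R * R) : R * R :=
  (p.2 - critical_graph n ftilde p.1,
   eps ^+ (2 * n) * (eps ^+ (2 * n - 1) * lambda - p.1 ^+ (2 * n - 1))).

(* The derivatives are two-sided also at end points of [J]; this loses nothing
   since solutions of a smooth vector field extend past end points. *)
Definition solution_on (R : realType) (V : R * R -> R * R) (J : set R)
    (gamma : R -> R * R) : Prop :=
  forall t : R, J t ->
    is_derive t (1 : R) (fun u : R => (gamma u).1) (V (gamma t)).1 /\
    is_derive t (1 : R) (fun u : R => (gamma u).2) (V (gamma t)).2.

Definition omega_limit_point (R : realType) (V : R * R -> R * R)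
    (p q : R * R) : Prop :=
  exists gamma : R -> R * R,
    [/\ solution_on V [set t | 0 <= t] gamma, gamma 0 = p
      & gamma t @[t --> +oo] --> q].

Definition alpha_limit_point (R : realType) (V : R * R -> R * R)
    (p q : R * R) : Prop :=
  exists gamma : R -> R * R,
    [/\ solution_on V [set t | t <= 0] gamma, gamma 0 = p
      & gamma t @[t --> -oo] --> q].

(* A smooth arc [sigma : [0, s0] -> R^2] starting at the contact point (0,0).
   Transversality to the horizontal foliation is Y' != 0, which also makes the
   parametrization regular. *)
Definition transverse_section (R : realType) (s0 : R) (sigma : R -> R * R) : Prop :=
  sigma 0 = (0, 0) /\
  exists X Y : R -> R,
    [/\ smooth X, smooth Y &
        forall s, 0 <= s <= s0 -> sigma s = (X s, Y s) /\ derive1 Y s != 0].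

(* Entry section: each point other than the contact point is attracted, by the
   fast subsystem (eps = 0, where lambda plays no role), to the point of abscissa
   omega1 s > 0 of the critical curve. *)
Definition entry_section (R : realType) (n : nat) (ftilde : R -> R) (s0 : R)
    (sigma : R -> R * R) (omega1 : R -> R) : Prop :=
  transverse_section s0 sigma /\
  forall s, 0 < s <= s0 ->
    0 < omega1 s /\
    omega_limit_point (slow_fast_field n ftilde 0 0) (sigma s)
      (omega1 s, critical_graph n ftilde (omega1 s)).

Definition exit_section (R : realType) (n : nat) (ftilde : R -> R) (s0 : R)
    (sigma : R -> R * R) (alpha1 : R -> R) : Prop :=
  transverse_section s0 sigma /\
  forall s, 0 < s <= s0 ->
    alpha1 s < 0 /\
    alpha_limit_point (slow_fast_field n ftilde 0 0) (sigma s)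
      (alpha1 s, critical_graph n ftilde (alpha1 s)).

Definition oriented_integral (R : realType) (a b : R) (g : R -> R) : R :=
  if a <= b then \int[lebesgue_measure]_(x in `[a, b]) g x
  else - \int[lebesgue_measure]_(x in `[b, a]) g x.

(* At x = 0 the integrand is 0 / 0 = 0, its continuous extension. *)
Definition slow_divergence (R : realType) (n : nat) (ftilde : R -> R) (x : R) : R :=
  (derive1 (critical_graph n ftilde) x) ^+ 2 / x ^+ (2 * n - 1).

Definition I_minus (R : realType) (n : nat) (ftilde omega1 : R -> R) (s : R) : R :=
  oriented_integral (omega1 s) 0 (slow_divergence n ftilde).

Definition I_plus (R : realType) (n : nat) (ftilde alpha1 : R -> R) (s : R) : R :=
  oriented_integral 0 (alpha1 s) (slow_divergence n ftilde).

Definition slow_relation (R : realType) (n : nat) (ftilde omega1 alpha1 : R -> R)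
    (L : set R) (S0 : R -> R) : Prop :=
  [/\ smooth_on L S0,
      (forall s t, L s -> L t -> s < t -> S0 s < S0 t)
    & forall s, L s ->
        I_minus n ftilde omega1 s + I_plus n ftilde alpha1 (S0 s) = 0].

(* [passes_to V E p q]: the orbit of [p] makes one passage around the contact
   point and then first meets the section [E] at [q].  Going from the attracting
   branch (x > 0) to the repelling one (x < 0) means crossing the half-line
   {x = 0, y < 0}, which is done exactly once.  Meeting [E] is only counted after
   this crossing: both sections may lie between the two branches, so that an
   orbit can meet [E] already on its way to the attracting branch. *)
Definition passes_to (R : realType) (V : R * R -> R * R) (E : set (R * R))
    (p q : R * R) : Prop :=
  exists (T tau : R) (gamma : R -> R * R),
    [/\ 0 < tau < T,
        solution_on V [set t | 0 <= t <= T] gamma,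
        gamma 0 = p /\ gamma T = q,
        E q /\ (forall t, tau < t < T -> ~ E (gamma t))
      & forall t, 0 <= t <= T ->
          ((gamma t).1 = 0 /\ (gamma t).2 < 0) <-> t = tau].

Definition section_points (R : realType) (s0 : R) (sigma : R -> R * R) : set (R * R) :=
  sigma @` `[0, s0].

(* [lambda_c 0 = 0] is the requirement that lambda be close to 0. *)
Definition control_curve (R : realType) (n : nat) (ftilde : R -> R)
    (s0p : R) (sigmam sigmap : R -> R * R) (scm scp eps0 : R)
    (lambda_c : R -> R) : Prop :=
  [/\ smooth_on `[0, eps0] lambda_c, lambda_c 0 = 0
    & forall eps, 0 < eps < eps0 ->
        passes_to (slow_fast_field n ftilde eps (lambda_c eps))
          (section_points s0p sigmap) (sigmam scm) (sigmap scp)].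

Definition transition_maps (R : realType) (n : nat) (ftilde : R -> R)
    (s0p : R) (sigmam sigmap : R -> R * R) (eps0 : R) (lambda_c : R -> R)
    (L : set R) (S : R -> R -> R) : Prop :=
  forall eps, 0 < eps < eps0 ->
    increasing_diffeo_on L (S eps) /\
    forall s, L s ->
      0 <= S eps s <= s0p /\
      passes_to (slow_fast_field n ftilde eps (lambda_c eps))
        (section_points s0p sigmap) (sigmam s) (sigmap (S eps s)).

Definition supported_on (R : realType) (A : set R)
    (mu : set (measurableTypeR R) -> \bar R) : Prop :=
  mu (~` A) = 0%E.

(* Weak convergence as eps -> 0+.  Stated for set functions so that it applies
   to [pushforward_on] without a measurability proof; only values on Borel sets
   enter the integrals. *)
Definition weak_cvg (R : realType)
    (mu : R -> set (measurableTypeR R) -> \bar R)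
    (mu0 : set (measurableTypeR R) -> \bar R) : Prop :=
  forall chi : R -> R, continuous chi ->
    (exists M : R, forall x, `|chi x| <= M) ->
    (\int[mu eps]_x (chi x)%:E)%E @[eps --> 0^'+] --> (\int[mu0]_x (chi x)%:E)%E.

(* Push-forward of a measure supported on [L] by a map that is meaningful on [L]
   only: the preimage is taken in [L]. *)
Definition pushforward_on (R : realType) (L : set R)
    (mu : set (measurableTypeR R) -> \bar R) (G : R -> R) :
    set (measurableTypeR R) -> \bar R :=
  fun A => mu (L `&` G @^-1` A).

Definition buffered (R : realType) (S0 : R -> R) (sb scp : R) : R -> R :=
  fun s => if s < sb then S0 s else scp.

(* Main.v *)
(* Time reversal together with x -> -x turns the passage along the repelling
   branch into a passage along an attracting one, so on both sides of the contact
   point one has half orbits of x' = y - F(x), y' = d (c - x^k) which fall onto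
   the branch y = F(x), x > 0, follow it and leave it across {x = 0} at some
   height h < 0.  Let J' = F'^2 / x^k.  Two half orbits landing on the branch at
   abscissas at least om cross at heights which differ by at most
   exp (- (J om - J 0 - o(1)) / d), and by at least exp (- (J om - J 0 + o(1)) / d)
   if one of them lands below om and the other one beyond om.  The orbit of s and
   the connecting orbit of s_c^- reach {x = 0} at the same two heights as, backwards
   in time, those of S_eps(s) and s_c^+.  Comparing the entry gap with the exit gap
   shows that S_eps(s) tends to the point where the slow divergence integrals
   balance, unless that point lies beyond s_c^+: then the entry gap is so small that
   S_eps(s) tends to s_c^+.  As S_eps is increasing and the limit continuous, the
   convergence is uniform on L, which suffices for the integrals against mu_eps. *)

Require Import Defs.
From HB Require Import structures.
From mathcomp Require Import all_boot all_order all_algebra.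
From mathcomp Require Import all_classical all_reals all_analysis.
From mathcomp Require Import ring lra measurable_realfun.
Import Order.TTheory GRing.Theory Num.Theory.
Import numFieldNormedType.Exports.
Import HBNNSimple.
Set Implicit Arguments.
Unset Strict Implicit.
Unset Printing Implicit Defensive.
Local Open Scope classical_set_scope.
Local Open Scope ring_scope.

(** * Barriers for functions of one real variable *)

(** Here [k = 2 n1 - 1], [d = eps ^ (k + 1)] and [c = eps ^ k lambda]. With the height [w = F x - y]
    one has [x' = - w] and [w' = d (x ^ k - c) - F'(x) w]. Away from the contact point [w] is close
    to [d x ^ k / F'(x)], and two orbits, seen as graphs over [X], separate at the logarithmic rate
    [d (X ^ k - c) / (w1 w2)], which is about [J' / d]: hence the slow divergence integral. Near the
    contact point this approximation fails, but a lower bound of order [d] on [w] suffices there,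
    because [J'] is [O(X ^ k)] and that stretch contributes little to the exponent. The lower gap
    estimate is the harder one: one of the two orbits need not be a graph up to the abscissas in
    play, so it is traced back from its crossing while it shadows the other. Two obstacles come from
    the sections: starts close to the contact point have no uniform margin, and the exit section may
    enter the region under the curve; before [s_c^+] the latter is excluded by the first-meeting
    clause of the connecting orbit. *)

Lemma real_induction (R : realType) (P : R -> Prop) (a b : R) :
  P a ->
  (forall t, a <= t < b -> (forall s, a <= s <= t -> P s) ->
     exists2 e, 0 < e & forall s, t < s < t + e -> P s) ->
  (forall t, a < t <= b -> (forall s, a <= s < t -> P s) -> P t) ->
  forall t, a <= t <= b -> P t.
Proof.
move=> Pa open_step closed_step t /andP[at_ tb].
pose A := [set u | a <= u <= b /\ forall s, a <= s <= u -> P s].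
have Aa : A a.
  split=> [|s /andP[? ?]]; first by rewrite lexx (le_trans at_ tb).
  by have -> : s = a by lra.
have supA : has_sup A.
  by split; [exists a | exists b => u [/andP[]]].
pose m := sup A.
have ubm : ubound A m by apply: sup_upper_bound.
have am : a <= m by apply: ubm.
have mb : m <= b by apply: ge_sup; [exists a | move=> u [/andP[]]].
have below : forall s, a <= s < m -> P s.
  move=> s /andP[as_ sm].
  have ms0 : 0 < m - s by lra.
  have [u [_ Pu]] := sup_adherent ms0 supA.
  by rewrite -/m => su; apply: Pu; rewrite as_ /=; lra.
have Pm : forall s, a <= s <= m -> P s.
  move=> s /andP[as_ sm]; have [lt_sm|le_ms] := ltP s m.
    by apply: below; rewrite as_.
  have -> : s = m by lra.
  have [lt_am|le_ma] := ltP a m; last by have -> : m = a by lra.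
  by apply: closed_step => //; rewrite lt_am.
have [lt_mb|le_bm] := ltP m b; last first.
  by apply: Pm; rewrite at_ /= (le_trans tb).
have [|e e0 Pe] := open_step m _ Pm; first by rewrite am.
pose u := Num.min b (m + e / 2).
have um : m < u by rewrite lt_min lt_mb; lra.
have : A u.
  split=> [|s /andP[as_ su]].
    by rewrite ge_min lexx andbT; lra.
  have [sm|ms] := leP s m; first by apply: Pm; rewrite as_.
  by apply: Pe; rewrite ms /=; move: su; rewrite le_min => /andP[_]; lra.
by move/ubm; lra.
Qed.

Lemma continuous_at_eps (R : realType) (f : R -> R) (t e : R) :
  {for t, continuous f} -> 0 < e ->
  exists2 d, 0 < d & forall s, t - d < s < t + d -> `|f s - f t| < e.
Proof.
move=> cf e0.
have /cvgrPdist_lt /(_ e e0) := cf.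
move=> [d /= d0 H]; exists d => // s /andP[s1 s2].
by rewrite distrC; apply: H; rewrite /= ltr_norml; lra.
Qed.

(** A bootstrap: at [t] the weak bound may be assumed on all of [[a, t]], [t] included, and only
    strictness remains to be shown there. A first zero would violate exactly this. *)
Lemma positivity_persists (R : realType) (f : R -> R) (a b : R) :
  (forall t, a <= t <= b -> {for t, continuous f}) -> 0 < f a ->
  (forall t, a <= t <= b -> (forall s, a <= s <= t -> 0 <= f s) -> f t != 0) ->
  forall t, a <= t <= b -> 0 < f t.
Proof.
move=> cf fa nz; apply: real_induction => //.
  move=> t /andP[at_ tb] pos.
  have ft : 0 < f t by apply: pos; rewrite at_ lexx.
  have [|d d0 H] := continuous_at_eps (cf t _) ft; first by rewrite at_ ltW.
  exists d => // s /andP[s1 s2].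
  have : `|f s - f t| < f t by apply: H; lra.
  by rewrite ltr_norml; lra.
move=> t /andP[at_ tb] pos.
have tab : a <= t <= b by rewrite tb ltW.
have ft : 0 <= f t.
  rewrite leNgt; apply/negP => ft.
  have ft' : 0 < - f t by lra.
  have [d d0 H] := continuous_at_eps (cf t tab) ft'.
  pose s := Num.max a (t - d / 2).
  have sa : a <= s by rewrite le_max lexx.
  have st : s < t by rewrite gt_max at_; lra.
  have sd : t - d < s by rewrite lt_max; apply/orP; right; lra.
  have : `|f s - f t| < - f t by apply: H; lra.
  have : 0 < f s by apply: pos; rewrite sa.
  by rewrite ltr_norml; lra.
rewrite lt_neqAle ft andbT eq_sym; apply: nz => // s /andP[as_ st].
have [lt_st|le_ts] := ltP s t; first by apply/ltW/pos; rewrite as_.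
by have -> : s = t by lra.
Qed.

Lemma first_zero (R : realType) (f : R -> R) (a b : R) :
  (forall t, a <= t <= b -> {for t, continuous f}) -> 0 <= f a -> a <= b ->
  f b <= 0 ->
  exists t, [/\ a <= t <= b, f t = 0 & forall s, a <= s <= t -> 0 <= f s].
Proof.
move=> cf fa ab fb.
have [fa0|fa0] := eqVneq (f a) 0.
  exists a; split=> [||s /andP[? ?]]; rewrite ?lexx //.
  by have -> : s = a by lra.
have {}fa : 0 < f a by rewrite lt_neqAle fa eq_sym fa0.
apply: contrapT => none.
suff : 0 < f b by lra.
apply: (@positivity_persists _ f a b) => //; last by rewrite ab lexx.
move=> t tab pos; apply/eqP => ft; apply: none; exists t; split=> //.
Qed.

Lemma continuous_at_opp (R : realType) (f : R -> R) (t : R) :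
  {for - t, continuous f} -> {for t, continuous (fun s => f (- s))}.
Proof.
by move=> cf; apply: (@continuous_comp _ _ _ -%R f t); [exact: opp_continuous | exact: cf].
Qed.

Lemma last_zero (R : realType) (f : R -> R) (a b : R) :
  (forall t, a <= t <= b -> {for t, continuous f}) -> 0 <= f b -> a <= b ->
  f a <= 0 ->
  exists t, [/\ a <= t <= b, f t = 0 & forall s, t <= s <= b -> 0 <= f s].
Proof.
move=> cf fb ab fa.
have [||||t [tab ft pos]] := @first_zero _ (fun s => f (- s)) (- b) (- a).
- by move=> t tab; apply: continuous_at_opp; apply: cf; lra.
- by rewrite opprK.
- lra.
- by rewrite opprK.
exists (- t); split=> [||s sab]; [lra | by [] |].
by rewrite -[s]opprK; apply: pos; lra.
Qed.

Lemma is_derive_ext (R : realType) (f g : R -> R) (t l l' : R) :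
  is_derive t (1 : R) f l -> (forall s, f s = g s) -> l = l' ->
  is_derive t (1 : R) g l'.
Proof. by move=> Df /funext <- <-. Qed.

Lemma is_derive_continuous (R : realType) (f : R -> R) (t l : R) :
  is_derive t (1 : R) f l -> {for t, continuous f}.
Proof.
by move=> H; apply/differentiable_continuous/derivable1_diffP; case: H.
Qed.

Lemma is_derive_gt0 (R : realType) (f : R -> R) (t l : R) :
  is_derive t (1 : R) f l -> 0 < l ->
  exists2 e, 0 < e &
    (forall s, t < s < t + e -> f t < f s) /\
    (forall s, t - e < s < t -> f s < f t).
Proof.
move=> df l0.
have /cvgrPdist_lt /(_ l l0) : h^-1 *: (f (h *: (1 : R) + t) - f t) @[h --> 0^'] --> l.
  by case: df => dv <-; exact: dv.
move=> [e /= e0 H]; exists e => //.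
have key h : h != 0 -> `|h| < e -> 0 < h^-1 * (f (t + h) - f t).
  move=> h0 he; have := H h; rewrite /= sub0r normrN => /(_ he h0).
  rewrite /GRing.scale /= mulr1 [h + t]addrC ltr_norml; lra.
split=> s ste.
  have h0 : 0 < s - t by lra.
  have := key (s - t); rewrite gt_eqF // gtr0_norm // => /(_ isT).
  have -> : t + (s - t) = s by ring.
  rewrite pmulr_rgt0 ?invr_gt0 //; lra.
have h0 : s - t < 0 by lra.
have := key (s - t); rewrite lt_eqF // ltr0_norm // => /(_ isT).
have -> : t + (s - t) = s by ring.
rewrite nmulr_rgt0 ?invr_lt0 //; lra.
Qed.

(** The sign of the derivative matters only at zeros of [g] reached from nonnegative values: there
    [g] becomes positive at once. The assumption on the past makes a priori bounds available inside
    the sign computation. *)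
Lemma barrier (R : realType) (g dg : R -> R) (a b : R) :
  (forall t, a <= t <= b -> is_derive t (1 : R) g (dg t)) -> 0 <= g a ->
  (forall t, a <= t <= b -> (forall s, a <= s <= t -> 0 <= g s) ->
     g t = 0 -> 0 < dg t) ->
  forall t, a <= t <= b -> 0 <= g t.
Proof.
move=> Dg ga bd.
have cg t : a <= t <= b -> {for t, continuous g}.
  by move=> /Dg /is_derive_continuous.
apply: real_induction => //.
  move=> t /andP[at_ tb] pos.
  have tab : a <= t <= b by rewrite at_ ltW.
  have gt0 : 0 <= g t by apply: pos; rewrite at_ lexx.
  have [g0|g0] := eqVneq (g t) 0.
    have [e e0 [He _]] := is_derive_gt0 (Dg t tab) (bd t tab pos g0).
    by exists e => // s /He; rewrite g0 => /ltW.
  have {}gt0 : 0 < g t by rewrite lt_neqAle gt0 eq_sym g0.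
  have [d d0 H] := continuous_at_eps (cg t tab) gt0.
  exists d => // s /andP[s1 s2].
  have : `|g s - g t| < g t by apply: H; lra.
  by rewrite ltr_norml; lra.
move=> t /andP[at_ tb] pos.
have tab : a <= t <= b by rewrite tb ltW.
rewrite leNgt; apply/negP => ft.
have ft' : 0 < - g t by lra.
have [d d0 H] := continuous_at_eps (cg t tab) ft'.
pose s := Num.max a (t - d / 2).
have sa : a <= s by rewrite le_max lexx.
have st : s < t by rewrite gt_max at_; lra.
have sd : t - d < s by rewrite lt_max; apply/orP; right; lra.
have : `|g s - g t| < - g t by apply: H; lra.
have : 0 <= g s by apply: pos; rewrite sa.
by rewrite ltr_norml; lra.
Qed.

Lemma is_derive_reflect (R : realType) (f : R -> R) (t c l : R) :
  is_derive (c - t) (1 : R) f l -> is_derive t (1 : R) (fun s => f (c - s)) (- l).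
Proof.
move=> df.
have dh : is_derive t (1 : R) (fun s : R => c - s) (-1).
  rewrite -[X in is_derive _ _ _ X]add0r.
  exact: is_deriveB.
have := @is_derive1_comp _ f (fun s => c - s) t l (-1) df dh.
by rewrite mulrN1.
Qed.

(** For estimates whose known value sits at the end of the interval: an orbit is traced back from a
    prescribed abscissa. *)
Lemma barrier_backward (R : realType) (g dg : R -> R) (a b : R) :
  (forall t, a <= t <= b -> is_derive t (1 : R) g (dg t)) -> 0 <= g b ->
  (forall t, a <= t <= b -> (forall s, t <= s <= b -> 0 <= g s) ->
     g t = 0 -> dg t < 0) ->
  forall t, a <= t <= b -> 0 <= g t.
Proof.
move=> Dg gb bd t tab.
have : 0 <= (fun s => g (0 - s)) (- t).
  apply: (@barrier _ (fun s => g (0 - s)) (fun s => - dg (0 - s)) (- b) (- a)).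
  - by move=> s sab; apply: is_derive_reflect; apply: Dg; lra.
  - by rewrite sub0r opprK.
  - move=> s sab pos gs.
    suff : dg (0 - s) < 0 by lra.
    apply: bd => //; first lra.
    move=> u uab; have := pos (- u); rewrite sub0r opprK; apply; lra.
  - lra.
by rewrite /= sub0r opprK.
Qed.

Lemma positivity_persists_backward (R : realType) (f : R -> R) (a b : R) :
  (forall t, a <= t <= b -> {for t, continuous f}) -> 0 < f b ->
  (forall t, a <= t <= b -> (forall s, t <= s <= b -> 0 <= f s) -> f t != 0) ->
  forall t, a <= t <= b -> 0 < f t.
Proof.
move=> cf fb nz t tab; rewrite -[t]opprK.
apply: (@positivity_persists _ (fun s => f (- s)) (- b) (- a)).
- by move=> s sab; apply: continuous_at_opp; apply: cf; lra.
- by rewrite opprK.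
- move=> s sab pos; apply: nz; first lra.
  by move=> u uab; rewrite -[u]opprK; apply: pos; lra.
- lra.
Qed.

Lemma is_derive_within_continuous (R : realType) (f df : R -> R) (a b : R) :
  (forall t, a <= t <= b -> is_derive t (1 : R) f (df t)) ->
  {within `[a, b], continuous f}.
Proof.
move=> Df; apply: continuous_in_subspaceT => t.
by rewrite inE /= in_itv /= => /Df /is_derive_continuous.
Qed.

Lemma MVT_cc (R : realType) (f df : R -> R) (a b : R) :
  (forall t, a <= t <= b -> is_derive t (1 : R) f (df t)) -> a < b ->
  exists2 c, a < c < b & f b - f a = df c * (b - a).
Proof.
move=> Df ab.
have [|c] := @MVT _ f df a b ab _ (is_derive_within_continuous Df).
  by move=> x; rewrite in_itv /= => /andP[? ?]; apply: Df; rewrite !ltW.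
by rewrite in_itv /= => cab E; exists c.
Qed.

Lemma nondecreasing_is_derive (R : realType) (f df : R -> R) (a b : R) :
  (forall t, a <= t <= b -> is_derive t (1 : R) f (df t)) ->
  (forall t, a <= t <= b -> 0 <= df t) ->
  a <= b -> f a <= f b.
Proof.
move=> Df pos; rewrite le_eqVlt => /orP[/eqP -> //|ab].
have [c /andP[c1 c2] E] := MVT_cc Df ab.
rewrite -subr_ge0 E mulr_ge0 ?pos ?subr_ge0 ?ltW ?c1 //.
Qed.

Lemma increasing_is_derive (R : realType) (f df : R -> R) (a b : R) :
  (forall t, a <= t <= b -> is_derive t (1 : R) f (df t)) ->
  (forall t, a < t < b -> 0 < df t) ->
  a < b -> f a < f b.
Proof.
move=> Df pos ab.
have [c /andP[c1 c2] E] := MVT_cc Df ab.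
by rewrite -subr_gt0 E mulr_gt0 ?pos ?subr_gt0 // c1.
Qed.

(** * Orbits landing on the attracting branch *)

(** These properties of the critical curve survive [x -> - x], so that one set of estimates serves
    both branches. [shape_bound] is the flatness of the curve at the contact point; it makes
    [dF x ^+ 2 / x ^+ k] at most [C ^+ 2 * x ^+ k] on []0, K]]. *)
Record critical_shape (R : realType) (k : nat) (F dF : R -> R) (K C : R) : Prop :=
  CriticalShape {
    shape_derive : forall x, is_derive x (1 : R) F (dF x);
    shape_cont : forall x, {for x, continuous dF};
    shape0 : F 0 = 0;
    shape_pos : forall x, 0 < x -> 0 < dF x;
    shape_neg : forall x, x < 0 -> dF x < 0;
    shape_K : 0 < K;
    shape_C : 0 < C;
    shape_bound : forall x, `|x| <= K -> `|dF x| <= C * `|x| ^+ k }.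

(* [rho] separates the slow regime from the contact point: for [x >= rho] the
   constant [c] is dominated by [x ^+ k], and from [x = rho] on a height
   [F x - y] of order [d] can no longer be lost. *)
Definition small (R : realType) (k : nat) (nu d c rho : R) : Prop :=
  [/\ 0 < d < nu, 0 < rho < nu, 2 * `|c| <= rho ^+ k, rho ^+ k.+1 <= nu * d
    & d <= nu * rho ^+ k].

Definition solution (R : realType) (k : nat) (F : R -> R) (d c : R) (a b : R)
    (x y : R -> R) : Prop :=
  forall t, a <= t <= b ->
    is_derive t (1 : R) x (y t - F (x t)) /\
    is_derive t (1 : R) y (d * (c - x t ^+ k)).

Lemma small_weaken (R : realType) (k : nat) (nu nu' d c rho : R) :
  nu <= nu' -> small k nu d c rho -> small k nu' d c rho.
Proof.
move=> nn [/andP[d0 dn] /andP[r0 rn] c1 r1 d1]; split=> //.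
- by rewrite d0 (lt_le_trans dn).
- by rewrite r0 (lt_le_trans rn).
- by apply: le_trans r1 _; rewrite ler_pM2r.
- by apply: le_trans d1 _; rewrite ler_pM2r // exprn_gt0.
Qed.

Section HalfOrbit.
Variables (R : realType) (k : nat) (F dF : R -> R) (K C : R).
Hypothesis shape : critical_shape k F dF K C.

Lemma sub_solution (d c a b a' b' : R) (x y : R -> R) : a <= a' -> b' <= b ->
  solution k F d c a b x y -> solution k F d c a' b' x y.
Proof. by move=> aa bb S t /andP[? ?]; apply: S; lra. Qed.

Lemma solution_continuous (d c a b : R) (x y : R -> R) : solution k F d c a b x y ->
  forall t, a <= t <= b -> {for t, continuous x}.
Proof. by move=> S t /S [/is_derive_continuous]. Qed.

(** The height gains from the drift [d * (x ^+ k - c)] and loses by the contraction [dF x] towards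
    the branch. *)
Lemma height_derive (d c a b : R) (x y : R -> R) (t : R) :
  solution k F d c a b x y -> a <= t <= b ->
  is_derive t (1 : R) (fun t => F (x t) - y t)
    (d * (x t ^+ k - c) - dF (x t) * (F (x t) - y t)).
Proof.
move=> S /S [Dx Dy].
have DF := @is_derive1_comp _ F x t _ _ (shape_derive shape (x t)) Dx.
have := is_deriveB DF Dy.
by congr is_derive; ring.
Qed.

Lemma height_continuous (d c a b : R) (x y : R -> R) : solution k F d c a b x y ->
  forall t, a <= t <= b -> {for t, continuous (fun t => F (x t) - y t)}.
Proof. by move=> S t tab; apply: is_derive_continuous (height_derive S tab). Qed.

Lemma shape_nondec_pos (u v : R) : 0 <= u -> u <= v -> F u <= F v.
Proof.
move=> u0 uv; have [->//|uv'] := eqVneq u v.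
apply/ltW; apply: (@increasing_is_derive _ F dF) => [t _|t /andP[ut _]|].
- exact: shape_derive shape t.
- by apply: shape_pos shape _ _; lra.
- by rewrite lt_neqAle uv'.
Qed.

Lemma shape_inc_pos (u v : R) : 0 <= u -> u < v -> F u < F v.
Proof.
move=> u0 uv.
apply: (@increasing_is_derive _ F dF) => [t _|t /andP[ut _]|//].
- exact: shape_derive shape t.
- by apply: shape_pos shape _ _; lra.
Qed.

Lemma shape_dec_neg (u v : R) : v <= 0 -> u < v -> F v < F u.
Proof.
move=> u0 uv.
have : (fun x => - F x) u < (fun x => - F x) v.
  apply: (@increasing_is_derive _ (fun x => - F x) (fun x => - dF x)).
  - by move=> t _; apply: is_deriveN; exact: shape_derive shape t.
  - by move=> t /andP[_ tv]; rewrite oppr_gt0; apply: shape_neg shape _ _; lra.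
  - by [].
by rewrite /= ltrN2.
Qed.

Lemma shape_ge0 (x : R) : 0 <= F x.
Proof.
rewrite -(shape0 shape); have [x0|x0|<-//] := ltgtP 0 x.
  by apply: shape_nondec_pos => //; exact: ltW.
by apply/ltW/shape_dec_neg.
Qed.

Lemma small_drift (nu d c rho x : R) : small k nu d c rho -> rho <= x ->
  0 < x ^+ k / 2 /\ x ^+ k / 2 <= x ^+ k - c.
Proof.
move=> [_ /andP[r0 _] c1 _ _] rx.
have xk : rho ^+ k <= x ^+ k by rewrite lerXn2r // nnegrE; lra.
have rk : 0 < rho ^+ k by rewrite exprn_gt0.
have := ler_norm c; lra.
Qed.

Lemma shape_bound_pos (x : R) : 0 <= x <= K -> dF x <= C * x ^+ k.
Proof.
move=> /andP[x0 xK]; apply: le_trans (ler_norm _) _.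
have := shape_bound shape (x := x); rewrite (ger0_norm x0) => H.
exact: H.
Qed.

Lemma shape_deriv_ge0 (x : R) : 0 < x -> 0 <= dF x.
Proof. by move=> x0; apply/ltW/(shape_pos shape). Qed.

(** On the line [w = th * (x t0 - x)] the drift supplies at least [d * x ^+ k / 2], whereas the
    contraction [dF * w] and the slope term [th * w] each take at most a quarter of [d * x ^+ k].
    Hence the height cannot fall below this line. *)
Lemma descent_outer (nu d c rho t0 t1 : R) (x y : R -> R) :
  small k nu d c rho -> nu < 4 * C ^+ 2 * x t0 -> rho <= x t0 -> x t0 <= K ->
  solution k F d c t0 t1 x y -> 0 <= F (x t0) - y t0 ->
  (forall t, t0 <= t <= t1 -> rho <= x t) ->
  forall t, t0 <= t <= t1 ->
    [/\ x t <= x t0, 0 <= F (x t) - y t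
      & d / (4 * C * x t0) * (x t0 - x t) <= F (x t) - y t].
Proof.
move=> sm nuC rb bK S w0 xr.
have C0 := shape_C shape.
have [/andP[d0 dn] /andP[r0 rn] c1 r1 d1] := sm.
have b0 : 0 < x t0 by lra.
have wpos t : t0 <= t <= t1 -> 0 <= F (x t) - y t.
  apply: (barrier (fun t => height_derive S (t := t))) => // s st _ ->.
  have [p q] := small_drift sm (xr s st); rewrite mulr0 subr0 pmulr_rgt0 //; lra.
have xb t : t0 <= t <= t1 -> x t <= x t0.
  move=> /andP[t0t tt1].
  have : - x t0 <= - x t; last by rewrite lerN2.
  apply: (@nondecreasing_is_derive _ (fun s => - x s) (fun s => - (y s - F (x s)))) => //.
    by move=> s /andP[? ?]; apply: is_deriveN; apply: (S s _).1; lra.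
  by move=> s /andP[? ?]; rewrite opprB; apply: wpos; lra.
move=> t tt; split; [exact: xb|exact: wpos|].
rewrite -subr_ge0; set th := d / _.
have th0 : 0 < th by rewrite divr_gt0 // !mulr_gt0.
pose dg s := (d * (x s ^+ k - c) - dF (x s) * (F (x s) - y s)) + th * (y s - F (x s)).
apply: (@barrier _ (fun s => F (x s) - y s - th * (x t0 - x s)) dg t0 t1) => //.
- move=> s ss.
  have H1 := height_derive S ss.
  have H2 := is_deriveZ th (is_deriveB (is_derive_cst (x t0) s 1) (S s ss).1).
  have := is_deriveB H1 H2; congr is_derive.
  by rewrite /dg /GRing.scale /=; ring.
- by rewrite subrr mulr0 subr0.
move=> s ss _ /eqP; rewrite subr_eq0 => /eqP E.
rewrite /dg -[y s - F (x s)]opprB mulrN E.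
have [p q] := small_drift sm (xr s ss).
have xs0 : 0 < x s by apply: lt_le_trans (xr s ss).
have xk0 : 0 < x s ^+ k by rewrite exprn_gt0.
have rk : rho ^+ k <= x s ^+ k by rewrite lerXn2r ?nnegrE ?xr // ltW.
have w1 : th * (x t0 - x s) <= d / (4 * C).
  have -> : d / (4 * C) = th * x t0 by rewrite /th; field; rewrite !gt_eqF.
  by rewrite ler_pM2l //; lra.
have w2 : 0 <= th * (x t0 - x s) by rewrite -E wpos.
have B1 : dF (x s) * (th * (x t0 - x s)) <= d * (x s ^+ k / 4).
  apply: (@le_trans _ _ (C * x s ^+ k * (d / (4 * C)))).
    apply: ler_pM => //; first exact: shape_deriv_ge0.
    by apply: shape_bound_pos; rewrite ltW //= (le_trans (xb s ss)).
  by rewrite le_eqVlt; apply/orP; left; apply/eqP; field; rewrite gt_eqF.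
have B2 : th * (th * (x t0 - x s)) < d * (x s ^+ k / 4).
  apply: (@le_lt_trans _ _ (th * (d / (4 * C)))); first by rewrite ler_pM2l.
  have -> : th * (d / (4 * C)) = d * (d / (16 * C ^+ 2 * x t0)).
    by rewrite /th; field; rewrite !gt_eqF.
  rewrite ltr_pM2l // ltr_pdivrMr; last by rewrite !mulr_gt0 // exprn_gt0.
  apply: (@le_lt_trans _ _ (nu * x s ^+ k)).
    by apply: le_trans d1 _; rewrite ler_pM2l //; lra.
  have -> : x s ^+ k / 4 * (16 * C ^+ 2 * x t0) = (4 * C ^+ 2 * x t0) * x s ^+ k by field.
  by rewrite ltr_pM2r.
have B3 : d * (x s ^+ k / 2) <= d * (x s ^+ k - c) by rewrite ler_pM2l.
lra.
Qed.

(** Below [rho] the drift may be negative, so some loss of height must be allowed: it is linear in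
    [x] with slope [A], and over the length [rho] it uses up at most half of [d / (8 * C)]. *)
Lemma descent_inner (nu d c rho t1 t2 : R) (x y : R -> R) :
  small k nu d c rho -> nu <= ((17 * C) ^+ 2)^-1 -> rho <= K ->
  x t1 = rho ->
  solution k F d c t1 t2 x y -> d / (8 * C) <= F (x t1) - y t1 ->
  (forall t, t1 <= t <= t2 -> 0 <= x t) ->
  forall t, t1 <= t <= t2 ->
    x t <= rho /\ d / (16 * C) <= F (x t) - y t.
Proof.
move=> sm nuC rK xt1 S w1 xpos.
have C0 := shape_C shape.
have [/andP[d0 dn] /andP[r0 rn] c1 r1 d1] := sm.
have rk0 : 0 < rho ^+ k by rewrite exprn_gt0.
(* [17 = 16 + 1]: for [w >= d / (16 * C)] the part [16 * C * rho ^+ k * w] outweighs the worst drift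
   [- d * rho ^+ k / 2], and the part [C * rho ^+ k * w] covers [dF * w]. *)
pose A := 17 * C * rho ^+ k.
have A0 : 0 < A by rewrite !mulr_gt0.
have Ar : A * rho <= d / (16 * C).
  have -> : A * rho = 17 * C * rho ^+ k.+1 by rewrite /A exprSr; ring.
  rewrite ler_pdivlMr ?mulr_gt0 //.
  have C17 : 0 < (17 * C) ^+ 2 by rewrite exprn_gt0 // mulr_gt0.
  have r17 : rho ^+ k.+1 * (17 * C) ^+ 2 <= d.
    rewrite -ler_pdivlMr //; apply: le_trans r1 _.
    by rewrite mulrC ler_pM2l.
  apply: le_trans r17; rewrite [X in _ <= X](_ : _ = 17 * C * rho ^+ k.+1 * (17 * C)).
    by rewrite ler_pM2l ?mulr_gt0 ?exprn_gt0 //; lra.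
  by ring.
clear nuC r1 d1.
pose g t := F (x t) - y t - (d / (8 * C) - A * (rho - x t)).
(* Staying left of [rho] and keeping the height support each other: the first follows from the
   second on the past, and is used in turn where [g] vanishes. *)
have xrho t3 : t3 <= t2 -> (forall s, t1 <= s <= t3 -> 0 <= g s) ->
    forall s, t1 <= s <= t3 -> x s <= rho.
  move=> t32 pos s st; rewrite -subr_ge0.
  apply: (@barrier _ (fun s => rho - x s) (fun s => F (x s) - y s) t1 t3) => //.
  - move=> u ut; have [|Dx _] := S u; first lra.
    have := is_deriveB (is_derive_cst rho u (1 : R)) Dx.
    by rewrite sub0r opprB.
  - by rewrite xt1 subrr.
  move=> u ut _ E; have := pos u ut; rewrite /g E mulr0.
  have : 0 < d / (8 * C) by rewrite divr_gt0 // mulr_gt0.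
  lra.
have hC : d / (16 * C) = d / (8 * C) / 2 by field; rewrite gt_eqF.
have hC0 : 0 < d / (8 * C) by rewrite divr_gt0 // mulr_gt0.
have gpos t : t1 <= t <= t2 -> 0 <= g t.
  pose dg s := (d * (x s ^+ k - c) - dF (x s) * (F (x s) - y s)) + A * (F (x s) - y s).
  apply: (@barrier _ g dg t1 t2).
  - move=> s ss.
    have H1 := height_derive S ss.
    have H2 := is_deriveZ A (is_deriveB (is_derive_cst rho s 1) (S s ss).1).
    have := is_deriveB H1 (is_deriveB (is_derive_cst (d / (8 * C)) s 1) H2).
    by congr is_derive; rewrite /dg /GRing.scale /=; ring.
  - by rewrite /g xt1 subrr mulr0 subr0 -xt1 subr_ge0.
  move=> s ss pos gs.
  have xr : x s <= rho by apply: (xrho s) => //; lra.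
  have xs0 : 0 <= x s by apply: xpos.
  have Bx : A * (rho - x s) <= d / (16 * C).
    by apply: le_trans Ar; rewrite ler_pM2l //; lra.
  have Bx0 : 0 <= A * (rho - x s) by rewrite mulr_ge0 //; lra.
  have Ew : F (x s) - y s = d / (8 * C) - A * (rho - x s) by move: gs; rewrite /g; lra.
  rewrite /dg; set w := F (x s) - y s in Ew *.
  have w_lo : d / (16 * C) <= w by lra.
  have w0 : 0 < w by lra.
  have xk : x s ^+ k <= rho ^+ k by rewrite lerXn2r ?nnegrE // ltW.
  have xk0 : 0 <= x s ^+ k by rewrite exprn_ge0.
  have B1 : dF (x s) * w <= C * rho ^+ k * w.
    rewrite ler_pM2r //; apply: (@le_trans _ _ (C * x s ^+ k)).
      by apply: shape_bound_pos; rewrite xs0 (le_trans xr).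
    by rewrite ler_pM2l.
  have B2 : - (d * (rho ^+ k / 2)) <= d * (x s ^+ k - c).
    by rewrite -mulrN ler_pM2l //; have := ler_norm c; lra.
  have B3 : rho ^+ k * d <= 16 * C * rho ^+ k * w.
    have -> : rho ^+ k * d = 16 * C * rho ^+ k * (d / (16 * C)).
      by field; rewrite gt_eqF.
    by rewrite ler_pM2l // !mulr_gt0.
  have B4 : 0 < rho ^+ k * d by rewrite mulr_gt0.
  have B5 : A * w = 16 * C * rho ^+ k * w + C * rho ^+ k * w by rewrite /A; ring.
  rewrite B5; lra.
move=> t tt.
have xr : x t <= rho.
  by apply: (xrho t2) => //; exact: gpos.
split=> //; have := gpos t tt; rewrite /g => gt0.
have xs0 : 0 <= x t by apply: xpos.
have : A * (rho - x t) <= d / (16 * C).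
  by apply: le_trans Ar; rewrite ler_pM2l //; lra.
lra.
Qed.

Lemma descent (nu d c rho t0 T : R) (x y : R -> R) :
  small k nu d c rho -> nu < 4 * C ^+ 2 * x t0 -> nu <= ((17 * C) ^+ 2)^-1 ->
  2 * rho <= x t0 -> x t0 <= K ->
  solution k F d c t0 T x y -> 0 <= F (x t0) - y t0 ->
  (forall t, t0 <= t < T -> ~ (x t = 0 /\ y t < 0)) ->
  forall t, t0 <= t <= T ->
    0 <= x t <= x t0 /\
    d / (16 * C * x t0) * (x t0 - x t) <= F (x t) - y t.
Proof.
move=> sm nuC nuC' rb bK S w0 nocross t /andP[t0t tT].
have C0 := shape_C shape.
have [/andP[d0 dn] /andP[r0 rn] c1 r1 d1] := sm.
set b := x t0; have b0 : 0 < b by rewrite /b; lra.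
have th0 : 0 < d / (16 * C * b) by rewrite divr_gt0 // !mulr_gt0.
have thE : d / (4 * C * b) = 4 * (d / (16 * C * b)).
  by field; rewrite !gt_eqF.
have inner' t1 t3 : x t1 = rho -> solution k F d c t1 t3 x y ->
    d / (8 * C) <= F (x t1) - y t1 -> t1 <= t3 -> (forall s, t1 <= s <= t3 -> 0 <= x s) ->
    x t3 <= rho /\ d / (16 * C) <= F (x t3) - y t3.
  move=> E S' w1 t13 xp.
  have rK : rho <= K by lra.
  by apply: (descent_inner sm nuC' rK E S' w1 xp); rewrite t13 lexx.
have outer t3 : t0 <= t3 <= T -> (forall s, t0 <= s <= t3 -> rho <= x s) ->
    x t3 <= b /\ d / (4 * C * b) * (b - x t3) <= F (x t3) - y t3.
  move=> /andP[t03 t3T] xr.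
  have S' : solution k F d c t0 t3 x y by apply: sub_solution S.
  have rb' : rho <= x t0 by lra.
  have [|//] := descent_outer sm nuC rb' bK S' w0 xr (t := t3).
  by rewrite t03 lexx.
clear nuC nuC' dn rn c1 r1 d1.
have [xr|] := pselect (forall s, t0 <= s <= t -> rho <= x s).
  have [|xb wb] := outer t _ xr; first by rewrite t0t.
  have xt : rho <= x t by apply: xr; rewrite t0t lexx.
  split; first by rewrite xb andbT; lra.
  apply: le_trans wb; rewrite thE -mulrA -/b.
  have : 0 <= d / (16 * C * b) * (b - x t) by apply: mulr_ge0; [exact: ltW | lra].
  lra.
move=> /existsNP [s /not_implyP [/andP[s0 st] /negP]]; rewrite -ltNge => xs.
have [||||t1 [/andP[t01 t1s] xt1 pos1]] := @first_zero _ (fun s => x s - rho) t0 s.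
- move=> u /andP[u0 us]; apply: continuousB; last exact: cst_continuous.
  by apply: (solution_continuous S); rewrite u0 (le_trans us) // (le_trans st).
- by rewrite subr_ge0; lra.
- by [].
- by rewrite subr_le0 ltW.
have {}xt1 : x t1 = rho by lra.
have [|u /pos1|xb1 wb1] := outer t1; [by rewrite t01 (le_trans t1s) // (le_trans st) | lra |].
(* At arrival [x = rho <= b / 2], so the outer line leaves the height [d / (4 * C * b) * (b / 2)],
   the one required by [descent_inner]. *)
have w1 : d / (8 * C) <= F (x t1) - y t1.
  apply: le_trans wb1; rewrite xt1.
  have -> : d / (8 * C) = d / (4 * C * b) * (b / 2) by field; rewrite !gt_eqF.
  by rewrite ler_pM2l ?divr_gt0 ?mulr_gt0 // /b; lra.
have dC0 : 0 < d / (16 * C) by rewrite divr_gt0 // mulr_gt0.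
have inner t3 : t1 <= t3 <= t -> (forall s, t1 <= s <= t3 -> 0 <= x s) ->
    x t3 <= rho /\ d / (16 * C) <= F (x t3) - y t3.
  move=> /andP[t13 t3t] xp.
  have S' : solution k F d c t1 t3 x y by apply: sub_solution S => //; lra.
  exact: (inner' t1 t3 xt1 S' w1 t13 xp).
(* At a first zero of [x] the inner estimate makes [F 0 - y = - y] positive: that would be a
   crossing of [{x = 0, y < 0}] before [T]. *)
have xp : forall s, t1 <= s <= t -> 0 <= x s.
  move=> u /andP[u1 ut]; rewrite leNgt; apply/negP => xu.
  have [||||t2 [/andP[t12 t2u] xt2 pos2]] := @first_zero _ x t1 u.
  - by move=> v /andP[v0 vs]; apply: (solution_continuous S); lra.
  - by rewrite xt1 ltW.
  - by [].
  - by rewrite ltW.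
  have [|//|_ w2] := inner t2; first lra.
  apply: (nocross t2).
    rewrite (le_trans t01) //=; apply: lt_le_trans tT; apply: lt_le_trans ut.
    rewrite lt_neqAle t2u andbT; apply/eqP => E; move: xu; rewrite -E xt2; lra.
  split=> //; move: w2; rewrite xt2 (shape0 shape); lra.
have [|//|xr w2] := inner t.
  by rewrite lexx andbT; lra.
have xt : 0 <= x t by apply: xp; rewrite lexx andbT; lra.
split; first by rewrite xt /= /b; lra.
apply: le_trans w2.
have -> : d / (16 * C) = d / (16 * C * b) * b by field; rewrite !gt_eqF.
by rewrite ler_pM2l //; lra.
Qed.

End HalfOrbit.

(** * Half orbits from a start to the crossing *)

(** [tau < T] keeps a piece of the orbit beyond the crossing, which later makes the orbit a
    differentiable graph on a full neighbourhood of [x = 0]. *)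
Record half_orbit (R : realType) (k : nat) (F : R -> R) (d c T tau : R)
    (x y : R -> R) : Prop := HalfOrbit {
  orbit_times : 0 < tau < T;
  orbit_solution : solution k F d c 0 T x y;
  orbit_end : x tau = 0;
  orbit_end_lt0 : y tau < 0;
  orbit_nocross : forall t, 0 <= t < tau -> ~ (x t = 0 /\ y t < 0) }.

(* The fast flow leads from [(X, Y)] to the attracting branch, with margin [v]. *)
Definition good_start (R : realType) (F : R -> R) (K v X Y : R) : Prop :=
  [/\ - K <= X <= K, Y + v <= F K, 0 <= X \/ F X <= Y - v & v <= Y].

Section GoodOrbits.
Variables (R : realType) (k : nat) (F dF : R -> R) (K C : R).
Hypothesis shape : critical_shape k F dF K C.

(** While [y - F x >= v / 2], [x] advances at least at that speed, so the slow change of [y] is paid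
    for by the displacement of [x], which is at most [2 * K]. Comparing with [x] avoids any bound on
    the time spent. *)
Lemma fast_phase (d c a b v x1 : R) (x y : R -> R) :
  0 < d -> `|c| <= 1 -> 0 < v -> - K <= x a -> x1 <= K ->
  32 * (K ^+ k + 1) * K * d <= v ^+ 2 ->
  solution k F d c a b x y ->
  (forall u, x a <= u <= x1 -> F u <= y a - v) ->
  (forall t, a <= t <= b -> x t <= x1) ->
  forall t, a <= t <= b ->
    `|y t - y a| <= 8 * (K ^+ k + 1) / v * K * d /\ v / 2 <= y t - F (x t).
Proof.
move=> d0 c1 v0 xaK x1K dsmall S Fv xx1.
have K0 := shape_K shape.
pose m := K ^+ k + 1.
have m0 : 1 <= m by rewrite lerDr exprn_ge0 // ltW.
(* [M * (v / 2) = 2 * m], so [M * d * x'] exceeds the largest possible speed [d * m] of [y]. The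
   assumption on [v ^+ 2] makes the total change of [y] at most [v / 4], which closes the bootstrap
   on [v / 2]. *)
pose M := 4 * m / v.
have M0 : 0 < M by rewrite divr_gt0 // mulr_gt0 //; lra.
have Mv : M * v = 4 * m by rewrite /M; field; rewrite gt_eqF.
have boundE : 8 * (K ^+ k + 1) / v * K * d = M * d * (2 * K).
  by rewrite /M -/m; field; rewrite gt_eqF.
have bound4 : M * d * (2 * K) <= v / 4.
  rewrite -(ler_pM2l v0).
  have -> : v * (M * d * (2 * K)) = (M * v) * d * (2 * K) by ring.
  rewrite Mv; have -> : v * (v / 4) = v ^+ 2 / 4 by field.
  move: dsmall; rewrite -/m; lra.
have claim t : a <= t <= b -> (forall s, a <= s <= t -> v / 2 <= y s - F (x s)) ->
    x a <= x t /\ `|y t - y a| <= M * d * (2 * K).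
  move=> /andP[at_ tb] past.
  have xinc s : a <= s <= t -> x a <= x s.
    move=> /andP[as_ st].
    apply: (@nondecreasing_is_derive _ x (fun s => y s - F (x s))) => //.
      by move=> u /andP[u1 u2]; apply: (S u _).1; lra.
    by move=> u /andP[u1 u2]; have := past u; lra.
  have xat : x a <= x t by apply: xinc; rewrite at_ lexx.
  have xtK : x t <= x1 by apply: xx1; rewrite at_.
  have pow s : a <= s <= t -> `|c - x s ^+ k| <= m.
    move=> st; apply: le_trans (ler_normB _ _) _; rewrite addrC lerD //.
    rewrite normrX lerXn2r ?nnegrE ?(ltW K0) // ler_norml.
    have := xinc s st; have := xx1 s; lra.
  have up (e : R) : `|e| = 1 -> 0 <= e * (y t - y a) + M * d * (x t - x a).
    move=> e1.
    pose g s := e * (y s - y a) + M * d * (x s - x a).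
    have ga : g a = 0 by rewrite /g !subrr !mulr0 addr0.
    rewrite -[X in X <= _]ga -/(g t).
    apply: (@nondecreasing_is_derive _ g
      (fun s => e * (d * (c - x s ^+ k)) + M * d * (y s - F (x s)))) => //.
      move=> s /andP[s1 s2]; have [|Dx Dy] := S s; first lra.
      have H1 := is_deriveZ e (is_deriveB Dy (is_derive_cst (y a) s (1 : R))).
      have H2 := is_deriveZ (M * d) (is_deriveB Dx (is_derive_cst (x a) s (1 : R))).
      by have := is_deriveD H1 H2; rewrite !subr0.
    move=> s st.
    have e2 : - m <= e * (c - x s ^+ k).
      suff : `|e * (c - x s ^+ k)| <= m by rewrite ler_norml => /andP[].
      by rewrite normrM e1 mul1r; exact: pow.
    have p1 : d * (M * (v / 2)) <= M * d * (y s - F (x s)).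
      have -> : M * d * (y s - F (x s)) = d * (M * (y s - F (x s))) by ring.
      by rewrite ler_pM2l // ler_pM2l //; exact: past.
    have p2 : d * (- m) <= d * (e * (c - x s ^+ k)) by rewrite ler_pM2l.
    have p3 : M * (v / 2) = 2 * m by rewrite mulrA Mv; field.
    rewrite p3 in p1.
    have p4 : 0 < d * m by rewrite mulr_gt0 //; lra.
    lra.
  split=> //.
  have u1 := up 1 (normr1 _); have u2 := up (- 1) _.
  rewrite normrN normr1 in u2; have {}u2 := u2 erefl.
  have : M * d * (x t - x a) <= M * d * (2 * K).
    by rewrite (ler_pM2l (mulr_gt0 M0 d0)); lra.
  by rewrite ler_norml; lra.
have pos : forall t, a <= t <= b -> 0 < (y t - F (x t)) - v / 2.
  have [ab|ab] := leP a b; last by move=> t; lra.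
  apply: (@positivity_persists _ (fun t => (y t - F (x t)) - v / 2)).
  - move=> t tab; apply: continuousB; last exact: cst_continuous.
    have := height_continuous shape S tab => /continuousN.
    by rewrite [X in {for _, continuous X} -> _](_ : _ = fun t => y t - F (x t)) //;
      apply/funext => s /=; rewrite opprB.
  - have := Fv (x a); have := xx1 a; rewrite !lexx ab /= => /(_ isT) -> /(_ isT); lra.
  move=> t tab past.
  have [|H1 H2] := claim t tab; first by move=> s /past; lra.
  have := Fv (x t); rewrite H1 xx1 // => /(_ isT) Ft.
  by move: H2; rewrite ler_norml => /andP[H2 _]; rewrite gt_eqF //; lra.
move=> t /andP[at_ tb].
have [||H1 H2] := claim t; first by rewrite at_.
  by move=> s /andP[s1 s2]; have := pos s; lra.
by rewrite boundE; split=> //; have := pos t; lra.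
Qed.

Lemma good_start_below (v b X Y u : R) : good_start F K v X Y ->
  0 < b -> F b <= Y - v -> X <= u <= b -> F u <= Y - v.
Proof.
move=> [_ _ XF _] b0 Fb /andP[Xu ub].
have [u0|u0] := leP 0 u.
  by apply: le_trans Fb; exact: shape_nondec_pos shape _ _ u0 ub.
case: XF => [X0|XF]; first lra.
apply: le_trans XF; have [->//|uX] := eqVneq u X.
by apply/ltW/(shape_dec_neg shape); [exact: ltW | rewrite lt_neqAle eq_sym uX].
Qed.

Lemma good_orbit_arrival (d c v b e T tau : R) (x y : R -> R) :
  0 < d -> `|c| <= 1 -> 0 < v -> 0 < b -> b <= K -> 0 <= e -> e <= v / 2 ->
  32 * (K ^+ k + 1) * K * d <= v ^+ 2 ->
  8 * (K ^+ k + 1) / v * K * d <= e ->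
  half_orbit k F d c T tau x y ->
  good_start F K v (x 0) (y 0) -> F b <= y 0 - v ->
  exists t', [/\ 0 <= t' <= tau, b <= x t' &
    forall s, 0 <= s <= t' -> x s <= K /\ y s <= y 0 + e].
Proof.
move=> d0 cle1 v0 b0 bK e0 ev dA dB orb good Fb.
have [/andP[tau0 tauT] S xtau ytau nocross] := orb.
have [/andP[XK KX] YK XF vY] := good.
have [Xb|Xb] := leP b (x 0).
  exists 0; split=> [||s /andP[s1 s2]] //; first by rewrite lexx ltW.
  have -> : s = 0 by apply/eqP; rewrite eq_le s1 s2.
  by split=> //; rewrite lerDl.
have fast t : 0 <= t <= tau -> (forall s, 0 <= s <= t -> x s <= b) ->
    forall s, 0 <= s <= t -> `|y s - y 0| <= e.
  move=> /andP[t0 tt] xb s st.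
  have S' : solution k F d c 0 t x y.
    by apply: sub_solution S => //; apply: le_trans tt (ltW tauT).
  have Fv u : x 0 <= u <= b -> F u <= y 0 - v by apply: good_start_below good b0 Fb.
  have [H _] := fast_phase d0 cle1 v0 XK bK dA S' Fv xb st.
  exact: le_trans dB.
clear dA dB.
(* If [x] stayed at most [b] up to [tau], [y tau] would be within [e <= v / 2] of [y 0 >= v],
   against [y tau < 0]. *)
have [xb|] := pselect (forall s, 0 <= s <= tau -> x s <= b).
  have := fast tau _ xb tau; rewrite lexx (ltW tau0) => /(_ isT isT).
  by rewrite ler_norml; lra.
move=> /existsNP [s /not_implyP [/andP[s0 st] /negP]]; rewrite -ltNge => xs.
have [||||t' [/andP[t'0 t's] xt' pos]] := @first_zero _ (fun s => b - x s) 0 s.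
- move=> u /andP[u0 us]; apply: continuousB; first exact: cst_continuous.
  by apply: (solution_continuous S); lra.
- by rewrite subr_ge0 ltW.
- by [].
- by rewrite subr_le0 ltW.
exists t'; split; [lra|lra|] => u ut.
have xb r : 0 <= r <= t' -> x r <= b by move=> /pos; lra.
have := fast t' _ xb u ut; rewrite t'0 (le_trans t's st) => /(_ isT).
have := xb u ut; rewrite ler_norml; lra.
Qed.

Lemma good_orbit_descent (nu d c rho v b e t' T tau : R) (x y : R -> R) :
  small k nu d c rho -> nu < 4 * C ^+ 2 * b -> nu <= ((17 * C) ^+ 2)^-1 ->
  2 * rho <= b -> 0 < v -> 0 < b -> b <= K -> 0 <= e -> e <= v / 2 ->
  half_orbit k F d c T tau x y ->
  y 0 + v <= F K -> F b <= y 0 - v ->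
  0 <= t' <= tau -> b <= x t' ->
  (forall s, 0 <= s <= t' -> x s <= K /\ y s <= y 0 + e) ->
  exists t1, [/\ 0 <= t1 < tau, x t1 = b, 0 <= F b - y t1,
      (forall t, 0 <= t <= tau -> x t <= K /\ y t <= y 0 + e) &
      (forall t, t1 <= t <= tau -> 0 <= x t <= b /\
         d / (16 * C * b) * (b - x t) <= F (x t) - y t)].
Proof.
move=> sm nu_21 nu_22 rb v0 b0 bK e0 ev orb YK Fb /andP[t'0 t'tau] xt' H'.
have C0 := shape_C shape.
have [/andP[d0 _] /andP[r0 _] _ _ _] := sm.
have [/andP[tau0 tauT] S xtau ytau nocross] := orb.
have dsc t0 : 0 <= t0 -> x t0 = b -> 0 <= F b - y t0 ->
    forall t, t0 <= t <= tau -> 0 <= x t <= b /\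
      d / (16 * C * b) * (b - x t) <= F (x t) - y t.
  move=> t00 E w0; rewrite -E; rewrite -E in nu_21 rb w0 bK.
  apply: (descent shape sm nu_21 nu_22 rb bK _ w0).
    by apply: sub_solution S; [|exact: ltW].
  by move=> s /andP[s1 s2]; apply: nocross; rewrite (le_trans t00).
clear nu_21 nu_22.
have [||||t'' [/andP[t''0 t''tau] xt'' pos'']] :=
    @first_zero _ (fun s => x s - b / 2) t' tau.
- move=> u /andP[u0 us]; apply: continuousB; last exact: cst_continuous.
  by apply: (solution_continuous S); lra.
- lra.
- by [].
- rewrite xtau; lra.
have ydec t : t' <= t <= t'' -> y t <= y 0 + e.
  move=> /andP[tt' tt'']; have [|_] := H' t'; first by rewrite t'0 lexx.
  apply: le_trans; rewrite -lerN2.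
  apply: (@nondecreasing_is_derive _ (fun s => - y s) (fun s => - (d * (c - x s ^+ k)))) => //.
    by move=> s /andP[? ?]; apply: is_deriveN; apply: (S s _).2; lra.
  move=> s /andP[s1 s2]; rewrite -mulrN opprB mulr_ge0 ?(ltW d0) //.
  have rx : rho <= x s by have := pos'' s; lra.
  by have [p q] := small_drift sm rx; lra.
have xK' t : t' <= t <= t'' -> x t <= K.
  move=> tt; rewrite -subr_ge0; move: t tt.
  apply: (@barrier _ (fun s => K - x s) (fun s => F (x s) - y s)).
  - move=> s /andP[s1 s2]; have [|Dx _] := S s; first lra.
    have := is_deriveB (is_derive_cst K s (1 : R)) Dx.
    by rewrite sub0r opprB.
  - by rewrite subr_ge0; have [|] := H' t'; first by rewrite t'0 lexx.
  move=> s st _ E; have -> : x s = K by lra.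
  have := ydec s st; lra.
(* The last visit of [b] before the first passage at [b / 2]: afterwards [x <= b], so [x'] cannot be
   positive at [t1], which gives the nonnegative height from which [descent] starts. *)
have [||||t1 [/andP[t10 t1t''] xt1 pos1]] :=
    @last_zero _ (fun s => b - x s) t' t''.
- move=> u /andP[u0 us]; apply: continuousB; first exact: cst_continuous.
  by apply: (solution_continuous S); lra.
- lra.
- by [].
- by rewrite subr_le0.
have {}xt1 : x t1 = b by lra.
have t1lt : t1 < t''.
  by rewrite lt_neqAle t1t'' andbT; apply/eqP => E; move: xt''; rewrite -E xt1; lra.
have w1 : 0 <= F b - y t1.
  rewrite leNgt; apply/negP => w1.
  have [|Dx _] := S t1; first lra.
  have [|eps eps0 [H _]] := is_derive_gt0 Dx; first by rewrite xt1; lra.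
  pose s := Num.min t'' (t1 + eps / 2).
  have s1 : t1 < s by rewrite lt_min t1lt; lra.
  have s2 : s <= t'' by rewrite ge_min lexx.
  have s3 : s <= t1 + eps / 2 by rewrite ge_min lexx orbT.
  have := H s; have := pos1 s; lra.
have desc := dsc t1 (le_trans t'0 t10) xt1 w1.
exists t1; split=> //; first by rewrite (le_trans t'0) //= (lt_le_trans t1lt).
move=> t /andP[t0 ttau].
have [tt'|tt'] := leP t t'.
  by have [|] := H' t; [rewrite t0|split=> //; lra].
have [tt''|tt''] := leP t t''.
  have tt : t' <= t <= t'' by rewrite ltW.
  by split; [exact: xK' | have := ydec t tt; lra].
have [|/andP[x0 xb] wt] := desc t; first lra.
split; first lra.
have p0 : 0 <= d / (16 * C * b) * (b - x t).
  by rewrite mulr_ge0 ?subr_ge0 // divr_ge0 ?ltW // !mulr_gt0.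
have := shape_nondec_pos shape x0 xb; lra.
Qed.

Lemma good_orbit (v b e : R) : 0 < v -> 0 < b -> 0 < e ->
  exists2 nu, 0 < nu & forall d c rho T tau x y,
    small k nu d c rho -> half_orbit k F d c T tau x y ->
    good_start F K v (x 0) (y 0) -> F b <= y 0 - v ->
    exists t1, [/\ 0 <= t1 < tau, x t1 = b, 0 <= F b - y t1,
      (forall t, 0 <= t <= tau -> x t <= K /\ y t <= y 0 + e) &
      (forall t, t1 <= t <= tau -> 0 <= x t <= b /\
         d / (16 * C * b) * (b - x t) <= F (x t) - y t)].
Proof.
move=> v0 b0 e0.
have K0 := shape_K shape; have C0 := shape_C shape.
pose e' := Num.min e (v / 2).
have e'0 : 0 < e' by rewrite lt_min e0 divr_gt0.
have e'e : e' <= e by rewrite ge_min lexx.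
have e'v : e' <= v / 2 by rewrite ge_min lexx orbT.
have Kk : 0 < K ^+ k + 1 by rewrite ltr_wpDl // exprn_ge0 // ltW.
have p1 : 0 < 32 * (K ^+ k + 1) * K by rewrite !mulr_gt0.
have p2 : 0 < 8 * (K ^+ k + 1) / v * K by rewrite !mulr_gt0 ?invr_gt0.
pose nu1 := Num.min (v ^+ 2 / (32 * (K ^+ k + 1) * K)) (e' / (8 * (K ^+ k + 1) / v * K)).
pose nu2 := Num.min (2 * C ^+ 2 * b) ((17 * C) ^+ 2)^-1.
pose nu := Num.min (Num.min 1 (b / 2)) (Num.min nu1 nu2).
have nu0 : 0 < nu.
  have v2 := exprn_gt0 2 v0; have C2 := exprn_gt0 2 C0.
  have CC : 0 < ((17 * C) ^+ 2)^-1 by rewrite invr_gt0 exprn_gt0 // mulr_gt0.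
  by rewrite !lt_min ltr01 CC !divr_gt0 // !mulr_gt0.
exists nu => // d c rho T tau x y sm orb good Fb.
have [nu_1 nu_b nu_11 nu_12 [nu_21 nu_22]] : [/\ nu <= 1, nu <= b / 2,
    nu <= v ^+ 2 / (32 * (K ^+ k + 1) * K), nu <= e' / (8 * (K ^+ k + 1) / v * K)
    & nu <= 2 * C ^+ 2 * b /\ nu <= ((17 * C) ^+ 2)^-1].
  by rewrite /nu /nu1 /nu2 !ge_min !lexx !orbT /=.
have [/andP[d0 dn] /andP[r0 rn] c1 r1 d1] := sm.
have cle1 : `|c| <= 1.
  have rk1 : rho ^+ k <= 1 by rewrite exprn_ile1 // ltW // (lt_le_trans rn).
  by apply: le_trans rk1; apply: le_trans c1; rewrite ler_peMl // ler1n.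
have dA : 32 * (K ^+ k + 1) * K * d <= v ^+ 2.
  by rewrite mulrC -ler_pdivlMr //; apply: le_trans nu_11; exact: ltW.
have dB : 8 * (K ^+ k + 1) / v * K * d <= e'.
  by rewrite mulrC -ler_pdivlMr //; apply: le_trans nu_12; exact: ltW.
have [_ YK _ _] := good.
have bK : b <= K.
  rewrite leNgt; apply/negP => Kb.
  have := shape_inc_pos shape (ltW K0) Kb.
  by clear -YK Fb v0; lra.
have [t' [t'0 xt' H']] :=
  good_orbit_arrival d0 cle1 v0 b0 bK (ltW e'0) e'v dA dB orb good Fb.
have nuC : nu < 4 * C ^+ 2 * b.
  apply: le_lt_trans nu_21 _; rewrite !ltr_pM2r ?exprn_gt0 // ltr_nat //.
have rb : 2 * rho <= b by clear -rn nu_b; lra.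
have [t1 [? ? ? H1 ?]] := good_orbit_descent sm nuC nu_22 rb v0 b0 bK (ltW e'0) e'v
  orb YK Fb t'0 xt' H'.
exists t1; split=> // t /H1 [? yt]; split=> //.
by apply: le_trans yt _; rewrite lerD2l.
Qed.

End GoodOrbits.

(** * Sharp heights on the slow branch for small parameters *)

(** Acts as a filter on the triples [(d, c, rho)]: thresholds are collected by conjunction and need
    not be named. *)
Definition eventually_small (R : realType) (k : nat) (P : R -> R -> R -> Prop) :=
  exists2 nu, 0 < nu & forall d c rho, small k nu d c rho -> P d c rho.

Lemma eventually_small_and (R : realType) (k : nat) (P Q : R -> R -> R -> Prop) :
  eventually_small k P -> eventually_small k Q ->
  eventually_small k (fun d c rho => P d c rho /\ Q d c rho).
Proof.
move=> [n1 n10 H1] [n2 n20 H2]; exists (Num.min n1 n2).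
  by rewrite lt_min n10.
move=> d c rho sm; split.
- by apply: H1; apply: small_weaken sm; rewrite ge_min lexx.
- by apply: H2; apply: small_weaken sm; rewrite ge_min lexx orbT.
Qed.

Lemma eventually_small_imply (R : realType) (k : nat) (P Q : R -> R -> R -> Prop) :
  eventually_small k P ->
  (forall nu d c rho, small k nu d c rho -> P d c rho -> Q d c rho) ->
  eventually_small k Q.
Proof. by move=> [n n0 H] PQ; exists n => // d c rho sm; apply: (PQ n) => //; exact: H. Qed.

Lemma eventually_small_d (R : realType) (k : nat) (A B : R) : 0 < B ->
  eventually_small k (fun d c rho => A * d < B).
Proof.
move=> B0; have A0 : 0 < `|A| + 1 by rewrite ltr_wpDl.
exists (B / (`|A| + 1)); first by rewrite divr_gt0.
move=> d c rho [/andP[d0 dn] _ _ _ _].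
move: dn; rewrite ltr_pdivlMr // => H; apply: le_lt_trans H.
by rewrite mulrC ler_pM2l //; apply: le_trans (ler_norm _) _; rewrite lerDl.
Qed.

Lemma eventually_small_rho (R : realType) (k : nat) (B : R) : 0 < B ->
  eventually_small k (fun d c rho => rho < B).
Proof. by move=> B0; exists B => // d c rho [_ /andP[]]. Qed.

Lemma eventually_small_c (R : realType) (k : nat) (B : R) : (0 < k)%N -> 0 < B ->
  eventually_small k (fun d c rho => `|c| < B).
Proof.
move=> k0 B0; exists (Num.min 1 B); first by rewrite lt_min ltr01.
move=> d c rho [_ /andP[r0 rn] c1 _ _].
move: rn; rewrite lt_min => /andP[r1 rB].
have H : rho ^+ k <= rho by rewrite -[X in _ <= X]expr1 ler_wiXn2l // ltW.
by have := normr_ge0 c; lra.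
Qed.

Lemma eventually_good_orbit (R : realType) (k : nat) (F dF : R -> R) (K C : R)
    (v b e : R) :
  critical_shape k F dF K C -> 0 < v -> 0 < b -> 0 < e ->
  eventually_small k (fun d c rho => forall T tau x y,
    half_orbit k F d c T tau x y ->
    good_start F K v (x 0) (y 0) -> F b <= y 0 - v ->
    exists t1, [/\ 0 <= t1 < tau, x t1 = b, 0 <= F b - y t1,
      (forall t, 0 <= t <= tau -> x t <= K /\ y t <= y 0 + e) &
      (forall t, t1 <= t <= tau -> 0 <= x t <= b /\
         d / (16 * C * b) * (b - x t) <= F (x t) - y t)]).
Proof.
move=> shape v0 b0 e0; have [nu nu0 H] := good_orbit shape v0 b0 e0.
by exists nu => // d c rho sm T tau x y; apply: H sm.
Qed.

(* On the slow branch [F x - y] is close to [d * x ^+ k / dF x]; in the next two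
   lemmas [m] stands for [xh ^+ k / dF xh]. *)
Lemma slow_height_ge (R : realType) (k : nat) (F dF : R -> R) (K C : R)
    (d c h kap m xh t0 th : R) (x y : R -> R) :
  critical_shape k F dF K C ->
  0 < d -> 0 < h -> 0 < kap < 1 -> 0 < m -> 0 < xh ->
  solution k F d c t0 th x y -> t0 <= th -> x t0 = xh + h -> x th = xh ->
  0 <= F (x t0) - y t0 ->
  (forall t, t0 <= t <= th -> xh <= x t <= xh + h) ->
  (forall u, xh <= u <= xh + h -> dF u * m <= (1 + kap) * u ^+ k) ->
  d * m ^+ 2 / h + `|c| < kap ^+ 2 * xh ^+ k ->
  (1 - kap) * d * m <= F (x th) - y th.
Proof.
move=> shape d0 h0 /andP[kap0 kap1] m0 xh0 S t0th xt0 xth w0 xr qm smallness.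
(* The barrier rises linearly from [0] at [xh + h] to the target at [xh]. On it the contraction
   takes at most the share [(1 - kap) * (1 + kap) = 1 - kap ^+ 2] of [d * x ^+ k]; the remaining
   share [kap ^+ 2] pays for [c] and for the slope term [A * w]. *)
pose A := (1 - kap) * d * m / h.
have kap1' : 0 < 1 - kap by lra.
have A0 : 0 < A by rewrite divr_gt0 // !mulr_gt0.
pose g t := F (x t) - y t - A * (xh + h - x t).
suff : 0 <= g th.
  rewrite /g xth; have -> : A * (xh + h - xh) = (1 - kap) * d * m.
    by rewrite /A; field; rewrite gt_eqF.
  by rewrite subr_ge0.
pose dg s := (d * (x s ^+ k - c) - dF (x s) * (F (x s) - y s)) + A * (y s - F (x s)).
apply: (@barrier _ g dg t0 th); last by rewrite t0th lexx.
- move=> s ss.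
  have H1 := height_derive shape S ss.
  have H2 := is_deriveZ A (is_deriveB (is_derive_cst (xh + h) s 1) (S s ss).1).
  have := is_deriveB H1 H2; congr is_derive.
  by rewrite /dg /GRing.scale /=; ring.
- by rewrite /g xt0 subrr mulr0 subr0 -xt0.
move=> s ss _ gs.
have /andP[x1 x2] := xr s ss.
have E : F (x s) - y s = A * (xh + h - x s) by move: gs; rewrite /g; lra.
have xs0 : 0 < x s by apply: lt_le_trans x1.
rewrite /dg -[y s - F (x s)]opprB mulrN; set w := F (x s) - y s in E *.
have w0' : 0 <= w by rewrite E mulr_ge0 ?(ltW A0) // subr_ge0.
have w1 : w <= (1 - kap) * d * m.
  have -> : (1 - kap) * d * m = A * h by rewrite /A; field; rewrite gt_eqF.
  by rewrite E ler_pM2l //; clear -x1; lra.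
have B1 : dF (x s) * w <= d * ((1 - kap ^+ 2) * x s ^+ k).
  apply: (@le_trans _ _ (dF (x s) * ((1 - kap) * d * m))).
    by apply: ler_wpM2l => //; exact: shape_deriv_ge0 shape _ xs0.
  have -> : dF (x s) * ((1 - kap) * d * m) = ((1 - kap) * d) * (dF (x s) * m) by ring.
  have -> : d * ((1 - kap ^+ 2) * x s ^+ k) = ((1 - kap) * d) * ((1 + kap) * x s ^+ k) by ring.
  by rewrite ler_pM2l ?mulr_gt0 //; apply: qm; rewrite x1.
have B2 : A * w <= d * (d * m ^+ 2 / h).
  apply: (@le_trans _ _ (A * (d * m))).
    rewrite ler_pM2l //; apply: le_trans w1 _; rewrite -mulrA ler_piMl //.
      by rewrite mulr_ge0 // ltW.
    by clear -kap0; lra.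
  have -> : d * (d * m ^+ 2 / h) = (d * m / h) * (d * m) by field; rewrite gt_eqF.
  have -> : A = (1 - kap) * (d * m / h) by rewrite /A; field; rewrite gt_eqF.
  rewrite ler_pM2r ?mulr_gt0 // ler_piMl //; first by rewrite divr_ge0 ?mulr_ge0 // ltW.
  by clear -kap0; lra.
have B3 : xh ^+ k <= x s ^+ k by rewrite lerXn2r ?nnegrE // ltW.
have B4 : kap ^+ 2 * xh ^+ k <= kap ^+ 2 * x s ^+ k by rewrite ler_pM2l ?exprn_gt0.
have B5 : 0 < d * (kap ^+ 2 * x s ^+ k - c - d * m ^+ 2 / h).
  by rewrite mulr_gt0 //; have := ler_norm c; clear -smallness B4; lra.
by clear -B1 B2 B5; lra.
Qed.

Lemma slow_height_le (R : realType) (k : nat) (F dF : R -> R) (K C : R)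
    (d c h kap m M mu xh om th : R) (x y : R -> R) :
  critical_shape k F dF K C ->
  let A := kap * xh ^+ k / (8 * M) in
  0 < d -> 0 < h -> 0 < kap <= 1 -> 0 < m <= M -> 0 < xh -> 0 < mu ->
  solution k F d c 0 th x y -> 0 <= th -> x th = xh ->
  (forall t, 0 <= t <= th -> x t <= K) ->
  (forall u, xh <= u <= xh + h -> u ^+ k <= (1 + kap / 4) * (dF u * m)) ->
  (forall u, xh <= u <= K -> mu <= dF u) ->
  `|c| <= 1 -> `|c| < kap * xh ^+ k / 4 ->
  2 * (K ^+ k + 1) * d < mu * (A * h) ->
  2 * (K ^+ k + 1) * K * d < (F om - F (xh + h)) * (A * h) ->
  F om <= y 0 ->
  F (x th) - y th <= (1 + kap) * d * m.
Proof.
move=> shape A d0 h0 /andP[kap0 kap1] /andP[m0 mM] xh0 mu0 S th0 xth xK qm Fmu c1 csm dsm1 dsm2 Y.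
have K0 := shape_K shape.
have M0 : 0 < M by apply: lt_le_trans mM.
have A0 : 0 < A by rewrite divr_gt0 ?mulr_gt0 // exprn_gt0.
(* Too large a height grows backwards in time: along a line of slope [A] up to the abscissa
   [xh + h], where it exceeds [A * h], a bound independent of [d], and it keeps that order before.
   Then [y] is almost constant in the past, and the orbit would start below the level [F om]. *)
rewrite leNgt; apply/negP => wth.
set theta := (1 + kap) * d * m in wth.
have theta0 : 0 < theta by rewrite !mulr_gt0 //; clear -kap0; lra.
have xge t3 t4 : 0 <= t3 -> t4 <= th -> (forall s, t3 <= s <= t4 -> 0 <= F (x s) - y s) ->
    forall s, t3 <= s <= t4 -> x t4 <= x s.
  move=> t30 t4th pos s /andP[s1 s2]; rewrite -lerN2.
  apply: (@nondecreasing_is_derive _ (fun s => - x s) (fun s => - (y s - F (x s)))) => //.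
    move=> u /andP[u1 u2]; apply: is_deriveN; apply: (S u _).1.
    by rewrite (le_trans t30) ?(le_trans u2) // (le_trans s1).
  by move=> u /andP[u1 u2]; rewrite opprB; apply: pos; rewrite u2 (le_trans s1).
have stageA s0 : 0 <= s0 <= th -> (forall t, s0 <= t <= th -> x t <= xh + h) ->
    forall t, s0 <= t <= th -> theta + A * (x t - xh) <= F (x t) - y t /\ xh <= x t.
  move=> /andP[s00 s0th] xtop.
  have sub t3 : s0 <= t3 -> (forall s, t3 <= s <= th ->
      0 <= F (x s) - y s - (theta + A * (x s - xh))) ->
      forall s, t3 <= s <= th -> xh <= x s.
    move=> s03 past s st; rewrite -subr_ge0; move: s st.
    apply: (@barrier_backward _ (fun s => x s - xh) (fun s => y s - F (x s))).
    - move=> u /andP[u1 u2]; have [|Dx _] := S u.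
        by rewrite u2 (le_trans s00) // (le_trans s03).
      by have := is_deriveB Dx (is_derive_cst xh u (1 : R)); rewrite subr0.
    - by rewrite xth subrr.
    move=> u ut _ E; have := past u ut; rewrite E mulr0.
    by clear -theta0; lra.
  have main t : s0 <= t <= th -> 0 <= F (x t) - y t - (theta + A * (x t - xh)).
    pose dg s := (d * (x s ^+ k - c) - dF (x s) * (F (x s) - y s)) - A * (y s - F (x s)).
    apply: (@barrier_backward _ (fun t => F (x t) - y t - (theta + A * (x t - xh))) dg).
    - move=> s ss.
      have ss' : 0 <= s <= th by clear -ss s00; lra.
      have H1 := height_derive shape S ss'.
      have H2 := is_deriveZ A (is_deriveB (S s ss').1 (is_derive_cst xh s 1)).
      have := is_deriveB H1 (is_deriveD (is_derive_cst theta s 1) H2).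
      by congr is_derive; rewrite /dg /GRing.scale /=; ring.
    - by rewrite xth subrr mulr0 addr0 subr_ge0 -xth ltW.
    move=> s /andP[s1 s2] past gs.
    have x1 : xh <= x s by apply: (sub s s1 past); rewrite lexx.
    have x2 : x s <= xh + h by apply: xtop; rewrite s1.
    have E : F (x s) - y s = theta + A * (x s - xh) by clear -gs; lra.
    rewrite /dg -[y s - F (x s)]opprB; set w := F (x s) - y s in E *.
    have xk0 : xh ^+ k <= x s ^+ k.
      by rewrite lerXn2r ?nnegrE ?(ltW xh0) // (le_trans (ltW xh0)).
    have B0 : A * m <= kap * xh ^+ k / 8.
      have -> : kap * xh ^+ k / 8 = A * M by rewrite /A; field; rewrite gt_eqF.
      by rewrite ler_pM2l.
    have key : x s ^+ k * (1 + kap / 2) - kap * xh ^+ k / 4 <= (1 + kap) * m * (dF (x s) - A).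
      have H := qm (x s); rewrite x1 x2 in H; have {}H := H isT.
      have H' : (1 + kap) / (1 + kap / 4) * x s ^+ k <= (1 + kap) * (dF (x s) * m).
        rewrite mulrAC ler_pdivrMr; last by clear -kap0; lra.
        rewrite -mulrA ler_pM2l; last by clear -kap0; lra.
        by rewrite mulrC.
      have H'' : (1 + kap / 2) * x s ^+ k <= (1 + kap) / (1 + kap / 4) * x s ^+ k.
        rewrite ler_pM2r; last by apply: lt_le_trans xk0; rewrite exprn_gt0.
        rewrite ler_pdivlMr; last by clear -kap0; lra.
        have : 0 <= kap * (1 - kap) by rewrite mulr_ge0 ?subr_ge0 // ltW.
        by clear -kap0; lra.
      have B1 : (1 + kap) * (A * m) <= 2 * (kap * xh ^+ k / 8).
        apply: ler_pM => //; first by clear -kap0; lra.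
          by rewrite mulr_ge0 // ltW.
        by clear -kap1; lra.
      by clear -H' H'' B1; lra.
    have wth' : theta <= w by rewrite E lerDl mulr_ge0 ?(ltW A0) // subr_ge0.
    have p0 : 0 <= dF (x s) - A.
      have : 0 < (1 + kap) * m * (dF (x s) - A).
        apply: lt_le_trans key; have := exprn_gt0 k xh0 => xx.
        have : kap * xh ^+ k <= 1 * xh ^+ k by rewrite ler_pM2r.
        have : 0 < kap * x s ^+ k by rewrite mulr_gt0 // (lt_le_trans _ xk0).
        by clear -xx xk0; lra.
      by rewrite pmulr_rgt0 ?mulr_gt0 // => [/ltW //|]; clear -kap0; lra.
    have q : (dF (x s) - A) * theta <= (dF (x s) - A) * w by rewrite ler_wpM2l.
    have q2 : d * (x s ^+ k * (1 + kap / 2) - kap * xh ^+ k / 4) <= (dF (x s) - A) * theta.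
      have -> : (dF (x s) - A) * theta = d * ((1 + kap) * m * (dF (x s) - A)).
        by rewrite /theta; ring.
      by rewrite ler_pM2l.
    have q3 : 0 < d * (kap * x s ^+ k / 2 - kap * xh ^+ k / 4 + c).
      rewrite mulr_gt0 //.
      have : kap * xh ^+ k <= kap * x s ^+ k by rewrite ler_pM2l.
      have := ler_norm (- c); rewrite normrN; clear -csm; lra.
    by clear -q q2 q3; lra.
  move=> t tt; split; first by have := main t tt; clear; lra.
  move: t tt; apply: (sub s0) => //.
have [xtop|] := pselect (forall t, 0 <= t <= th -> x t <= xh + h).
  (* The start already lies in the window: [y 0 <= F (x 0) <= F (xh + h) < F om]. *)
  have [||w1 w2] := stageA 0 _ xtop 0; rewrite ?lexx ?th0 //.
  have x0 : x 0 <= xh + h by apply: xtop; rewrite lexx.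
  have F1 : F (x 0) <= F (xh + h).
    by apply: (shape_nondec_pos shape) x0; exact: le_trans (ltW xh0) w2.
  have F2 : 0 < F om - F (xh + h).
    have H : 0 < (F om - F (xh + h)) * (A * h).
      apply: le_lt_trans dsm2; rewrite !mulr_ge0 ?(ltW d0) ?(ltW K0) //.
      by rewrite addr_ge0 // exprn_ge0 // ltW.
    by move: H; rewrite pmulr_lgt0 // mulr_gt0.
  have F3 : 0 <= A * (x 0 - xh) by rewrite mulr_ge0 ?(ltW A0) // subr_ge0.
  by clear -w1 F1 F2 F3 Y theta0; lra.
move=> /existsNP [s /not_implyP [/andP[s0 st] /negP]]; rewrite -ltNge => xs.
have [||||s1 [/andP[ss1 s1th] xs1 pos1]] := @last_zero _ (fun t => xh + h - x t) s th.
- move=> u /andP[u0 us]; apply: continuousB; first exact: cst_continuous.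
  by apply: (solution_continuous S); rewrite us (le_trans s0).
- by rewrite xth; clear -h0; lra.
- by [].
- by rewrite subr_le0 ltW.
have {}xs1 : x s1 = xh + h by clear -xs1; lra.
have s10 : 0 <= s1 by apply: le_trans ss1.
have [|t /pos1||w1 _] := stageA s1 _ _ s1; rewrite ?s10 ?lexx ?s1th //.
  by clear; lra.
have {}w1 : A * h <= F (x s1) - y s1.
  by move: w1; rewrite xs1; clear -theta0; lra.
have Ah0 : 0 < A * h by rewrite mulr_gt0.
pose w0 := A * h / 2.
have w00 : 0 < w0 by rewrite divr_gt0.
have m0K : 0 <= K ^+ k by rewrite exprn_ge0 // ltW.
(* Where [w = w0] and [x >= xh + h], the contraction, at least [mu * w0], beats the drift, at most
   [d * (K ^+ k + 1)]; so [w] cannot pass below [w0] backwards in time. *)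
have stageB t : 0 <= t <= s1 -> 0 <= F (x t) - y t - w0.
  pose dg s := d * (x s ^+ k - c) - dF (x s) * (F (x s) - y s).
  apply: (@barrier_backward _ (fun t => F (x t) - y t - w0) dg).
  - move=> u /andP[u0 us1].
    have uu : 0 <= u <= th by rewrite u0 (le_trans us1).
    have := is_deriveB (height_derive shape S uu) (is_derive_cst w0 u (1 : R)).
    by rewrite subr0.
  - by rewrite subr_ge0; apply: le_trans w1; rewrite /w0; clear -Ah0; lra.
  move=> u /andP[u0 us1] past gu.
  have E : F (x u) - y u = w0 by clear -gu; lra.
  have x1 : xh + h <= x u.
    rewrite -xs1; apply: (xge u s1) => //; last by rewrite lexx.
    by move=> r rr; have := past r rr; clear -w00; lra.
  have x2 : x u <= K by apply: xK; rewrite u0 (le_trans us1).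
  rewrite /dg E.
  have mx : mu <= dF (x u) by apply: Fmu; rewrite x2 andbT (le_trans _ x1) // lerDl ltW.
  have B1 : mu * w0 <= dF (x u) * w0 by rewrite ler_pM2r.
  have xu0 : 0 <= x u by apply: le_trans x1; rewrite addr_ge0 // ltW.
  have B2 : x u ^+ k <= K ^+ k by rewrite lerXn2r ?nnegrE // ltW.
  have B3 : d * (x u ^+ k - c) <= d * (K ^+ k + 1).
    by rewrite ler_pM2l //; have := ler_norm (- c); rewrite normrN; clear -c1 B2; lra.
  have B4 : 2 * (mu * w0) = mu * (A * h) by rewrite /w0; field.
  by clear -B1 B3 B4 dsm1; lra.
pose B := (K ^+ k + 1) / w0.
have B0 : 0 < B by rewrite divr_gt0 // ltr_wpDl.
have Bw : B * w0 = K ^+ k + 1 by rewrite /B; field; rewrite gt_eqF.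
(* As in the fast phase, [B] converts the drift of [y] into displacement of [x]: since [w >= w0],
   [y] loses at most [B * d * K] over [[0, s1]]. *)
have yb : y 0 - B * d * x 0 <= y s1 - B * d * x s1.
  apply: (@nondecreasing_is_derive _ (fun t => y t - B * d * x t)
    (fun t => d * (c - x t ^+ k) - B * d * (y t - F (x t)))) => //.
    move=> u /andP[u0 us1]; have [|Dx Dy] := S u; first by rewrite u0 (le_trans us1).
    have H := is_deriveZ (B * d) Dx.
    by have := is_deriveB Dy H.
  move=> u uu; have wu := stageB u uu.
  have x2 : x u <= K by apply: xK; clear -uu s1th; lra.
  have x1 : xh + h <= x u.
    rewrite -xs1; apply: (xge 0 s1) => //.
    by move=> r rr; have := stageB r rr; clear -w00; lra.
  have xu0 : 0 <= x u by apply: le_trans x1; rewrite addr_ge0 // ltW.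
  have B2 : x u ^+ k <= K ^+ k by rewrite lerXn2r ?nnegrE // ltW.
  have -> : d * (c - x u ^+ k) - B * d * (y u - F (x u)) =
      d * (B * (F (x u) - y u) - (x u ^+ k - c)) by ring.
  rewrite mulr_ge0 ?(ltW d0) //.
  have B3 : B * w0 <= B * (F (x u) - y u).
    by rewrite ler_pM2l //; clear -wu; lra.
  by have := ler_norm (- c); rewrite normrN; clear -Bw B3 B2 c1; lra.
have X0 : x 0 <= K by apply: xK; rewrite lexx.
have Bd0 : 0 < B * d by rewrite mulr_gt0.
have P1 : B * d * x 0 <= B * d * K by rewrite ler_pM2l.
have P2 : 0 < B * d * x s1 by rewrite mulr_gt0 // xs1 addr_gt0.
have P3 : B * d * K < F om - F (xh + h).
  rewrite -(ltr_pM2r Ah0); apply: le_lt_trans dsm2.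
  rewrite le_eqVlt; apply/orP; left; apply/eqP.
  by rewrite /B /w0; field; rewrite ?gt_eqF.
by rewrite xs1 in w1; clear -w1 yb P1 P2 P3 Y Ah0; lra.
Qed.

(** Uniform continuity of [dF u / u ^+ k] on the compact [[eta, K]], in the multiplicative form that
    compares slow heights [d * u ^+ k / dF u] at nearby abscissas. *)
Lemma slope_ratio (R : realType) (k : nat) (F dF : R -> R) (K C eta kap : R) :
  critical_shape k F dF K C -> 0 < eta -> 0 < kap ->
  exists2 h, 0 < h & forall u u', eta <= u <= K -> eta <= u' <= K ->
    `|u - u'| <= h -> dF u * u' ^+ k <= (1 + kap) * (dF u' * u ^+ k).
Proof.
move=> shape eta0 kap0.
have := @segment_compact _ eta K.
move/(compact_near_coveringP `[eta, K]).1/(near_covering_withinP `[eta, K]).2.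
move=> /(_ R (0^'+) (fun h u => forall u', eta <= u' <= K ->
  `|u - u'| <= h -> dF u * u' ^+ k <= (1 + kap) * (dF u' * u ^+ k))).
move=> /(_ (at_right_proper_filter _)) [].
  move=> x; rewrite /= in_itv /= => /andP[x1 x2].
  have x0 : 0 < x by apply: lt_le_trans x1.
  pose q z := dF z * (z ^+ k)^-1.
  have cq : {for x, continuous q}.
    apply: (@cvgM _ _ (nbhs x)); first exact: (shape_cont shape).
    by apply: cvgV; [rewrite expf_neq0 // gt_eqF | exact: exprn_continuous].
  have qx : 0 < q x by rewrite divr_gt0 ?exprn_gt0 // (shape_pos shape).
  (* This tolerance is the solution [z] of [q x + z = (1 + kap) * (q x - z)]. *)
  have e0 : 0 < kap * q x / (2 + kap) by apply: divr_gt0; [exact: mulr_gt0 | lra].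
  have [dl dl0 H] := continuous_at_eps cq e0.
  exists (ball x (dl / 2), [set h | 0 < h < dl / 2]).
    split; first by apply: nbhsx_ballx; rewrite divr_gt0.
    exists (dl / 2) => /=; first by rewrite divr_gt0.
    move=> z /=; rewrite sub0r normrN => zl z0; rewrite z0 /=.
    by rewrite (gtr0_norm z0) in zl.
  move=> [u h] /= [bu /andP[h0 hl]]; rewrite in_itv /= => /andP[u1 u2] u' /andP[u1' u2'] uu.
  have u0 : 0 < u by apply: lt_le_trans u1.
  have u0' : 0 < u' by apply: lt_le_trans u1'.
  move: bu; rewrite /ball /= ltr_norml => /andP[bu1 bu2].
  move: uu; rewrite ler_norml => /andP[uu1 uu2].
  have H1 : `|q u - q x| < kap * q x / (2 + kap) by apply: H; lra.
  have H2 : `|q u' - q x| < kap * q x / (2 + kap) by apply: H; lra.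
  have E : kap * q x / (2 + kap) * (2 + kap) = kap * q x by field; rewrite gt_eqF //; lra.
  have key : q u <= (1 + kap) * q u'.
    move: H1 H2 E; set z := kap * q x / (2 + kap).
    rewrite !ltr_norml => /andP[_ H1] /andP[H2 _] E.
    have : (1 + kap) * (q x - z) <= (1 + kap) * q u' by rewrite ler_pM2l; lra.
    lra.
  have -> : dF u * u' ^+ k = q u * (u ^+ k * u' ^+ k).
    by rewrite /q; field; rewrite expf_neq0 // gt_eqF.
  have -> : (1 + kap) * (dF u' * u ^+ k) = (1 + kap) * q u' * (u ^+ k * u' ^+ k).
    by rewrite /q; field; rewrite expf_neq0 // gt_eqF.
  by rewrite ler_pM2r // mulr_gt0 // exprn_gt0.
move=> h /= h0 H; exists (h / 2); first by rewrite divr_gt0.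
move=> u u' u1 u2 uu; apply: (H (h / 2)) => //=.
- by rewrite sub0r normrN gtr0_norm ?divr_gt0 // ltr_pdivrMr // ltr_pMr // ltr1n.
- by rewrite divr_gt0.
Qed.

Lemma slope_min (R : realType) (k : nat) (F dF : R -> R) (K C eta : R) :
  critical_shape k F dF K C -> 0 < eta -> eta <= K ->
  exists2 mu, 0 < mu & forall u, eta <= u <= K -> mu <= dF u.
Proof.
move=> shape eta0 etaK.
have cw : {within `[eta, K], continuous dF}.
  by apply: continuous_subspaceT => x; exact: (shape_cont shape).
have [z zi H] := EVT_min etaK cw.
exists (dF z); first by apply: (shape_pos shape); move: zi; rewrite in_itv /=; lra.
by move=> u ui; apply: H; rewrite in_itv.
Qed.

Lemma slow_orbit (R : realType) (k : nat) (F dF : R -> R) (K C v om b eta kap e : R) :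
  critical_shape k F dF K C -> (0 < k)%N ->
  0 < v -> 0 < b -> b <= K -> v <= F om - F b -> 0 < eta -> eta <= b -> 0 < kap < 1 -> 0 < e ->
  eventually_small k (fun d c rho => forall T tau x y,
    half_orbit k F d c T tau x y ->
    good_start F K v (x 0) (y 0) -> F om <= y 0 ->
    exists t1, [/\ 0 <= t1 < tau, x t1 = b,
      (forall t, 0 <= t <= tau -> x t <= K /\ y t <= y 0 + e),
      (forall t, t1 <= t <= tau -> 0 <= x t <= b /\
         d / (16 * C * b) * (b - x t) <= F (x t) - y t) &
      (forall t, t1 <= t <= tau -> eta <= x t <= b - eta ->
         (1 - kap) * (d * x t ^+ k) <= dF (x t) * (F (x t) - y t)
           <= (1 + kap) * (d * x t ^+ k))]).
Proof.
move=> shape kpos v0 b0 bK Fv eta0 etab /andP[kap0 kap1] e0.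
have C0 := shape_C shape; have K0 := shape_K shape.
have etaK : eta <= K by apply: le_trans bK.
have [mu mu0 Hmu] := slope_min shape eta0 etaK.
have kap4 : 0 < kap / 4 by rewrite divr_gt0.
have [h' h'0 Hh'] := slope_ratio shape eta0 kap4.
pose h := Num.min h' eta.
have h0 : 0 < h by rewrite lt_min h'0.
have hh' : h <= h' by rewrite ge_min lexx.
have heta : h <= eta by rewrite ge_min lexx orbT.
have ek0 : 0 < eta ^+ k by rewrite exprn_gt0.
(* [M] bounds [x ^+ k / dF x] on [[eta, K]], and [A0] bounds the slope of [slow_height_le] from
   below: the smallness of [d] is thus uniform in the abscissa. *)
pose M := K ^+ k / mu.
have M0 : 0 < M by rewrite divr_gt0 ?exprn_gt0.
pose A0 := kap * eta ^+ k / (8 * M).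
have M80 : 0 < 8 * M by apply: mulr_gt0.
have A00 : 0 < A0 by apply: divr_gt0 => //; apply: mulr_gt0.
have := eventually_good_orbit shape v0 b0 e0.
move=> /eventually_small_and /(_ (eventually_small_c kpos ltr01)).
have p1 : 0 < kap * eta ^+ k / 4 by rewrite divr_gt0 ?mulr_gt0.
move=> /eventually_small_and /(_ (eventually_small_c kpos p1)).
have p2 : 0 < kap ^+ 2 * eta ^+ k / 2 by rewrite divr_gt0 ?mulr_gt0 // exprn_gt0.
move=> /eventually_small_and /(_ (eventually_small_c kpos p2)).
move=> /eventually_small_and /(_ (eventually_small_d k (M ^+ 2 / h) p2)).
have p3 : 0 < mu * (A0 * h) by exact: mulr_gt0 mu0 (mulr_gt0 A00 h0).
move=> /eventually_small_and /(_ (eventually_small_d k (2 * (K ^+ k + 1)) p3)).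
have p4 : 0 < v * (A0 * h) by exact: mulr_gt0 v0 (mulr_gt0 A00 h0).
move=> /eventually_small_and /(_ (eventually_small_d k (2 * (K ^+ k + 1) * K) p4)).
move=> /eventually_small_imply; apply=> nu d c rho sm [[[[[[H c1] c2] c3] d1] d2] d3].
move=> T tau x y orb good Y.
have d0 : 0 < d by case: sm => /andP[].
have Fb : F b <= y 0 - v by clear -Y Fv; lra.
have [t1 [/andP[t10 t1tau] xt1 w1 bounds desc]] := H T tau x y orb good Fb.
exists t1; split; rewrite ?t10 //.
move=> th /andP[t1th thtau] /andP[x1 x2].
have [/andP[_ tauT] S _ _ _] := orb.
have xh0 : 0 < x th by apply: lt_le_trans x1.
have dFx : 0 < dF (x th) by apply: shape_pos shape _ xh0.
pose m := x th ^+ k / dF (x th).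
have xhk0 : 0 < x th ^+ k by rewrite exprn_gt0.
have m0 : 0 < m by rewrite divr_gt0.
have xhK : x th <= K by clear -x2 bK eta0; lra.
have mM : m <= M.
  apply: ler_pM => //; [exact: ltW | by rewrite invr_ge0 ltW | |].
    by rewrite lerXn2r ?nnegrE // ltW.
  by rewrite lef_pV2 ?posrE //; apply: Hmu; rewrite x1.
have ek : eta ^+ k <= x th ^+ k by rewrite lerXn2r ?nnegrE // ltW.
have topb : x th + h <= b by clear -x2 heta; lra.
have wpos t : t1 <= t <= tau -> 0 <= F (x t) - y t.
  move=> /desc[/andP[_ xb]]; apply: le_trans.
  by rewrite mulr_ge0 ?subr_ge0 // divr_ge0 ?ltW // !mulr_gt0.
have mono t t' : t1 <= t -> t <= t' -> t' <= tau -> x t' <= x t.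
  move=> a1 a2 a3; rewrite -lerN2.
  apply: (@nondecreasing_is_derive _ (fun s => - x s) (fun s => - (y s - F (x s)))) => //.
    move=> u /andP[u1 u2]; apply: is_deriveN; apply: (S u _).1.
    by rewrite (le_trans t10) ?(le_trans a1) //= ?(le_trans u2) ?(le_trans a3) // ltW.
  move=> u /andP[u1 u2]; rewrite opprB; apply: wpos.
  by rewrite (le_trans a1) //= (le_trans u2).
(* Last visit of [x th + h]: from there to [th] the abscissa stays in the window on which [ratio]
   holds. *)
have [||||t0 [/andP[t10' t0th] xt0 pos]] := @last_zero _ (fun t => x th + h - x t) t1 th.
- move=> u /andP[u0 us]; apply: continuousB; first exact: cst_continuous.
  by apply: (solution_continuous S); clear -u0 us t10 thtau tauT; lra.
- by clear -h0; lra.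
- by [].
- by rewrite xt1; clear -topb; lra.
have {}xt0 : x t0 = x th + h by clear -xt0; lra.
have ratio u : x th <= u <= x th + h ->
    u ^+ k <= (1 + kap / 4) * (dF u * m) /\ dF u * m <= (1 + kap) * u ^+ k.
  move=> /andP[u1 u2].
  have ui : eta <= u <= K by clear -u1 u2 x1 topb bK; lra.
  have xi : eta <= x th <= K by rewrite x1.
  have u0 : 0 < u by clear -u1 xh0; lra.
  split.
    have -> : (1 + kap / 4) * (dF u * m) = (1 + kap / 4) * (dF u * x th ^+ k) / dF (x th).
      by rewrite /m; ring.
    rewrite ler_pdivlMr // mulrC; apply: Hh' => //.
    by rewrite ler_norml; clear -u1 u2 hh' h0; lra.
  rewrite /m mulrA ler_pdivrMr //; apply: (@le_trans _ _ ((1 + kap / 4) * (dF (x th) * u ^+ k))).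
    by apply: Hh' => //; rewrite ler_norml; clear -u1 u2 hh' h0; lra.
  rewrite -mulrA [dF _ * _]mulrC ler_pM2r; last by rewrite mulr_gt0 // exprn_gt0.
  by clear -kap0; lra.
have dm : d * x th ^+ k = d * m * dF (x th) by rewrite /m; field; rewrite gt_eqF.
have th0 : 0 <= th by apply: le_trans t1th.
have -> : (1 - kap) * (d * x th ^+ k) = ((1 - kap) * d * m) * dF (x th) by rewrite dm; ring.
have -> : (1 + kap) * (d * x th ^+ k) = ((1 + kap) * d * m) * dF (x th) by rewrite dm; ring.
rewrite [dF _ * _]mulrC !(ler_pM2r dFx); apply/andP; split.
  apply: (@slow_height_ge _ k F dF K C d c h kap m (x th) t0 th x y shape) => //.
  - by rewrite kap0.
  - by apply: sub_solution S => //; [exact: le_trans t10' | exact: le_trans thtau (ltW tauT)].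
  - by apply: wpos; clear -t10' t0th thtau; lra.
  - move=> t /andP[s1 s2]; have := pos t; rewrite s1 s2 => /(_ isT) p.
    rewrite mono ?(le_trans t10') //=.
    by clear -p; lra.
  - by move=> u /ratio[].
  have B1 : d * m ^+ 2 / h <= M ^+ 2 / h * d.
    rewrite -mulrA [X in _ <= X]mulrC ler_pM2l // ler_pM2r ?invr_gt0 //.
    by rewrite lerXn2r ?nnegrE // ltW.
  have B2 : kap ^+ 2 * eta ^+ k <= kap ^+ 2 * x th ^+ k by rewrite ler_pM2l ?exprn_gt0.
  by clear -B1 B2 d1 c3; lra.
have AA : A0 <= kap * x th ^+ k / (8 * M).
  by rewrite ler_pM2r ?invr_gt0 // ler_pM2l.
have Ah : A0 * h <= kap * x th ^+ k / (8 * M) * h by rewrite ler_pM2r.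
apply: (@slow_height_le _ k F dF K C d c h kap m M mu (x th) om th x y shape) => //.
- by rewrite kap0 ltW.
- by rewrite m0.
- by apply: sub_solution S => //; exact: le_trans thtau (ltW tauT).
- by move=> t /andP[s1 s2]; have [|] := bounds t; first by rewrite s1 (le_trans s2).
- by move=> u /ratio[].
- by move=> u /andP[u1 u2]; apply: Hmu; rewrite u2 (le_trans x1).
- exact: ltW.
- apply: lt_le_trans c2 _; have B2 : kap * eta ^+ k <= kap * x th ^+ k by rewrite ler_pM2l.
  by clear -B2; lra.
- by apply: lt_le_trans d2 _; rewrite ler_pM2l.
- have Fth : F (x th + h) <= F b.
    by apply: (shape_nondec_pos shape) topb; rewrite addr_ge0 // ltW.
  have vF : v <= F om - F (x th + h) by clear -Fth Fv; lra.
  apply: lt_le_trans d3 _; apply: ler_pM => //; first exact: ltW.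
  by rewrite mulr_ge0 // ltW.
Qed.

(** * Orbits as graphs over the abscissa *)

(** A positive height makes [x] strictly decreasing, so time is a function of the abscissa; [phi] is
    [y] in that variable, and its derivative is [y' / x']. *)
Lemma orbit_graph (R : realType) (k : nat) (F dF : R -> R) (K C d c T tau t1 : R)
    (x y : R -> R) :
  critical_shape k F dF K C -> half_orbit k F d c T tau x y ->
  0 <= t1 < tau -> 0 < x t1 ->
  (forall t, t1 <= t <= tau -> 0 < F (x t) - y t) ->
  exists phi sig, [/\ 0 < sig,
    (forall X, - sig < X < x t1 -> 0 < F X - phi X /\
       is_derive X (1 : R) phi (d * (X ^+ k - c) / (F X - phi X))),
    (forall t, t1 <= t <= tau -> y t = phi (x t)),
    (forall X, 0 <= X <= x t1 -> exists2 t, t1 <= t <= tau & x t = X)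
    & phi 0 = y tau].
Proof.
move=> shape [/andP[tau0 tauT] S xtau ytau _] /andP[t10 t1tau] b0 wpos.
have wtau : 0 < F (x tau) - y tau by apply: wpos; rewrite lexx ltW.
have tauT' : 0 <= tau <= T by rewrite !ltW.
have [s s0 Hs] := continuous_at_eps (height_continuous shape S tauT') wtau.
(* By continuity the height is still positive shortly after [tau], which puts [X = 0] in the
   interior of the domain of [phi]. *)
pose t2 := Num.min (tau + s / 2) T.
have t2tau : tau < t2 by rewrite lt_min tauT andbT; lra.
have t2T : t2 <= T by rewrite ge_min lexx orbT.
have t2s : t2 < tau + s.
  by apply: (@le_lt_trans _ _ (tau + s / 2)); [rewrite ge_min lexx | lra].
have t12 : t1 < t2 by apply: lt_trans t2tau.
have {}Hs t : tau <= t <= t2 -> 0 < F (x t) - y t.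
  by move=> tt; have := Hs t; rewrite ltr_norml; clear -tt t2s s0; lra.
have {t2s}wpos2 t : t1 <= t <= t2 -> 0 < F (x t) - y t.
  move=> /andP[tt1 tt2]; have [H|H] := leP t tau; first by apply: wpos; rewrite tt1.
  by apply: Hs; rewrite ltW.
have S' : solution k F d c t1 t2 x y by apply: sub_solution S.
have xdec u v : t1 <= u -> u < v -> v <= t2 -> x v < x u.
  move=> u1 uv v2; rewrite -ltrN2.
  apply: (@increasing_is_derive _ (fun s => - x s) (fun s => - (y s - F (x s)))) => //.
    move=> r /andP[r1 r2]; apply: is_deriveN; apply: (S' r _).1.
    by rewrite (le_trans u1) //= (le_trans r2).
  move=> r /andP[r1 r2]; rewrite opprB; apply: wpos2.
  by rewrite (le_trans u1) ?(ltW r1) //= (le_trans (ltW r2)).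
have xinj u v : t1 <= u <= t2 -> t1 <= v <= t2 -> x u = x v -> u = v.
  move=> /andP[u1 u2] /andP[v1 v2] E; have [uv|uv|//] := ltgtP u v.
    by have := xdec u v u1 uv v2; rewrite E ltxx.
  by have := xdec v u v1 uv u2; rewrite E ltxx.
have xsurj (t3 : R) X : t1 <= t3 <= t2 -> x t3 <= X <= x t1 -> exists2 t, t1 <= t <= t3 & x t = X.
  move=> /andP[t13 t32] /andP[X1 X2].
  have [||||t [tt xt _]] := @first_zero _ (fun s => x s - X) t1 t3.
  - move=> u /andP[u0 us]; apply: continuousB; last exact: cst_continuous.
    by apply: (solution_continuous S'); rewrite u0 (le_trans us).
  - by rewrite subr_ge0.
  - by [].
  - by rewrite subr_le0.
  by exists t => //; apply/eqP; rewrite -subr_eq0 xt.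
(* The default [0] is returned only for abscissas that the orbit does not visit on [[t1, t2]]. *)
pose inv X := xget 0 [set t | t1 <= t <= t2 /\ x t = X].
have invK t : t1 <= t <= t2 -> inv (x t) = t.
  move=> tt; have := @xgetI _ 0 [set u | t1 <= u <= t2 /\ x u = x t] t (conj tt erefl).
  by move=> [H1 H2]; apply: xinj.
have x2neg : x t2 < 0 by rewrite -xtau; apply: xdec; rewrite ?lexx // ltW.
exists (y \o inv), (- x t2); split.
- by rewrite oppr_gt0.
- move=> X; rewrite opprK => /andP[X1 X2].
  have [||t /andP[a1 a2] xt] := xsurj t2 X; rewrite ?lexx ?(ltW t12) ?(ltW X1) ?(ltW X2) //.
  have tt1 : t1 < t.
    by rewrite lt_neqAle a1 andbT; apply/eqP => E; move: X2; rewrite -xt E ltxx.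
  have tt2 : t < t2.
    by rewrite lt_neqAle a2 andbT; apply/eqP => E; move: X1; rewrite -xt E ltxx.
  have tt : t1 <= t <= t2 by rewrite a1.
  have Ephi : (y \o inv) X = y t by rewrite /= -xt invK.
  rewrite Ephi -xt; split; first exact: wpos2.
  have [Dx Dy] := S' t tt.
  have nz : y t - F (x t) != 0 by have := wpos2 t tt => w0; rewrite lt_eqF // -opprB oppr_lt0.
  have nearT : \forall u \near t, t1 < u < t2.
    by apply: (@near_in_itvoo _ t1 t2); rewrite in_itv /= tt1.
  have Dinv : is_derive (x t) (1 : R) inv (y t - F (x t))^-1.
    apply: is_derive_inverse => //.
      by near=> u; apply: invK; have /andP[? ?] : t1 < u < t2 by [near: u]; rewrite !ltW.
    near=> u; apply: (solution_continuous S').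
    by have /andP[? ?] : t1 < u < t2 by [near: u]; rewrite !ltW.
  have Dy' : is_derive (inv (x t)) (1 : R) y (d * (c - x t ^+ k)) by rewrite invK.
  have := @is_derive1_comp _ y inv (x t) _ _ Dy' Dinv.
  congr is_derive.
  by rewrite -[F _ - _]opprB -[X in _ = d * X / _]opprB invrN; ring.
- by move=> t /andP[a1 a2]; rewrite /= invK // a1 (le_trans a2) // ltW.
- move=> X /andP[X1 X2]; apply: xsurj; last by rewrite xtau X1.
  by rewrite !ltW.
- by rewrite /= -xtau invK // !ltW.
Unshelve. all: by end_near.
Qed.

(** * Separation of the crossing heights *)

Lemma good_start_weaken (R : realType) (F : R -> R) (K v v' X Y : R) :
  v' <= v -> good_start F K v X Y -> good_start F K v' X Y.
Proof.
move=> vv [XK YK XF vY]; split=> //; try lra.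
Qed.

(** The comparison of orbits needs the height up to the factors [1 - kap] and [1 + kap] beyond
    [eta]; closer to the contact point, where the slow approximation fails, a lower bound of order
    [d] is enough. [sig] lets the differential equation hold at [X = 0] itself. *)
Record slow_graph (R : realType) (k : nat) (F dF : R -> R) (C d c b eta kap : R)
    (phi : R -> R) (sig : R) : Prop := SlowGraph {
  graph_sig : 0 < sig;
  graph_derive : forall X, - sig < X < b -> 0 < F X - phi X /\
    is_derive X (1 : R) phi (d * (X ^+ k - c) / (F X - phi X));
  graph_lower : forall X, 0 <= X < b -> d / (32 * C) <= F X - phi X;
  graph_sharp : forall X, eta <= X < b ->
    (1 - kap) * (d * X ^+ k) <= dF X * (F X - phi X) <= (1 + kap) * (d * X ^+ k) }.

Lemma slow_graph_exists (R : realType) (k : nat) (F dF : R -> R)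
    (K C v om b eta kap : R) :
  critical_shape k F dF K C -> (0 < k)%N ->
  0 < v -> 0 < b < om -> om <= K -> 0 < eta -> 0 < kap <= 2^-1 ->
  eventually_small k (fun d c rho => forall T tau x y,
    half_orbit k F d c T tau x y ->
    good_start F K v (x 0) (y 0) -> F om <= y 0 ->
    exists phi sig, [/\ slow_graph k F dF C d c b eta kap phi sig, phi 0 = y tau &
      forall X, 0 <= X < b -> exists2 t, 0 < t <= tau & x t = X /\ y t = phi X]).
Proof.
move=> shape kpos v0 /andP[b0 bom] omK eta0 /andP[kap0 kap1].
have C0 := shape_C shape.
(* The descent starts at [bb], strictly between [b] and the landing abscissa [om], because
   [slow_orbit] is sharp only at a distance [eta'] from its starting abscissa. *)
pose bb := (b + om) / 2.
have bbb : b < bb by rewrite /bb; lra.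
have bbom : bb < om by rewrite /bb; lra.
have bb0 : 0 < bb by lra.
have bb20 : 0 < bb / 2 by lra.
pose eta' := Num.min (Num.min eta (bb - b)) (bb / 2).
have eta'0 : 0 < eta' by rewrite !lt_min eta0 bb20 subr_gt0 bbb.
have [eta'1 eta'2 eta'3] : [/\ eta' <= eta, eta' <= bb - b & eta' <= bb / 2].
  by rewrite /eta' !ge_min !lexx !orbT.
have Fv : 0 < F om - F bb by rewrite subr_gt0; apply: shape_inc_pos shape _ _ (ltW bb0) bbom.
pose v' := Num.min v (F om - F bb).
have v'0 : 0 < v' by rewrite lt_min v0.
have v'v : v' <= v by rewrite ge_min lexx.
have v'F : v' <= F om - F bb by rewrite ge_min lexx orbT.
have bbK : bb <= K by lra.
have etabb : eta' <= bb by lra.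
have kap01 : 0 < kap < 1 by lra.
have := slow_orbit shape kpos v'0 bb0 bbK v'F eta'0 etabb kap01 (@ltr01 R).
clearbody eta' v' bb.
move=> /eventually_small_imply; apply=> nu d c rho sm H T tau x y orb good Y.
have d0 : 0 < d by case: sm => /andP[].
have [t1 [/andP[t10 t1tau] xt1 bounds desc sharp]] :=
  H T tau x y orb (good_start_weaken v'v good) Y.
have [/andP[tau0 tauT] S xtau ytau _] := orb.
have thpos : 0 < d / (16 * C * bb) by rewrite divr_gt0 // !mulr_gt0.
have [||||t2 [/andP[t12 t2tau] xt2 pos2]] := @first_zero _ (fun t => x t - (bb - eta')) t1 tau.
- move=> u /andP[u0 us]; apply: continuousB; last exact: cst_continuous.
  by apply: (solution_continuous S); clear -u0 us t10 tauT; lra.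
- by rewrite xt1; clear -eta'0; lra.
- exact: ltW.
- by rewrite xtau; clear -eta'3 bb0; lra.
have {}xt2 : x t2 = bb - eta' by clear -xt2; lra.
have t2lt : t2 < tau.
  by rewrite lt_neqAle t2tau andbT; apply/eqP => E; move: xt2; rewrite E xtau; clear -eta'3 bb0; lra.
have t12' : t1 < t2.
  by rewrite lt_neqAle t12 andbT; apply/eqP => E; move: xt2; rewrite -E xt1; clear -eta'0; lra.
have xle t : t2 <= t <= tau -> x t <= bb - eta'.
  move=> /andP[s1 s2]; rewrite -xt2 -lerN2.
  apply: (@nondecreasing_is_derive _ (fun s => - x s) (fun s => - (y s - F (x s)))) => //.
    by move=> u /andP[u1 u2]; apply: is_deriveN; apply: (S u _).1; clear -u1 u2 s2 t12 t10 tauT; lra.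
  move=> u /andP[u1 u2]; rewrite opprB.
  have [|/andP[_ xb]] := desc u; first by clear -u1 u2 s2 t12; lra.
  by apply: le_trans; rewrite mulr_ge0 ?subr_ge0 // ltW.
have wpos t : t2 <= t <= tau -> 0 < F (x t) - y t.
  move=> tt; have [|_] := desc t; first by clear -tt t12; lra.
  apply: lt_le_trans; rewrite mulr_gt0 //; have := xle t tt; clear -eta'0; lra.
have x20 : 0 < x t2 by rewrite xt2; clear -eta'3 bb0; lra.
have t2i : 0 <= t2 < tau by rewrite t2lt andbT (le_trans t10).
have [phi [sig [sig0 graph yphi surj phi0]]] := orbit_graph shape orb t2i x20 wpos.
have bt2 : b <= x t2 by rewrite xt2; clear -eta'2; lra.
exists phi, sig; split=> //.
- have sharp' X : eta' <= X < b ->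
      (1 - kap) * (d * X ^+ k) <= dF X * (F X - phi X) <= (1 + kap) * (d * X ^+ k).
    move=> /andP[X1 X2]; have [|t /andP[tt1 tt2] xt] := surj X.
      by rewrite (le_trans (ltW eta'0)) //= (le_trans (ltW X2)).
    have := sharp t; rewrite xt -[phi X](_ : y t = _); last by rewrite yphi ?xt // tt1.
    by apply; clear -tt1 tt2 t12 X1 X2 eta'2; lra.
  split=> //.
  + by move=> X /andP[X1 X2]; apply: graph; rewrite X1 (lt_le_trans X2).
  (* For [X <= bb / 2] the linear bound of the descent keeps half of [d / (16 * C)]; for larger [X]
     the sharp height and [dF X <= C * X ^+ k] even give [d / (2 * C)]. *)
  + move=> X /andP[X1 X2]; have [Xb|Xb] := leP X (bb / 2).
      have [|t /andP[tt1 tt2] xt] := surj X; first by rewrite X1 (le_trans (ltW X2)).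
      rewrite -xt -yphi ?tt1 //; have [|_] := desc t; first by clear -tt1 tt2 t12; lra.
      apply: le_trans; rewrite xt.
      have -> : d / (32 * C) = d / (16 * C * bb) * (bb / 2) by field; rewrite !gt_eqF.
      by rewrite ler_pM2l //; clear -Xb; lra.
    have X0 : 0 < X by clear -bb20 Xb; lra.
    have Xk : 0 < X ^+ k by rewrite exprn_gt0.
    have /andP[H1 _] : (1 - kap) * (d * X ^+ k) <= dF X * (F X - phi X) <= (1 + kap) * (d * X ^+ k).
      by apply: sharp'; clear -Xb eta'3 X2; lra.
    have W0 : 0 < F X - phi X.
      by apply: (graph X _).1; clear -X0 sig0 X2 bt2; lra.
    have H2 : dF X * (F X - phi X) <= C * X ^+ k * (F X - phi X).
      rewrite ler_pM2r //; apply: shape_bound_pos shape _ _; clear -X0 X2 bt2 xt2 eta'0 bbK; lra.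
    have H3 : (d / 2) * X ^+ k <= (C * (F X - phi X)) * X ^+ k.
      have : 2^-1 * (d * X ^+ k) <= (1 - kap) * (d * X ^+ k).
        by rewrite ler_pM2r ?mulr_gt0 //; clear -kap1; lra.
      by clear -H1 H2; lra.
    rewrite ler_pM2r // in H3.
    rewrite ler_pdivrMr ?mulr_gt0 //; clear -H3 d0; lra.
  + by move=> X /andP[X1 X2]; apply: sharp'; rewrite X2 (le_trans eta'1).
move=> X /andP[X1 X2]; have [|t /andP[tt1 tt2] xt] := surj X.
  by rewrite X1 (le_trans (ltW X2)).
exists t; last by rewrite -xt yphi // tt1.
by rewrite tt2 andbT; clear -t10 t12' tt1; lra.
Qed.

(* The logarithmic derivative of [phi1 - phi2] is
   [d * (X ^+ k - c) / ((F X - phi1 X) * (F X - phi2 X))], which for [X >= eta] is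
   close to [dF X ^+ 2 / (d * X ^+ k)] by [graph_sharp]. *)
Lemma graph_difference (R : realType) (k : nat) (F dF : R -> R) (K C : R)
    (d c b eta kap B sig1 sig2 b1 : R) (J phi1 phi2 : R -> R) :
  critical_shape k F dF K C -> (0 < k)%N -> 0 < d -> 0 < kap <= 4^-1 -> 0 < eta ->
  0 < b1 < b -> b1 <= K ->
  (forall X, 0 <= X <= K -> is_derive X (1 : R) J (dF X ^+ 2 / X ^+ k)) ->
  `|c| <= kap * eta ^+ k ->
  C ^+ 2 * eta ^+ k + `|c| * (32 * C) ^+ 2 <= B ->
  slow_graph k F dF C d c b eta kap phi1 sig1 ->
  slow_graph k F dF C d c b eta kap phi2 sig2 ->
  `|phi1 0 - phi2 0| <= `|phi1 b1 - phi2 b1| *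
     expR (- ((1 - 4 * kap) * (J b1 - J 0) - B * b1) / d).
Proof.
move=> shape kpos d0 /andP[kap0 kap1] eta0 /andP[b10 b1b] b1K DJ csm Bbig G1 G2.
have C0 := shape_C shape.
have s10 := graph_sig G1; have s20 := graph_sig G2.
pose Psi X := ((1 - 4 * kap) * J X - B * X) / d.
(* Gronwall in the variable [X]: the weighted square [N] is nondecreasing on [[0, b1]]; squaring
   avoids the sign of the difference. *)
pose N X := (phi1 X - phi2 X) ^+ 2 * expR (- 2 * Psi X).
pose a X := d * (X ^+ k - c) / ((F X - phi1 X) * (F X - phi2 X)).
pose dPsi X := ((1 - 4 * kap) * (dF X ^+ 2 / X ^+ k) - B) / d.
have B0 : 0 <= B.
  apply: le_trans Bbig; apply: addr_ge0; apply: mulr_ge0 => //; apply: exprn_ge0.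
  - exact: ltW.
  - exact: ltW.
  - by rewrite mulr_ge0 // ltW.
have DN X : 0 <= X <= b1 ->
    is_derive X (1 : R) N (2 * N X * (a X - dPsi X)).
  move=> /andP[X0 Xb1].
  have [|W1 D1] := graph_derive G1 (X := X); first by clear -s10 X0 Xb1 b1b; lra.
  have [|W2 D2] := graph_derive G2 (X := X); first by clear -s20 X0 Xb1 b1b; lra.
  have DD := is_deriveB D1 D2.
  have DX := DJ X (introT andP (conj X0 (le_trans Xb1 b1K))).
  have HP : is_derive X (1 : R) Psi (dPsi X).
    have H1 := is_deriveZ (1 - 4 * kap) DX.
    have H2 := is_deriveZ B (is_derive_id X (1 : R)).
    apply: (is_derive_ext (is_deriveZ d^-1 (is_deriveB H1 H2))).
      by move=> z; rewrite /Psi [RHS]mulrC.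
    by rewrite /dPsi /GRing.scale /= mulr1 mulrC.
  have HE := @is_derive1_comp _ expR (fun X => - 2 * Psi X) X _ _
    (is_derive_expR _) (is_deriveZ (- 2) HP).
  apply: (is_derive_ext (is_deriveM (is_deriveM DD DD) HE)).
    by move=> z; rewrite /N expr2.
  rewrite /N /a /GRing.scale /= !fctE.
  by field; rewrite !gt_eqF.
have pos X : 0 <= X <= b1 -> 0 <= 2 * N X * (a X - dPsi X).
  move=> /andP[X0 Xb1].
  have N0 : 0 <= N X by rewrite mulr_ge0 ?sqr_ge0 // expR_ge0.
  apply: mulr_ge0; first exact: mulr_ge0.
  rewrite subr_ge0.
  have XK : X <= K by apply: le_trans b1K.
  have Xb : X < b by apply: le_lt_trans b1b.
  have L1 := graph_lower G1 (introT andP (conj X0 Xb)).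
  have L2 := graph_lower G2 (introT andP (conj X0 Xb)).
  have q0 : 0 < d / (32 * C) by rewrite divr_gt0 // mulr_gt0.
  have W1 : 0 < F X - phi1 X by apply: lt_le_trans L1.
  have W2 : 0 < F X - phi2 X by apply: lt_le_trans L2.
  have W12 : 0 < (F X - phi1 X) * (F X - phi2 X) by rewrite mulr_gt0.
  have dF0 : 0 <= dF X ^+ 2 / X ^+ k by rewrite divr_ge0 ?sqr_ge0 // exprn_ge0.
  rewrite /dPsi /a; have [Xeta|Xeta] := leP eta X.
    have X0' : 0 < X by apply: lt_le_trans eta0 Xeta.
    have Xk : 0 < X ^+ k by rewrite exprn_gt0.
    have /andP[_ S1] := graph_sharp G1 (introT andP (conj Xeta Xb)).
    have /andP[_ S2] := graph_sharp G2 (introT andP (conj Xeta Xb)).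
    have dFX : 0 < dF X by apply: shape_pos shape _ X0'.
    have S12 : (dF X * (F X - phi1 X)) * (dF X * (F X - phi2 X)) <=
        ((1 + kap) * (d * X ^+ k)) * ((1 + kap) * (d * X ^+ k)).
      by apply: ler_pM => //; rewrite mulr_ge0 // ltW.
    have ck : `|c| <= kap * X ^+ k.
      by apply: le_trans csm _; rewrite ler_pM2l // lerXn2r // nnegrE ltW.
    have ck2 : (1 - kap) * X ^+ k <= X ^+ k - c.
      by have := ler_norm c; clear -ck; lra.
    (* [(1 + kap) ^+ 2] comes from the two heights and [1 - kap] from [c]; a loss of [4 * kap]
       absorbs both. *)
    have step : (1 - 4 * kap) * ((1 + kap) ^+ 2) <= 1 - kap.
      have : 0 <= kap ^+ 2 /\ 0 <= kap ^+ 3 by rewrite !exprn_ge0 // ltW.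
      by move=> [h1 h2]; clear -h1 h2 kap0; lra.
    apply: (@le_trans _ _ ((1 - 4 * kap) * (dF X ^+ 2 / X ^+ k) / d)).
      by rewrite ler_pM2r ?invr_gt0 //; clear -B0; lra.
    rewrite ler_pdivlMr // mulrAC ler_pdivrMr //.
    have p4 : 0 <= (1 - 4 * kap) by clear -kap1; lra.
    have H1 : (1 - 4 * kap) * (dF X ^+ 2 / X ^+ k) * ((F X - phi1 X) * (F X - phi2 X)) <=
        ((1 - 4 * kap) / X ^+ k) * (((1 + kap) * (d * X ^+ k)) * ((1 + kap) * (d * X ^+ k))).
      have -> : (1 - 4 * kap) * (dF X ^+ 2 / X ^+ k) * ((F X - phi1 X) * (F X - phi2 X)) =
        ((1 - 4 * kap) / X ^+ k) * ((dF X * (F X - phi1 X)) * (dF X * (F X - phi2 X))) by ring.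
      by rewrite ler_wpM2l // divr_ge0 // ltW.
    apply: (le_trans H1).
    have -> : ((1 - 4 * kap) / X ^+ k) * (((1 + kap) * (d * X ^+ k)) * ((1 + kap) * (d * X ^+ k)))
      = ((1 - 4 * kap) * (1 + kap) ^+ 2) * X ^+ k * d * d.
      by field; rewrite gt_eqF.
    rewrite ler_pM2r // mulrC ler_pM2l //.
    by apply: le_trans ck2; rewrite ler_pM2r.
  (* Below [eta] the logarithmic derivative may be negative, but by the lower height bounds at worst
     of size [|c| * (32 * C) ^+ 2 / d]. [B] covers this and the part of [J'] that is not gained
     here, at most [C ^+ 2 * eta ^+ k]. *)
  have Xk : X ^+ k <= eta ^+ k by rewrite lerXn2r ?nnegrE // ltW.
  have Xk0 : 0 <= X ^+ k by rewrite exprn_ge0.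
  have J1 : dF X ^+ 2 / X ^+ k <= C ^+ 2 * eta ^+ k.
    have [->|Xn] := eqVneq X 0.
      by rewrite expr0n gtn_eqF // invr0 mulr0 mulr_ge0 ?exprn_ge0 // ltW.
    have X0' : 0 < X by rewrite lt_neqAle X0 eq_sym Xn.
    have dFp := shape_deriv_ge0 shape X0'.
    have dFb : dF X <= C * X ^+ k by apply: shape_bound_pos shape _ _; rewrite X0.
    have CX : 0 <= C * X ^+ k by apply: mulr_ge0 => //; exact: ltW.
    rewrite ler_pdivrMr ?exprn_gt0 //; apply: (@le_trans _ _ ((C * X ^+ k) ^+ 2)).
      by rewrite lerXn2r ?nnegrE.
    have -> : (C * X ^+ k) ^+ 2 = (C ^+ 2 * X ^+ k) * X ^+ k by ring.
    by rewrite ler_wpM2r // ler_wpM2l // sqr_ge0.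
  apply: (@le_trans _ _ (- (`|c| * (32 * C) ^+ 2) / d)).
    rewrite ler_pM2r ?invr_gt0 //.
    have : (1 - 4 * kap) * (dF X ^+ 2 / X ^+ k) <= dF X ^+ 2 / X ^+ k.
      by rewrite ler_piMl //; clear -kap0; lra.
    by clear -J1 Bbig; lra.
  rewrite ler_pdivlMr //.
  have H1 : - (d * `|c|) <= d * (X ^+ k - c).
    by rewrite -mulrN ler_pM2l //; have := ler_norm c; clear -Xk0; lra.
  have H2 : (d / (32 * C)) * (d / (32 * C)) <= (F X - phi1 X) * (F X - phi2 X).
    by apply: ler_pM => //; exact: ltW.
  have H3 : `|c| * (32 * C) ^+ 2 / d * ((d / (32 * C)) * (d / (32 * C))) = d * `|c|.
    by field; rewrite !gt_eqF.
  have H4 : `|c| * (32 * C) ^+ 2 / d * ((d / (32 * C)) * (d / (32 * C))) <=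
      `|c| * (32 * C) ^+ 2 / d * ((F X - phi1 X) * (F X - phi2 X)).
    by rewrite ler_wpM2l // divr_ge0 ?mulr_ge0 ?sqr_ge0 // ltW.
  by clear -H1 H3 H4; lra.
have := nondecreasing_is_derive DN pos (ltW b10).
rewrite /N => H.
rewrite -(@ler_pXn2r _ 2) ?nnegrE ?mulr_ge0 ?expR_ge0 //.
rewrite exprMn !real_normK ?num_real // -expRM_natl.
rewrite -(@ler_pM2r _ (expR (- 2 * Psi 0))) ?expR_gt0 //.
apply: le_trans H _; rewrite -[X in _ <= X]mulrA -expRD le_eqVlt; apply/orP; left; apply/eqP.
by congr (_ * expR _); rewrite /Psi; field; rewrite gt_eqF.
Qed.

Definition divergence_primitive (R : realType) (k : nat) (dF : R -> R) (K : R) (J : R -> R) :=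
  forall X, 0 <= X <= K -> is_derive X (1 : R) J (dF X ^+ 2 / X ^+ k).

Lemma divergence_nondecreasing (R : realType) (k : nat) (dF : R -> R) (K u v : R) (J : R -> R) :
  divergence_primitive k dF K J -> 0 <= u -> u <= v -> v <= K -> J u <= J v.
Proof.
move=> DJ u0 uv vK.
have i X : u <= X <= v -> 0 <= X <= K.
  by move=> /andP[? ?]; rewrite (le_trans u0) //= (le_trans _ vK).
apply: (nondecreasing_is_derive (fun X Xi => DJ X (i X Xi))) => // X /i /andP[X0 _].
by rewrite divr_ge0 ?sqr_ge0 // exprn_ge0.
Qed.

Lemma height_gap_upper (R : realType) (k : nat) (F dF : R -> R) (K C v om e : R)
    (J : R -> R) :
  critical_shape k F dF K C -> (0 < k)%N -> divergence_primitive k dF K J ->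
  0 < v -> 0 < om <= K -> 0 < e ->
  eventually_small k (fun d c rho => forall T1 tau1 x1 y1 T2 tau2 x2 y2,
    half_orbit k F d c T1 tau1 x1 y1 -> half_orbit k F d c T2 tau2 x2 y2 ->
    good_start F K v (x1 0) (y1 0) -> good_start F K v (x2 0) (y2 0) ->
    F om <= y1 0 -> F om <= y2 0 ->
    `|y1 tau1 - y2 tau2| <= expR (- (J om - J 0 - e) / d)).
Proof.
move=> shape kpos DJ v0 /andP[om0 omK] e0.
have C0 := shape_C shape.
have e4 : 0 < e / 4 by rewrite divr_gt0.
have omi : 0 <= om <= K by rewrite ltW.
have [dl dl0 Hdl] := continuous_at_eps (is_derive_continuous (DJ om omi)) e4.
(* The error [e] is shared out: at most [e / 4] each for replacing [om] by [b1], for the factor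
   [1 - 4 * kap] and for [B * b1]. *)
pose b1 := om - Num.min (dl / 2) (om / 2).
have m0 : 0 < Num.min (dl / 2) (om / 2) by rewrite lt_min !divr_gt0.
have m1 : Num.min (dl / 2) (om / 2) <= dl / 2 by rewrite ge_min lexx.
have m2 : Num.min (dl / 2) (om / 2) <= om / 2 by rewrite ge_min lexx orbT.
have [b10 b1om] : 0 < b1 /\ b1 < om by rewrite /b1; split; lra.
have Jb1 : J om - e / 4 <= J b1.
  have := Hdl b1; rewrite ltr_norml /b1 => H.
  have : - (e / 4) < J b1 - J om < e / 4 by apply: H; clear -m0 m1 dl0; lra.
  by clear; lra.
clearbody b1; clear m0 m1 m2 Hdl dl0 dl.
have b1K : b1 <= K by apply: le_trans (ltW b1om) omK.
have Jpos : 0 <= J b1 - J 0.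
  by rewrite subr_ge0; exact: divergence_nondecreasing DJ _ (ltW b10) b1K.
pose b := (b1 + om) / 2.
have [b1b bom] : b1 < b /\ b < om by rewrite /b; split; clear -b1om; lra.
have b0 : 0 < b < om by rewrite bom andbT (lt_trans b10).
clearbody b.
pose kap := Num.min 4^-1 (e / (16 * (J b1 - J 0 + 1))).
have q1 : 0 < 16 * (J b1 - J 0 + 1) by rewrite mulr_gt0 // ltr_wpDl.
have kap0 : 0 < kap by rewrite lt_min invr_gt0 ltr0n divr_gt0.
have kap4 : kap <= 4^-1 by rewrite ge_min lexx.
have kapJ : 4 * kap * (J b1 - J 0) <= e / 4.
  have : kap <= e / (16 * (J b1 - J 0 + 1)) by rewrite ge_min lexx orbT.
  rewrite ler_pdivlMr //; clear -kap0; lra.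
clearbody kap.
pose eta := Num.min (Num.min 1 b1) (e / (8 * C ^+ 2 * b1)).
have q2 : 0 < 8 * C ^+ 2 * b1 by rewrite !mulr_gt0 // exprn_gt0.
have eta0 : 0 < eta by rewrite !lt_min ltr01 b10 divr_gt0.
have [eta1 etab etae] : [/\ eta <= 1, eta <= b1 & eta <= e / (8 * C ^+ 2 * b1)].
  by rewrite /eta !ge_min !lexx !orbT.
clearbody eta.
have ek0 : 0 < eta ^+ k by rewrite exprn_gt0.
have ek : eta ^+ k <= eta by rewrite -[X in _ <= X]expr1 ler_wiXn2l // ltW.
pose B := 2 * (C ^+ 2 * eta ^+ k).
have C2 : 0 < C ^+ 2 by rewrite exprn_gt0.
have CE : 0 < C ^+ 2 * eta ^+ k by rewrite mulr_gt0.
have Bb : B * b1 <= e / 4.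
  apply: (@le_trans _ _ (2 * (C ^+ 2 * eta) * b1)).
    by rewrite ler_pM2r // ler_pM2l // ler_pM2l.
  by rewrite ler_pdivlMr // in etae; clear -etae; lra.
have kap2 : 0 < kap <= 2^-1 by rewrite kap0 /=; clear -kap4; lra.
have dFb : 0 < dF b1 by apply: shape_pos shape _ b10.
have p1 : 0 < kap * eta ^+ k by rewrite mulr_gt0.
have C320 : 0 < (32 * C) ^+ 2 by rewrite exprn_gt0 // mulr_gt0.
have p2 : 0 < (C ^+ 2 * eta ^+ k) / (32 * C) ^+ 2 by rewrite divr_gt0.
have := slow_graph_exists shape kpos v0 b0 omK eta0 kap2.
move=> /eventually_small_and /(_ (eventually_small_c kpos p1)).
move=> /eventually_small_and /(_ (eventually_small_c kpos p2)).
move=> /eventually_small_and /(_ (eventually_small_d k (2 * b1 ^+ k) dFb)).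
move=> /eventually_small_imply; apply=> nu d c rho sm [[[H c1] c2] d1].
move=> T1 tau1 x1 y1 T2 tau2 x2 y2 orb1 orb2 good1 good2 Y1 Y2.
have d0 : 0 < d by case: sm => /andP[].
have [phi1 [sig1 [G1 <- _]]] := H _ _ _ _ orb1 good1 Y1.
have [phi2 [sig2 [G2 <- _]]] := H _ _ _ _ orb2 good2 Y2.
have b1i : 0 < b1 < b by rewrite b10.
have kap4' : 0 < kap <= 4^-1 by rewrite kap0.
have Bbig : C ^+ 2 * eta ^+ k + `|c| * (32 * C) ^+ 2 <= B.
  by rewrite ltr_pdivlMr // in c2; rewrite /B; clear -c2; lra.
apply: le_trans (graph_difference shape kpos d0 kap4' eta0 b1i b1K DJ (ltW c1) Bbig G1 G2) _.
(* The prefactor is harmless: for small [d] both heights at [b1] lie between [0] and [1], so the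
   graphs differ there by at most [1]. *)
apply: (@le_trans _ _ (1 * expR (- ((1 - 4 * kap) * (J b1 - J 0) - B * b1) / d))); last first.
  rewrite mul1r ler_expR ler_pM2r ?invr_gt0 //.
  by clear -kapJ Bb Jb1 e0; lra.
rewrite ler_pM2r ?expR_gt0 //.
have bi : eta <= b1 < b by rewrite etab.
have W1 := lt_le_trans _ (graph_lower G1 (introT andP (conj (ltW b10) b1b))).
have W2 := lt_le_trans _ (graph_lower G2 (introT andP (conj (ltW b10) b1b))).
have q0 : 0 < d / (32 * C) by rewrite divr_gt0 // mulr_gt0.
have {}W1 := W1 _ q0; have {}W2 := W2 _ q0.
have up : (1 + kap) * (d * b1 ^+ k) <= dF b1.
  have bk : 0 < b1 ^+ k by rewrite exprn_gt0.
  have : (1 + kap) * (d * b1 ^+ k) <= 2 * (d * b1 ^+ k).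
    by rewrite ler_pM2r ?mulr_gt0 //; clear -kap4; lra.
  by clear -d1; lra.
have U1 : F b1 - phi1 b1 <= 1.
  have /andP[_ S1] := graph_sharp G1 bi.
  by rewrite -(ler_pM2l dFb) mulr1 (le_trans S1).
have U2 : F b1 - phi2 b1 <= 1.
  have /andP[_ S2] := graph_sharp G2 bi.
  by rewrite -(ler_pM2l dFb) mulr1 (le_trans S2).
rewrite ler_norml; clear -U1 U2 W1 W2; lra.
Qed.

(** Nothing is known about the past of the orbit [(x, y)], so it is not treated as a graph but
    traced back from its crossing. Its vertical distance [D] to the graph grows backwards by at most
    the exponential of the divergence integral. A small enough gap at the crossing therefore keeps
    [D] below a fraction of the height of the graph as long as the abscissa is at most [b1]. *)
Lemma graph_shadow (R : realType) (k : nat) (F dF : R -> R) (K C : R)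
    (d c b eta kap B sig b1 s1 tau : R) (J phi x y : R -> R) :
  critical_shape k F dF K C -> (0 < k)%N -> 0 < d -> 0 < kap <= 6^-1 -> 0 < eta ->
  0 < b1 < b -> b1 <= K ->
  divergence_primitive k dF K J ->
  `|c| <= kap * eta ^+ k ->
  2 * (eta ^+ k + `|c|) * (32 * C) ^+ 2 <= B ->
  slow_graph k F dF C d c b eta kap phi sig ->
  solution k F d c s1 tau x y -> s1 <= tau -> x tau = 0 ->
  (forall t, s1 <= t <= tau -> - sig < x t <= b1) ->
  `|y tau - phi 0| * expR (((1 + 8 * kap) * (J b1 - J 0) + B * b1) / d)
    < kap * (d / (32 * C)) ->
  forall t, s1 <= t <= tau ->
    0 <= x t /\ `|y t - phi (x t)| <= kap * (d / (32 * C)).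
Proof.
move=> shape kpos d0 /andP[kap0 kap1] eta0 /andP[b10 b1b] b1K DJ csm Bbig G S s1tau xtau
  xr gap.
have C0 := shape_C shape.
have sig0 := graph_sig G.
have q0 : 0 < d / (32 * C) by rewrite divr_gt0 // mulr_gt0.
pose D t := y t - phi (x t).
pose Psi X := ((1 + 8 * kap) * J X + B * X) / d.
pose dPsi X := ((1 + 8 * kap) * (dF X ^+ 2 / X ^+ k) + B) / d.
(* [N] is nondecreasing as long as [D] stays below [kap * (F x - phi x)], so that
   the final value of [D] bounds all the previous ones. *)
pose N t := D t ^+ 2 * expR (- 2 * Psi (x t)).
have B0 : 0 <= B.
  apply: le_trans Bbig; apply: mulr_ge0; last exact: sqr_ge0.
  by apply: mulr_ge0 => //; apply: addr_ge0 => //; rewrite exprn_ge0 // ltW.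
have xb t : s1 <= t <= tau -> - sig < x t < b.
  by move=> /xr /andP[-> X1]; rewrite (le_lt_trans X1).
have Dphi t : s1 <= t <= tau -> 0 < F (x t) - phi (x t) /\
    is_derive t (1 : R) (phi \o x)
      (d * (x t ^+ k - c) / (F (x t) - phi (x t)) * (y t - F (x t))).
  move=> tt; have [W DW] := graph_derive G (xb t tt); split=> //.
  exact: (@is_derive1_comp _ phi x t _ _ DW (S t tt).1).
have DD t : s1 <= t <= tau ->
    is_derive t (1 : R) D (- (d * (x t ^+ k - c) / (F (x t) - phi (x t))) * D t).
  move=> tt; have [W Dp] := Dphi t tt.
  apply: (is_derive_ext (is_deriveB (S t tt).2 Dp)) => //.
  by rewrite /D; field; rewrite gt_eqF.
have Wlo t : s1 <= t <= tau -> 0 <= x t -> d / (32 * C) <= F (x t) - phi (x t).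
  by move=> /xb /andP[_ X1] X0; apply: (graph_lower G); rewrite X0.
have xpast t : s1 <= t <= tau -> (forall s, t <= s <= tau ->
    0 <= kap * (F (x s) - phi (x s)) - D s) -> forall s, t <= s <= tau -> 0 <= x s.
  move=> /andP[t1 t2] past s /andP[ts stau].
  rewrite -xtau -lerN2.
  apply: (@nondecreasing_is_derive _ (fun s => - x s) (fun s => - (y s - F (x s)))) => //.
    move=> u /andP[u1 u2]; apply: is_deriveN; apply: (S u _).1.
    by rewrite u2 andbT (le_trans t1) // (le_trans ts).
  move=> u /andP[u1 u2]; rewrite opprB.
  have tu : t <= u by apply: le_trans u1.
  have [|W _] := Dphi u; first by rewrite u2 andbT (le_trans t1).
  have P := past u (introT andP (conj tu u2)).
  have : kap * (F (x u) - phi (x u)) <= F (x u) - phi (x u).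
    by rewrite ler_piMl ?(ltW W) //; clear -kap1; lra.
  by move: P; rewrite /D; clear; lra.
have key t : s1 <= t <= tau -> (forall s, t <= s <= tau ->
    0 <= kap * (F (x s) - phi (x s)) - D s) -> `|D t| < kap * (d / (32 * C)).
  move=> tt past; have /andP[t1 t2] := tt.
  have x0 := xpast t tt past.
  apply: le_lt_trans gap.
  have DN s : t <= s <= tau -> is_derive s (1 : R) N
      (2 * N s * (dPsi (x s) * (F (x s) - y s) -
         d * (x s ^+ k - c) / (F (x s) - phi (x s)))).
    move=> ss; have s1' : s1 <= s <= tau by case/andP: ss => ? ->; rewrite (le_trans t1).
    have X0 := x0 s ss; have /andP[_ Xb] := xr s s1'.
    have DJX := DJ (x s) (introT andP (conj X0 (le_trans Xb b1K))).
    have Dx := (S s s1').1.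
    have [W _] := Dphi s s1'.
    have HJ := @is_derive1_comp _ J x s _ _ DJX Dx.
    have HP : is_derive s (1 : R) (Psi \o x) (dPsi (x s) * (y s - F (x s))).
      have H1 := is_deriveZ (1 + 8 * kap) HJ.
      have H2 := is_deriveZ B Dx.
      apply: (is_derive_ext (is_deriveZ d^-1 (is_deriveD H1 H2))).
        by move=> z; rewrite /= /Psi [RHS]mulrC.
      by rewrite /dPsi /GRing.scale /=; ring.
    have HE := @is_derive1_comp _ expR (fun z => - 2 * (Psi \o x) z) s _ _
      (is_derive_expR _) (is_deriveZ (- 2) HP).
    apply: (is_derive_ext (is_deriveM (is_deriveM (DD s s1') (DD s s1')) HE)).
      by move=> z; rewrite /N expr2.
    rewrite /N /GRing.scale /= !fctE /=.
    by field; rewrite !gt_eqF.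
  have pos s : t <= s <= tau -> 0 <= 2 * N s * (dPsi (x s) * (F (x s) - y s) -
         d * (x s ^+ k - c) / (F (x s) - phi (x s))).
    move=> ss; have s1' : s1 <= s <= tau by case/andP: ss => ? ->; rewrite (le_trans t1).
    have X0 := x0 s ss; have /andP[_ Xb1] := xr s s1'; have /andP[_ Xb] := xb s s1'.
    have N0 : 0 <= N s by apply: mulr_ge0; [exact: sqr_ge0 | exact: expR_ge0].
    apply: mulr_ge0; first exact: mulr_ge0.
    have W0 := Wlo s s1' X0.
    set W := F (x s) - phi (x s) in W0 *.
    have W1 : 0 < W by apply: lt_le_trans W0.
    have w1 : (1 - kap) * W <= F (x s) - y s.
      by have := past s ss; rewrite -/W /D /W; clear; lra.
    have dP0 : 0 <= dPsi (x s).
      rewrite divr_ge0 ?(ltW d0) // addr_ge0 // mulr_ge0 //; first by clear -kap0; lra.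
      by rewrite divr_ge0 ?sqr_ge0 // exprn_ge0.
    rewrite subr_ge0 ler_pdivrMr //.
    apply: (@le_trans _ _ (dPsi (x s) * ((1 - kap) * W) * W)); last first.
      by rewrite ler_pM2r // ler_wpM2l.
    have kap1' : 0 < 1 - kap by clear -kap1; lra.
    have [Xeta|Xeta] := leP eta (x s).
      have X0' : 0 < x s by apply: lt_le_trans Xeta.
      have Xk : 0 < x s ^+ k by rewrite exprn_gt0.
      have /andP[S1 _] := graph_sharp G (introT andP (conj Xeta Xb)).
      rewrite -/W in S1.
      have ck : `|c| <= kap * x s ^+ k.
        by apply: le_trans csm _; rewrite ler_pM2l // lerXn2r // nnegrE ltW.
      (* Two factors [1 - kap] come from squaring the lower height bound, the third from
         [F x - y >= (1 - kap) * W], and [1 + kap] from [c]. The expansion shows where [kap <= 6^-1]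
         enters. *)
      have step : 1 + kap <= (1 + 8 * kap) * (1 - kap) ^+ 3.
        have -> : (1 + 8 * kap) * (1 - kap) ^+ 3 =
          1 + kap + kap * (1 - 6 * kap) * 4 + kap ^+ 3 * (23 - 8 * kap) + 3 * kap ^+ 2 by ring.
        have h1 : 0 <= kap * (1 - 6 * kap) by apply: mulr_ge0; [exact: ltW | clear -kap1; lra].
        have h2 : 0 <= kap ^+ 3 * (23 - 8 * kap).
          by apply: mulr_ge0; [rewrite exprn_ge0 // ltW | clear -kap1; lra].
        have h3 : 0 <= kap ^+ 2 by exact: sqr_ge0.
        by clear -h1 h2 h3; lra.
      apply: (@le_trans _ _ (d * ((1 + kap) * x s ^+ k))).
        by rewrite ler_pM2l //; have := ler_norm (- c); rewrite normrN; clear -ck; lra.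
      apply: (@le_trans _ _ (d * (((1 + 8 * kap) * (1 - kap) ^+ 3) * x s ^+ k))).
        by rewrite ler_pM2l // ler_pM2r.
      have H1 : ((1 - kap) * (d * x s ^+ k)) * ((1 - kap) * (d * x s ^+ k)) <=
          (dF (x s) * W) * (dF (x s) * W).
        by apply: ler_pM => //; apply: mulr_ge0; rewrite ?(ltW kap1') // mulr_ge0 // ltW.
      have q3 : 0 <= (1 + 8 * kap) * (1 - kap) / (d * x s ^+ k).
        rewrite divr_ge0 ?mulr_ge0 ?(ltW kap1') ?(ltW d0) ?(ltW Xk) //.
        by clear -kap0; lra.
      have H2 := ler_wpM2l q3 H1.
      have -> : d * ((1 + 8 * kap) * (1 - kap) ^+ 3 * x s ^+ k) =
          (1 + 8 * kap) * (1 - kap) / (d * x s ^+ k) *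
          (((1 - kap) * (d * x s ^+ k)) * ((1 - kap) * (d * x s ^+ k))).
        by field; rewrite !gt_eqF.
      apply: (le_trans H2).
      have -> : (1 + 8 * kap) * (1 - kap) / (d * x s ^+ k) * ((dF (x s) * W) * (dF (x s) * W)) =
          ((1 + 8 * kap) * (dF (x s) ^+ 2 / x s ^+ k)) / d * ((1 - kap) * W) * W.
        by field; rewrite !gt_eqF.
      rewrite ler_pM2r // ler_pM2r ?mulr_gt0 // ler_pM2r ?invr_gt0 //.
      by rewrite lerDl.
    have Xk : x s ^+ k <= eta ^+ k by rewrite lerXn2r ?nnegrE // ltW.
    apply: (@le_trans _ _ (d * (eta ^+ k + `|c|))).
      by rewrite ler_pM2l //; have := ler_norm (- c); rewrite normrN; clear -Xk; lra.
    apply: (@le_trans _ _ (B / d * ((1 - kap) * (d / (32 * C))) * (d / (32 * C)))).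
      have -> : B / d * ((1 - kap) * (d / (32 * C))) * (d / (32 * C)) =
          d * ((1 - kap) * (B / (32 * C) ^+ 2)) by field; rewrite !gt_eqF.
      rewrite ler_pM2l //.
      have C320 : 0 < (32 * C) ^+ 2 by rewrite exprn_gt0 // mulr_gt0.
      have : 2 * (eta ^+ k + `|c|) <= B / (32 * C) ^+ 2 by rewrite ler_pdivlMr.
      have : 2^-1 * (B / (32 * C) ^+ 2) <= (1 - kap) * (B / (32 * C) ^+ 2).
        by apply: ler_wpM2r; [rewrite divr_ge0 // ltW | clear -kap1; lra].
      by clear; lra.
    have BdP : B / d <= dPsi (x s).
      rewrite ler_pM2r ?invr_gt0 // lerDr mulr_ge0 //; first by clear -kap0; lra.
      by rewrite divr_ge0 ?sqr_ge0 // exprn_ge0.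
    have Bd0 : 0 <= B / d by rewrite divr_ge0 // ltW.
    have kq0 : 0 <= (1 - kap) * (d / (32 * C)) by apply: mulr_ge0; exact: ltW.
    apply: ler_pM; [exact: mulr_ge0 | exact: ltW | | exact: W0].
    by apply: ler_pM => //; rewrite ler_pM2l.
  have Nmono := nondecreasing_is_derive DN pos t2.
  rewrite /N in Nmono.
  have E0 : D tau = y tau - phi 0 by rewrite /D xtau.
  rewrite -E0 -(@ler_pXn2r _ 2) ?nnegrE ?mulr_ge0 ?expR_ge0 //.
  rewrite exprMn !real_normK ?num_real // -expRM_natl.
  rewrite -(@ler_pM2r _ (expR (- 2 * Psi (x t)))) ?expR_gt0 //.
  apply: le_trans Nmono _; rewrite -[X in _ <= X]mulrA -expRD xtau.
  apply: ler_wpM2l; first exact: sqr_ge0.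
  rewrite ler_expR /Psi.
  have tX0 : 0 <= x t by apply: x0; rewrite lexx.
  have /andP[_ tXb] := xr t tt.
  have JX := divergence_nondecreasing DJ tX0 tXb b1K.
  have H1 : (1 + 8 * kap) * J (x t) <= (1 + 8 * kap) * J b1.
    by apply: ler_wpM2l => //; clear -kap0; lra.
  have H2 : B * x t <= B * b1 by apply: ler_wpM2l.
  have -> : - 2 * (((1 + 8 * kap) * J 0 + B * 0) / d) =
      (- 2 * ((1 + 8 * kap) * J 0)) / d by field; rewrite gt_eqF.
  have -> : 2%:R * (((1 + 8 * kap) * (J b1 - J 0) + B * b1) / d) +
     - 2 * (((1 + 8 * kap) * J (x t) + B * x t) / d) =
     (2 * ((1 + 8 * kap) * (J b1 - J 0) + B * b1) -
       2 * ((1 + 8 * kap) * J (x t) + B * x t)) / d by field; rewrite gt_eqF.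
  by rewrite ler_pM2r ?invr_gt0 //; clear -H1 H2; lra.
(* Bootstrap backwards from [tau]: assuming [D <= kap * W], [key] and the lower height bound yield
   the strict inequality. This also keeps [x' < 0], hence [0 <= x]. *)
have main t : s1 <= t <= tau -> 0 < kap * (F (x t) - phi (x t)) - D t.
  have bound s : s1 <= s <= tau -> 0 <= x s -> `|D s| < kap * (d / (32 * C)) ->
      0 < kap * (F (x s) - phi (x s)) - D s.
    move=> ss X0 Ds.
    have : kap * (d / (32 * C)) <= kap * (F (x s) - phi (x s)).
      by rewrite ler_pM2l //; exact: Wlo.
    by have := ler_norm (D s); clear -Ds; lra.
  have tautau : s1 <= tau <= tau by rewrite s1tau lexx.
  apply: (@positivity_persists_backward _ (fun t => kap * (F (x t) - phi (x t)) - D t) s1 tau).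
  - move=> s ss; have [_ Dp] := Dphi s ss.
    have DF := @is_derive1_comp _ F x s _ _ (shape_derive shape (x s)) (S s ss).1.
    exact: (is_derive_continuous (is_deriveB (is_deriveZ kap (is_deriveB DF Dp)) (DD s ss))).
  - apply: bound => //; first by rewrite xtau.
    rewrite /D xtau; apply: le_lt_trans gap; rewrite ler_peMr //.
    have J0 := divergence_nondecreasing DJ (lexx 0) (ltW b10) b1K.
    rewrite -[X in X <= _]expR0 ler_expR divr_ge0 ?(ltW d0) // addr_ge0 //.
      by rewrite mulr_ge0 ?subr_ge0 //; clear -kap0; lra.
    by rewrite mulr_ge0 // ltW.
  move=> s ss past; rewrite gt_eqF //; apply: bound => //.
    by have /andP[_ s2] := ss; apply: (xpast s ss past); rewrite lexx.
  exact: key.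
move=> t tt; have /andP[t1 t2] := tt.
have past s : t <= s <= tau -> 0 <= kap * (F (x s) - phi (x s)) - D s.
  by move=> /andP[s1' s2]; apply/ltW/main; rewrite s2 (le_trans t1).
split; first by apply: (xpast t tt past); rewrite lexx.
exact/ltW/(key t tt past).
Qed.

(** From [(z / 2) ^+ 2 <= expR z] with [z = u / d]. *)
Lemma expR_inv_small (R : realType) (A u d : R) : 0 < u -> 0 < d -> 0 < A ->
  4 * d < A * u ^+ 2 -> expR (- u / d) < A * d.
Proof.
move=> u0 d0 A0 H.
have z0 : 0 < u / d by rewrite divr_gt0.
have E1 : (u / d / 2) ^+ 2 <= expR (u / d).
  have -> : expR (u / d) = expR (u / d / 2) ^+ 2.
    by rewrite -expRM_natl; congr expR; field; rewrite gt_eqF.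
  rewrite lerXn2r ?nnegrE ?expR_ge0 //; first by rewrite ltW // divr_gt0.
  by apply: le_trans (expR_ge1Dx _); rewrite lerDr.
rewrite mulNr expRN -[X in X < _]mul1r ltr_pdivrMr ?expR_gt0 //.
apply: (@lt_le_trans _ _ (A * d * (u / d / 2) ^+ 2)); last by rewrite ler_pM2l ?mulr_gt0.
have -> : A * d * (u / d / 2) ^+ 2 = A * u ^+ 2 / (4 * d) by field; rewrite gt_eqF.
by rewrite ltr_pdivlMr ?mulr_gt0 // mul1r.
Qed.

(* If the crossing heights were closer, [graph_shadow] would keep the first orbit
   near the graph of the second one up to abscissas greater than [om]. *)
Lemma height_gap_lower (R : realType) (k : nat) (F dF : R -> R)
    (K C v v1 om om' e : R) (J : R -> R) :
  critical_shape k F dF K C -> (0 < k)%N -> divergence_primitive k dF K J ->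
  0 < v -> 0 < v1 -> 0 < om < om' -> om' <= K -> 0 < e ->
  eventually_small k (fun d c rho => forall T1 tau1 x1 y1 T2 tau2 x2 y2,
    half_orbit k F d c T1 tau1 x1 y1 -> half_orbit k F d c T2 tau2 x2 y2 ->
    good_start F K v (x2 0) (y2 0) -> F om' <= y2 0 ->
    (forall t, 0 <= t <= tau1 -> rho <= x1 t -> y1 t <= F om) ->
    F (x1 0) - y1 0 <= 0 \/ (v1 <= x1 0 /\ v1 <= F (x1 0) - y1 0) ->
    expR (- (J om - J 0 + e) / d) <= `|y1 tau1 - y2 tau2|).
Proof.
move=> shape kpos DJ v0 v10 /andP[om0 omom'] om'K e0.
have C0 := shape_C shape; have K0 := shape_K shape.
have e8 : 0 < e / 8 by rewrite divr_gt0.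
have omi : 0 <= om <= K by rewrite ltW //= (le_trans (ltW omom')).
have [dl dl0 Hdl] := continuous_at_eps (is_derive_continuous (DJ om omi)) e8.
(* At [b1], slightly beyond [om], an orbit below the level [F om] is separated from the curve by a
   height independent of [d]. *)
pose b1 := om + Num.min (dl / 2) ((om' - om) / 2).
have om'om : 0 < om' - om by rewrite subr_gt0.
have m0 : 0 < Num.min (dl / 2) ((om' - om) / 2) by rewrite lt_min !divr_gt0.
have m1 : Num.min (dl / 2) ((om' - om) / 2) <= dl / 2 by rewrite ge_min lexx.
have m2 : Num.min (dl / 2) ((om' - om) / 2) <= (om' - om) / 2.
  by rewrite ge_min lexx orbT.
have [omb1 b1om'] : om < b1 /\ b1 < om' by rewrite /b1; split; clear -m0 m1 m2 om'om; lra.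
have Jb1 : J b1 <= J om + e / 8.
  have := Hdl b1; rewrite ltr_norml /b1 => H.
  have : - (e / 8) < J b1 - J om < e / 8 by apply: H; clear -m0 m1 dl0; lra.
  by clear; lra.
clearbody b1; clear m0 m1 m2 Hdl dl0 dl.
have b10 : 0 < b1 by apply: lt_trans omb1.
have b1K : b1 <= K by apply: le_trans (ltW b1om') om'K.
have Jpos : 0 <= J b1 - J 0.
  by rewrite subr_ge0; exact: divergence_nondecreasing DJ _ (ltW b10) b1K.
have Fgap : 0 < F b1 - F om.
  by rewrite subr_gt0; exact: shape_inc_pos shape _ _ (ltW om0) omb1.
pose b := (b1 + om') / 2.
have [b1b bom] : b1 < b /\ b < om' by rewrite /b; split; clear -b1om'; lra.
have b0 : 0 < b < om' by rewrite bom andbT (lt_trans b10).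
clearbody b.
pose kap := Num.min 6^-1 (e / (64 * (J b1 - J 0 + 1))).
have q1 : 0 < 64 * (J b1 - J 0 + 1) by rewrite mulr_gt0 // ltr_wpDl.
have kap0 : 0 < kap by rewrite lt_min invr_gt0 ltr0n divr_gt0.
have kap6 : kap <= 6^-1 by rewrite ge_min lexx.
have kapJ : 8 * kap * (J b1 - J 0) <= e / 8.
  have : kap <= e / (64 * (J b1 - J 0 + 1)) by rewrite ge_min lexx orbT.
  rewrite ler_pdivlMr //; clear -kap0; lra.
clearbody kap.
have C320 : 0 < (32 * C) ^+ 2 by rewrite exprn_gt0 // mulr_gt0.
have q2 : 0 < 24 * (32 * C) ^+ 2 * b1 by rewrite !mulr_gt0.
pose eta := Num.min (Num.min 1 b1) (Num.min v1 (e / (24 * (32 * C) ^+ 2 * b1))).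
have eta0 : 0 < eta by rewrite !lt_min ltr01 b10 v10 divr_gt0.
have [eta1 etab etav etae] : [/\ eta <= 1, eta <= b1, eta <= v1 &
    eta <= e / (24 * (32 * C) ^+ 2 * b1)].
  by rewrite /eta !ge_min !lexx !orbT.
clearbody eta.
have ek0 : 0 < eta ^+ k by rewrite exprn_gt0.
have ek : eta ^+ k <= eta by rewrite -[X in _ <= X]expr1 ler_wiXn2l // ltW.
pose B := 3 * eta ^+ k * (32 * C) ^+ 2.
have Bb : B * b1 <= e / 8.
  apply: (@le_trans _ _ (3 * eta * (32 * C) ^+ 2 * b1)).
    by rewrite ler_pM2r // ler_pM2r // ler_pM2l.
  by rewrite ler_pdivlMr // in etae; clear -etae; lra.
have kap2 : 0 < kap <= 2^-1 by rewrite kap0 /=; clear -kap6; lra.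
have [mu mu0 Hmu] := slope_min shape eta0 (le_trans etab b1K).
have Kk0 : 0 < K ^+ k by rewrite exprn_gt0.
have p1 : 0 < kap * eta ^+ k by rewrite mulr_gt0.
have p2 : 0 < eta ^+ k / 2 by rewrite divr_gt0.
have p3 : 0 < v1 * mu by rewrite mulr_gt0.
have p4 : 0 < (F b1 - F om) * mu by rewrite mulr_gt0.
have kC0 : 0 < kap / (32 * C) by rewrite divr_gt0 // mulr_gt0.
have e20 : 0 < e / 2 by rewrite divr_gt0.
have p5 : 0 < kap / (32 * C) * (e / 2) ^+ 2 by rewrite mulr_gt0 // exprn_gt0.
have := slow_graph_exists shape kpos v0 b0 om'K eta0 kap2.
move=> /eventually_small_and /(_ (eventually_small_c kpos p1)).
move=> /eventually_small_and /(_ (eventually_small_c kpos p2)).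
move=> /eventually_small_and /(_ (eventually_small_d k (4 * K ^+ k) p3)).
move=> /eventually_small_and /(_ (eventually_small_d k (4 * K ^+ k) p4)).
move=> /eventually_small_and /(_ (eventually_small_d k 4 p5)).
move=> /eventually_small_and /(_ (eventually_small_rho k b10)).
move=> /eventually_small_imply; apply=> nu d c rho sm [[[[[[H c1] c2] d1] d2] d3] rb1].
move=> T1 tau1 x1 y1 T2 tau2 x2 y2 orb1 orb2 good2 Y2 low start.
have d0 : 0 < d by case: sm => /andP[].
have [phi [sig [G phi0 _]]] := H _ _ _ _ orb2 good2 Y2.
rewrite -phi0 leNgt; apply/negP => gap.
have [/andP[tau0 tauT] S xtau _ _] := orb1.
have S1 : solution k F d c 0 tau1 x1 y1 by apply: sub_solution S => //; exact: ltW.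
have sig0 := graph_sig G.
have b1i : 0 < b1 < b by rewrite b10.
have kap6' : 0 < kap <= 6^-1 by rewrite kap0.
have Bbig : 2 * (eta ^+ k + `|c|) * (32 * C) ^+ 2 <= B.
  by rewrite ler_pM2r //; clear -c2; lra.
(* The errors from [b1], [kap] and [B] use at most [e / 2] of the exponent; the remaining factor
   [expR (- (e / 2) / d)] beats the required multiple of [d]. *)
have gap' : `|y1 tau1 - phi 0| * expR (((1 + 8 * kap) * (J b1 - J 0) + B * b1) / d)
    < kap * (d / (32 * C)).
  apply: (@lt_trans _ _ (expR (- (J om - J 0 + e) / d) *
    expR (((1 + 8 * kap) * (J b1 - J 0) + B * b1) / d))).
    by rewrite ltr_pM2r // expR_gt0.
  rewrite -expRD; apply: (@le_lt_trans _ _ (expR (- (e / 2) / d))).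
    rewrite ler_expR -mulrDl ler_pM2r ?invr_gt0 //.
    by clear -Jb1 kapJ Bb e0; lra.
  have -> : kap * (d / (32 * C)) = kap / (32 * C) * d by ring.
  exact: expR_inv_small.
have shadow s0 : 0 <= s0 <= tau1 -> (forall t, s0 <= t <= tau1 -> x1 t <= b1) ->
    forall t, s0 <= t <= tau1 ->
    0 <= x1 t /\ `|y1 t - phi (x1 t)| <= kap * (d / (32 * C)).
  move=> /andP[s00 s0tau] xb.
  have sh s1 : s0 <= s1 <= tau1 -> (forall t, s1 <= t <= tau1 -> - sig < x1 t) ->
      forall t, s1 <= t <= tau1 ->
      0 <= x1 t /\ `|y1 t - phi (x1 t)| <= kap * (d / (32 * C)).
    move=> /andP[s01 s1tau] xs.
    apply: (graph_shadow shape kpos d0 kap6' eta0 b1i b1K DJ (ltW c1) Bbig G _ s1tau xtau _ gap').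
      by apply: sub_solution S1 => //; exact: le_trans s01.
    move=> t /andP[t1 t2]; rewrite xs ?t1 // xb //.
    by rewrite t2 (le_trans s01).
  have [xs|] := pselect (forall t, s0 <= t <= tau1 -> - sig < x1 t).
    by apply: sh => //; rewrite lexx.
  move=> /existsNP [s /not_implyP [/andP[ss0 stau] /negP]]; rewrite -leNgt => xs.
  (* Before leaving the domain [x > - sig] of the graph, backwards in time, the orbit would pass
     [- sig / 2]; it is shadowed from there to the crossing, which forces [0 <= x]. *)
  have [||||s1 [/andP[ss1 s1tau] xs1 pos1]] :=
      @last_zero _ (fun t => x1 t + sig / 2) s tau1.
  - move=> u /andP[u0 us]; apply: continuousD; last exact: cst_continuous.
    by apply: (solution_continuous S1); rewrite us (le_trans _ u0) // (le_trans s00).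
  - by rewrite xtau; clear -sig0; lra.
  - by [].
  - by clear -xs sig0; lra.
  have s1i : s0 <= s1 <= tau1 by rewrite s1tau (le_trans ss0).
  have xs' t : s1 <= t <= tau1 -> - sig < x1 t by move=> /pos1; clear -sig0; lra.
  have [X0 _] := sh s1 s1i xs' s1 (introT andP (conj (lexx _) s1tau)).
  by clear -xs1 sig0 X0; lra.
have small_gap X : eta <= X <= b1 ->
    2 * (F X - phi X) * mu <= 4 * K ^+ k * d /\ kap * (d / (32 * C)) <= F X - phi X
      /\ 0 < F X - phi X.
  move=> /andP[X1 X2].
  have Xb : X < b by apply: le_lt_trans b1b.
  have X0 : 0 < X by apply: lt_le_trans X1.
  have XK : X <= K by apply: le_trans b1K.
  have L := graph_lower G (introT andP (conj (ltW X0) Xb)).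
  have q0 : 0 < d / (32 * C) by rewrite divr_gt0 // mulr_gt0.
  have /andP[_ U] := graph_sharp G (introT andP (conj X1 Xb)).
  have W0 : 0 < F X - phi X by apply: lt_le_trans L.
  split; last split => //.
    have muX : mu <= dF X by apply: Hmu; rewrite X1.
    have h1 : mu * (F X - phi X) <= dF X * (F X - phi X) by rewrite ler_pM2r.
    have h2 : (1 + kap) * (d * X ^+ k) <= 2 * (d * K ^+ k).
      apply: ler_pM => //; rewrite ?mulr_ge0 ?exprn_ge0 ?(ltW d0) ?(ltW X0) //.
      - by clear -kap0; lra.
      - by clear -kap6; lra.
      - by rewrite ler_pM2l // lerXn2r // nnegrE ltW.
    by clear -U h1 h2; lra.
  apply: le_trans L; rewrite ler_piMl ?(ltW q0) //.
  by clear -kap6; lra.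
(* Without a visit of [b1] the start itself is shadowed, so its height is positive and of order [d]
   if [x >= eta]; both alternatives of [start] exclude this. *)
have [xb|] := pselect (forall t, 0 <= t <= tau1 -> x1 t < b1).
  have tau0i : 0 <= (0 : R) <= tau1 by apply/andP; split; [exact: lexx | exact: ltW].
  have [X0 D0] := shadow 0 tau0i (fun t ti => ltW (xb t ti)) 0 tau0i.
  have Xb1 : x1 0 < b1 by apply: xb; rewrite lexx ltW.
  have L := graph_lower G (introT andP (conj X0 (lt_trans Xb1 b1b))).
  have q0 : 0 < d / (32 * C) by rewrite divr_gt0 // mulr_gt0.
  move: D0; rewrite ler_norml => /andP[D1 D2].
  have kq : kap * (d / (32 * C)) < d / (32 * C).
    by rewrite gtr_pMl //; clear -kap6; lra.
  case: start => [w0|[xv wv]]; first by clear -w0 L D2 kq; lra.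
  have Xi : eta <= x1 0 <= b1 by rewrite (le_trans etav) //= ltW.
  have [h1 [h2 h3]] := small_gap _ Xi.
  have h4 : v1 * mu <= 2 * (F (x1 0) - phi (x1 0)) * mu.
    by rewrite ler_pM2r //; clear -wv D1 h2; lra.
  by clear -h1 h4 d1; lra.
move=> /existsNP [s /not_implyP [/andP[s0 stau] /negP]]; rewrite -leNgt => xs.
(* At its last visit of [b1] the orbit is shadowed, so [y] is within order [d] of [F b1], although
   it is at most [F om]. *)
have [||||s1 [/andP[ss1 s1tau] xs1 pos1]] := @last_zero _ (fun t => b1 - x1 t) s tau1.
- move=> u /andP[u0 us]; apply: continuousB; first exact: cst_continuous.
  by apply: (solution_continuous S1); rewrite us (le_trans s0).
- by rewrite xtau subr0 ltW.
- by [].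
- by rewrite subr_le0.
have {}xs1 : x1 s1 = b1 by clear -xs1; lra.
have s10 : 0 <= s1 by apply: le_trans ss1.
have s1i : 0 <= s1 <= tau1 by rewrite s10.
have xb t : s1 <= t <= tau1 -> x1 t <= b1 by move=> /pos1; clear; lra.
have [_] := shadow s1 s1i xb s1 (introT andP (conj (lexx _) s1tau)).
rewrite xs1 ler_norml => /andP[D1 _].
have [|h1 [h2 h3]] := small_gap b1; first by rewrite etab lexx.
have ylow : y1 s1 <= F om by apply: low; rewrite ?s10 // xs1 ltW.
have h4 : (F b1 - F om) * mu <= 2 * (F b1 - phi b1) * mu.
  by rewrite ler_pM2r //; clear -ylow D1 h2; lra.
by clear -h1 h4 d2; lra.
Qed.

(** * Sections *)

Lemma shape_small_level (R : realType) (k : nat) (F dF : R -> R) (K C y : R) :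
  critical_shape k F dF K C -> 0 < y ->
  exists2 r, 0 < r <= K & forall u, - r <= u <= r -> F u <= y.
Proof.
move=> shape y0; have K0 := shape_K shape.
have [dl dl0 H] := continuous_at_eps (is_derive_continuous (shape_derive shape 0)) y0.
exists (Num.min (dl / 2) K).
  by rewrite lt_min K0 divr_gt0 //= ge_min lexx orbT.
move=> u /andP[u1 u2]; have := H u; rewrite (shape0 shape) subr0 ltr_norml.
have m1 : Num.min (dl / 2) K <= dl / 2 by rewrite ge_min lexx.
have ud : 0 - dl < u < 0 + dl by clear -u1 u2 m1 dl0; lra.
by move=> /(_ ud) /andP[_ /ltW].
Qed.

Lemma good_orbit_low (R : realType) (k : nat) (F dF : R -> R) (K C v e : R) :
  critical_shape k F dF K C -> 0 < v -> 0 < e ->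
  eventually_small k (fun d c rho => forall T tau x y,
    half_orbit k F d c T tau x y -> good_start F K v (x 0) (y 0) ->
    forall t, 0 <= t <= tau -> y t <= y 0 + e).
Proof.
move=> shape v0 e0.
have v20 : 0 < v / 2 by rewrite divr_gt0.
have [r /andP[r0 rK] Fr] := shape_small_level shape v20.
have := eventually_good_orbit shape v20 r0 e0.
move=> /eventually_small_imply; apply=> nu d c rho sm H T tau x y orb good t tt.
have good' : good_start F K (v / 2) (x 0) (y 0).
  by apply: good_start_weaken good; clear -v0; lra.
have Fr' : F r <= y 0 - v / 2.
  have [_ _ _ vY] := good.
  have : F r <= v / 2 by apply: Fr; rewrite lexx andbT; clear -r0; lra.
  by clear -vY; lra.
by have [t1 [_ _ _ bounds _]] := H T tau x y orb good' Fr'; have [] := bounds t tt.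
Qed.

(** * Reflection, and starts near the contact point *)

Lemma shape_reflect (R : realType) (k : nat) (F dF : R -> R) (K C : R) :
  critical_shape k F dF K C ->
  critical_shape k (fun u => F (- u)) (fun u => - dF (- u)) K C.
Proof.
move=> [DF cF F0 Fpos Fneg K0 C0 Fb]; split=> //.
- move=> x; have := DF (0 - x); rewrite sub0r => D.
  have := @is_derive_reflect _ F x 0 (dF (- x)); rewrite sub0r => /(_ D) D'.
  by apply: (is_derive_ext D') => // s; rewrite sub0r.
- move=> x; apply: (@continuousN _ _ _ (fun u => dF (- u)) x).
  exact: continuous_at_opp.
- by rewrite oppr0.
- by move=> x x0; rewrite oppr_gt0; apply: Fneg; rewrite oppr_lt0.
- by move=> x x0; rewrite oppr_lt0; apply: Fpos; rewrite oppr_gt0.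
- by move=> x xK; rewrite normrN -(normrN x); apply: Fb; rewrite normrN.
Qed.

Lemma solution_reverse (R : realType) (k : nat) (F : R -> R) (d c a b t0 : R)
    (x y : R -> R) :
  odd k -> solution k F d c a b x y ->
  solution k (fun u => F (- u)) d (- c) (t0 - b) (t0 - a)
    (fun s => - x (t0 - s)) (fun s => y (t0 - s)).
Proof.
move=> ko S t tab; have [|Dx Dy] := S (t0 - t); first lra.
split.
  have := is_deriveN (is_derive_reflect Dx).
  by rewrite !opprK.
apply: (is_derive_ext (is_derive_reflect Dy)) => //.
by rewrite exprNn -signr_odd ko expr1; ring.
Qed.

(** These starts have no uniform margin. Were [y > y1] at some [x >= rho], this would persist
    backwards to the start or to [x = rho], at time [t3]. From there the reversed reflected orbit
    runs fast towards [X = r]. Either the start is met on the way, at a level close to [y t3], or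
    the orbit lands on the other branch and its height stays positive up to the start. Neither fits
    [y 0 < y1 / 2] and [F (x 0) - y 0 <= 0]. *)
Lemma low_start_low (R : realType) (k : nat) (F dF : R -> R) (K C r y1 : R) :
  critical_shape k F dF K C -> odd k -> 0 < y1 -> 0 < r <= K ->
  (forall u, - r <= u <= r -> F u <= y1 / 4) ->
  eventually_small k (fun d c rho => forall T tau x y,
    half_orbit k F d c T tau x y ->
    - r < x 0 -> y 0 < y1 / 2 -> F (x 0) - y 0 <= 0 ->
    forall t, 0 <= t <= tau -> rho <= x t -> y t <= y1).
Proof.
move=> shape ko y10 /andP[r0 rK] Fr.
have kpos : (0 < k)%N by case: k ko {shape}.
have C0 := shape_C shape; have K0 := shape_K shape.
pose v := y1 / 2.
have v0 : 0 < v by rewrite divr_gt0.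
have y14 : 0 < y1 / 4 by rewrite divr_gt0.
have v2 : 0 < v ^+ 2 by rewrite exprn_gt0.
have r2 : 0 < r / 2 by rewrite divr_gt0.
have p2 : 0 < ((17 * C) ^+ 2)^-1 by rewrite invr_gt0 exprn_gt0 // mulr_gt0.
have p3 : 0 < 4 * C ^+ 2 * r by rewrite !mulr_gt0 // exprn_gt0.
pose nu3 := Num.min (2 * C ^+ 2 * r) ((17 * C) ^+ 2)^-1.
have p4 : 0 < 2 * C ^+ 2 * r by rewrite !mulr_gt0 // exprn_gt0.
have nu30 : 0 < nu3 by rewrite lt_min p4.
have ev3 : eventually_small k (fun d c rho => small k nu3 d c rho) by exists nu3.
have := eventually_small_c kpos (@ltr01 R).
move=> /eventually_small_and /(_ (eventually_small_d k (32 * (K ^+ k + 1) * K) v2)).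
move=> /eventually_small_and /(_ (eventually_small_d k (8 * (K ^+ k + 1) / v * K) y14)).
move=> /eventually_small_and /(_ (eventually_small_rho k r2)).
move=> /eventually_small_and /(_ ev3).
move=> /eventually_small_imply; apply=> nu d c rho sm0 [[[[c1 d1] d2] rr] sm].
clear ev3 sm0 nu.
move=> T tau x y [/andP[tau0 tauT] S xtau ytau nocross] X0 Y0 w0 t1 /andP[t10 t1tau] xt1.
have [/andP[d0 _] /andP[rho0 _] _ _ _] := sm.
rewrite leNgt; apply/negP => yt1.
have ydec s : 0 <= s -> s <= t1 -> (forall u, s <= u <= t1 -> rho <= x u) -> y1 < y s.
  move=> s0 st xr; apply: lt_le_trans yt1 _; rewrite -lerN2.
  apply: (@nondecreasing_is_derive _ (fun s => - y s) (fun s => - (d * (c - x s ^+ k)))) => //.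
    by move=> u /andP[u1 u2]; apply: is_deriveN; apply: (S u _).2; clear -u1 u2 s0 t1tau tauT; lra.
  move=> u uu; rewrite -mulrN opprB mulr_ge0 ?(ltW d0) //.
  by have [p q] := small_drift sm (xr u uu); clear -p q; lra.
have [t3 [/andP[t30 t3t1] xt3 yt3]] : exists t3, [/\ 0 <= t3 <= t1, x t3 = rho & y1 < y t3].
  have [xr|] := pselect (forall s, 0 <= s <= t1 -> rho <= x s).
    by have := ydec 0 (lexx 0) t10 xr; clear -Y0 y10; lra.
  move=> /existsNP [s /not_implyP [/andP[s0 st] /negP]]; rewrite -ltNge => xs.
  have [||||t3 [/andP[t3s t3t1] xt3 pos]] := @last_zero _ (fun s => x s - rho) s t1.
  - move=> u /andP[u0 us]; apply: continuousB; last exact: cst_continuous.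
    by apply: (solution_continuous S); clear -u0 us s0 t1tau tauT; lra.
  - by rewrite subr_ge0.
  - by [].
  - by rewrite subr_le0 ltW.
  have t30 : 0 <= t3 by apply: le_trans t3s.
  exists t3; rewrite t30; split=> //; first by clear -xt3; lra.
  by apply: ydec => // u /pos; clear; lra.
pose X s := - x (t3 - s); pose Y s := y (t3 - s).
have SR : solution k (fun u => F (- u)) d (- c) 0 t3 X Y.
  have S3 : solution k F d c 0 t3 x y.
    by apply: sub_solution S => //; clear -t3t1 t1tau tauT; lra.
  have := solution_reverse (t0 := t3) ko S3.
  by rewrite subrr subr0.
have shR := shape_reflect shape.
have smR : small k nu3 d (- c) rho by case: sm => *; split; rewrite ?normrN.
have XE0 : X 0 = - rho by rewrite /X subr0 xt3.
have YE0 : Y 0 = y t3 by rewrite /Y subr0.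
have XE1 : X t3 = - x 0 by rewrite /X subrr.
have YE1 : Y t3 = y 0 by rewrite /Y subrr.
have phase b : 0 <= b <= t3 -> (forall s, 0 <= s <= b -> X s <= r) -> `|Y b - Y 0| <= y1 / 4.
  move=> /andP[b0 bt] Xr.
  have c1' : `|- c| <= 1 by rewrite normrN ltW.
  have XK : - K <= X 0 by rewrite XE0; clear -rr rK r0 rho0; lra.
  have S' : solution k (fun u => F (- u)) d (- c) 0 b X Y by apply: sub_solution SR.
  have Fv u : X 0 <= u <= r -> F (- u) <= Y 0 - v.
    rewrite XE0 YE0 => /andP[u1 u2]; apply: (@le_trans _ _ (y1 / 4)).
      by apply: Fr; clear -u1 u2 rr r0; lra.
    by rewrite /v; clear -yt3 y10; lra.
  have [] := fast_phase shR d0 c1' v0 XK rK (ltW d1) S' Fv Xr (t := b).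
    by rewrite b0 lexx.
  by move=> H _; apply: le_trans H (ltW d2).
have [Xr|] := pselect (forall s, 0 <= s <= t3 -> X s <= r).
  have := phase t3; rewrite t30 lexx => /(_ isT Xr).
  by rewrite YE1 YE0 ler_norml; clear -Y0 yt3 y10; lra.
move=> /existsNP [s /not_implyP [/andP[s0 st] /negP]]; rewrite -ltNge => Xs.
(* Last visit of [r] in reversed time: as [X] then stays at most [r], the height is nonnegative
   there, and [descent] applies to the reflected orbit up to the start. *)
have [||||s5 [/andP[ss5 s5t3] Xs5 pos5]] := @last_zero _ (fun s => r - X s) s t3.
- move=> u /andP[u0 us]; apply: continuousB; first exact: cst_continuous.
  by apply: (solution_continuous SR); rewrite us (le_trans s0).
- by rewrite XE1; clear -X0; lra.
- by [].
- by rewrite subr_le0 ltW.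
have {}Xs5 : X s5 = r by clear -Xs5; lra.
have s50 : 0 <= s5 by apply: le_trans ss5.
have s5lt : s5 < t3.
  rewrite lt_neqAle s5t3 andbT; apply/eqP => E; move: Xs5; rewrite E XE1; clear -X0; lra.
have s5pos : 0 < s5.
  rewrite lt_neqAle s50 andbT; apply/eqP => E; move: Xs5; rewrite -E XE0; clear -rho0 r0; lra.
have w5 : 0 <= F (- X s5) - Y s5.
  rewrite leNgt; apply/negP => w5.
  have [|Dx _] := SR s5; first by rewrite s50.
  have [|eps eps0 [H _]] := is_derive_gt0 Dx; first by clear -w5; lra.
  pose u := Num.min t3 (s5 + eps / 2).
  have s1 : s5 < u by rewrite lt_min s5lt; clear -eps0; lra.
  have s2 : u <= t3 by rewrite ge_min lexx.
  have s3 : u <= s5 + eps / 2 by rewrite ge_min lexx orbT.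
  have H1 : X s5 < X u by apply: H; rewrite s1 /=; clear -s3 eps0; lra.
  have H2 : 0 <= r - X u by apply: pos5; rewrite s2 ltW.
  by clear -H1 H2 Xs5; lra.
have [|||||||t3i] := descent shR smR _ _ _ _ _ w5 _ (T := t3) (t := t3).
- rewrite Xs5; apply: (@le_lt_trans _ _ (2 * C ^+ 2 * r)); first by rewrite ge_min lexx.
  by clear -p4; lra.
- by rewrite ge_min lexx orbT.
- by rewrite Xs5; clear -rr; lra.
- by rewrite Xs5.
- by apply: sub_solution SR.
- move=> u /andP[u1 u2] [xu yu]; apply: (nocross (t3 - u)).
    by clear -u1 u2 s5pos t3t1 t1tau; lra.
  by move: xu yu; rewrite /X /Y => /eqP; rewrite oppr_eq0 => /eqP.
- by rewrite s5t3 lexx.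
rewrite XE1 YE1 opprK Xs5.
have : 0 < d / (16 * C * r) * (r - - x 0).
  by rewrite mulr_gt0 ?divr_gt0 ?mulr_gt0 //; clear -X0; lra.
by clear -w0; lra.
Qed.

(** Common form of both sections, the exit one after reflection. [side_basin] is what the fast flow
    imposes on points left of the contact point, [side_germ] what transversality gives near it, as
    [F] is flat at [0]. *)
Record section_side (R : realType) (k : nat) (F dF : R -> R) (K C : R) (J : R -> R)
    (s0 : R) (X Y om : R -> R) : Prop := SectionSide {
  side_shape : critical_shape k F dF K C;
  side_primitive : divergence_primitive k dF K J;
  side_contX : forall s, 0 <= s <= s0 -> {for s, continuous X};
  side_contY : forall s, 0 <= s <= s0 -> {for s, continuous Y};
  side_X0 : X 0 = 0;
  side_Y0 : Y 0 = 0;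
  side_Y_inc : forall s t, 0 <= s -> s < t -> t <= s0 -> Y s < Y t;
  side_om : forall s, 0 < s <= s0 -> 0 < om s < K /\ Y s = F (om s);
  side_X_bound : forall s, 0 <= s <= s0 -> - K <= X s <= K;
  side_basin : forall s, 0 < s <= s0 -> X s < 0 -> F (X s) < Y s;
  side_germ : exists2 e, 0 < e & forall s, 0 < s < e -> F (X s) < Y s }.

Definition reaches (R : realType) (k : nat) (F : R -> R) (X Y : R -> R)
    (d c s h : R) : Prop :=
  exists T tau x y, [/\ half_orbit k F d c T tau x y, x 0 = X s, y 0 = Y s & y tau = h].

(** On the exit side time is reversed: first meeting of the section after the crossing becomes
    absence of meetings strictly between the start and the crossing. *)
Definition reaches_first (R : realType) (k : nat) (F : R -> R) (X Y : R -> R)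
    (s0 d c s h : R) : Prop :=
  exists T tau x y, [/\ half_orbit k F d c T tau x y, x 0 = X s, y 0 = Y s, y tau = h &
    forall t s', 0 < t < tau -> 0 <= s' <= s0 -> ~ (x t = X s' /\ y t = Y s')].

Lemma reaches_first_reaches (R : realType) (k : nat) (F : R -> R) (X Y : R -> R)
    (s0 d c s h : R) :
  reaches_first k F X Y s0 d c s h -> reaches k F X Y d c s h.
Proof. by move=> [T [tau [x [y []]]]] *; exists T, tau, x, y. Qed.

Lemma side_good (R : realType) (k : nat) (F dF : R -> R) (K C : R) (J : R -> R)
    (s0 : R) (X Y om : R -> R) (a : R) :
  section_side k F dF K C J s0 X Y om -> 0 < a <= s0 ->
  exists2 v, 0 < v & forall p, a <= p <= s0 -> good_start F K v (X p) (Y p).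
Proof.
move=> side /andP[a0 as0]; have shape := side_shape side.
(* One continuous function for both cases of [good_start]: [g p] is [Y p - F (X p)] where [X p < 0],
   and [Y p] elsewhere. *)
pose g p := Y p - F (Num.min (X p) 0).
have cg : {within `[a, s0], continuous g}.
  apply: continuous_in_subspaceT => p; rewrite inE /= in_itv /= => /andP[p1 p2].
  have pi : 0 <= p <= s0 by rewrite p2 (le_trans (ltW a0)).
  apply: (@continuousB _ _ _ Y (fun p => F (Num.min (X p) 0))).
    exact: (side_contY side).
  apply: (@continuous_comp _ _ _ (fun p => Num.min (X p) 0) F p).
    apply: (@continuous_min _ _ X (fun=> 0) p); first exact: (side_contX side).
    exact: cst_continuous.
  exact: is_derive_continuous (shape_derive shape _).
have [p0] := EVT_min as0 cg.
rewrite in_itv /= => /andP[ap0 p0s] gmin.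
have gpos p : a <= p <= s0 -> 0 < g p.
  move=> /andP[p1 p2]; have pi : 0 < p <= s0 by rewrite p2 (lt_le_trans a0).
  have [Xp|Xp] := ltP (X p) 0.
    by rewrite /g min_l ?(ltW Xp) // subr_gt0; exact: (side_basin side).
  rewrite /g min_r // (shape0 shape) subr0.
  have := side_Y_inc side (lexx 0) (t := p); rewrite (side_Y0 side); apply.
    by case/andP: pi.
  by [].
have sa : 0 < s0 by apply: lt_le_trans as0.
have Ya : 0 < Y a by rewrite -(side_Y0 side); exact: (side_Y_inc side) (lexx 0) a0 as0.
have [|/andP[om0 omK] Yom] := side_om side (s := s0); first by rewrite sa lexx.
have FK : 0 < F K - Y s0.
  by rewrite subr_gt0 Yom; exact: shape_inc_pos shape _ _ (ltW om0) omK.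
have g0 : 0 < g p0 by apply: gpos; rewrite ap0.
exists (Num.min (g p0) (Num.min (Y a) (F K - Y s0))); first by rewrite !lt_min g0 Ya.
move=> p /andP[p1 p2]; set v := Num.min _ _.
have [v1 v2 v3] : [/\ v <= g p0, v <= Y a & v <= F K - Y s0].
  by rewrite /v !ge_min !lexx !orbT.
have Yap : Y a <= Y p.
  have [->//|ap] := eqVneq a p.
  by apply/ltW/(side_Y_inc side) => //; [exact: ltW | rewrite lt_neqAle ap].
have Yps : Y p <= Y s0.
  have [->//|ap] := eqVneq p s0.
  apply/ltW/(side_Y_inc side); rewrite ?lexx //; last by rewrite lt_neqAle ap.
  by apply: le_trans p1; exact: ltW.
split.
- by apply: (side_X_bound side); rewrite p2 (le_trans (ltW a0)).
- by clear -v3 Yps; lra.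
- have [Xp|Xp] := leP 0 (X p); [by left|right].
  have : g p0 <= g p by apply: gmin; rewrite in_itv /= p1.
  by rewrite {2}/g min_l ?(ltW Xp) //; clear -v1; lra.
- exact: le_trans v2 Yap.
Qed.

Lemma side_om_inc (R : realType) (k : nat) (F dF : R -> R) (K C : R) (J : R -> R)
    (s0 : R) (X Y om : R -> R) (p q : R) :
  section_side k F dF K C J s0 X Y om -> 0 < p -> p < q -> q <= s0 -> om p < om q.
Proof.
move=> side p0 pq qs; have shape := side_shape side.
have q0 : 0 < q by apply: lt_trans pq.
have [|/andP[omp _] Yp] := side_om side (s := p).
  by rewrite p0 ltW // (lt_le_trans pq).
have [|/andP[omq _] Yq] := side_om side (s := q); first by rewrite q0.
rewrite ltNge; apply/negP => omqp.
have := shape_nondec_pos shape (ltW omq) omqp.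
by rewrite -Yp -Yq leNgt (side_Y_inc side (ltW p0) pq qs).
Qed.

Lemma side_gap_upper (R : realType) (k : nat) (F dF : R -> R) (K C : R) (J : R -> R)
    (s0 : R) (X Y om : R -> R) (a e : R) :
  (0 < k)%N -> section_side k F dF K C J s0 X Y om -> 0 < a <= s0 -> 0 < e ->
  eventually_small k (fun d c rho => forall p q h h',
    a <= p <= s0 -> a <= q <= s0 ->
    reaches k F X Y d c p h -> reaches k F X Y d c q h' ->
    `|h - h'| <= expR (- (J (om a) - J 0 - e) / d)).
Proof.
move=> kpos side ai e0; have /andP[a0 as0] := ai.
have shape := side_shape side.
have [v v0 good] := side_good side ai.
have [/andP[om0 omK] Ya] := side_om side ai.
have omi : 0 < om a <= K by rewrite om0 ltW.
have := height_gap_upper shape kpos (side_primitive side) v0 omi e0.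
move=> /eventually_small_imply; apply=> nu d c rho sm H p q h h' pi qi.
move=> [T1 [tau1 [x1 [y1 [orb1 X1 Y1 <-]]]]] [T2 [tau2 [x2 [y2 [orb2 X2 Y2 <-]]]]].
have Ymono r : a <= r <= s0 -> F (om a) <= Y r.
  move=> /andP[r1 r2]; rewrite -Ya; have [->//|ar] := eqVneq a r.
  by apply/ltW/(side_Y_inc side) => //; [exact: ltW | rewrite lt_neqAle ar].
apply: (H _ _ _ _ _ _ _ _ orb1 orb2); rewrite ?X1 ?Y1 ?X2 ?Y2.
- exact: good.
- exact: good.
- exact: Ymono.
- exact: Ymono.
Qed.

Lemma side_gap_lower (R : realType) (k : nat) (F dF : R -> R) (K C : R) (J : R -> R)
    (s0 : R) (X Y om : R -> R) (a q0 e : R) :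
  odd k -> section_side k F dF K C J s0 X Y om -> 0 < a -> a < q0 -> q0 <= s0 -> 0 < e ->
  eventually_small k (fun d c rho => forall p q h h',
    0 <= p <= a -> F (X p) <= Y p \/ p = a -> q0 <= q <= s0 ->
    reaches k F X Y d c p h -> reaches k F X Y d c q h' ->
    expR (- (J (om a) - J 0 + e) / d) <= `|h - h'|).
Proof.
move=> ko side a0 aq qs e0.
have kpos : (0 < k)%N by case: k ko {side}.
have shape := side_shape side; have K0 := shape_K shape.
have q00 : 0 < q0 by apply: lt_trans aq.
have ai : 0 < a <= s0 by rewrite a0 (le_trans (ltW aq)).
have qi : 0 < q0 <= s0 by rewrite q00.
have [/andP[oma omaK] Ya] := side_om side ai.
have [/andP[omq omqK] Yq] := side_om side qi.
have omaq := side_om_inc side a0 aq qs.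
have e2 : 0 < e / 2 by rewrite divr_gt0.
have omi : 0 <= om a <= K by rewrite !ltW.
have [dl dl0 Hdl] := continuous_at_eps (is_derive_continuous (side_primitive side omi)) e2.
(* [F om1] leaves room above the level of [a] for a small rise of [y], at the cost of [e / 2] in the
   exponent. *)
pose om1 := om a + Num.min (dl / 2) ((om q0 - om a) / 2).
have omd : 0 < om q0 - om a by rewrite subr_gt0.
have m0 : 0 < Num.min (dl / 2) ((om q0 - om a) / 2) by rewrite lt_min !divr_gt0.
have m1 : Num.min (dl / 2) ((om q0 - om a) / 2) <= dl / 2 by rewrite ge_min lexx.
have m2 : Num.min (dl / 2) ((om q0 - om a) / 2) <= (om q0 - om a) / 2.
  by rewrite ge_min lexx orbT.
have [om1a om1q] : om a < om1 /\ om1 < om q0.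
  by rewrite /om1; split; clear -m0 m1 m2 omd; lra.
have Jom1 : J om1 <= J (om a) + e / 2.
  have om1i : om a - dl < om1 < om a + dl by rewrite /om1; clear -m0 m1 dl0; lra.
  by have := Hdl _ om1i; rewrite ltr_norml; clear; lra.
clearbody om1; clear Hdl m0 m1 m2 dl0 dl.
have om10 : 0 < om1 by apply: lt_trans om1a.
have y10 : 0 < F om1 by rewrite -(shape0 shape); exact: shape_inc_pos shape _ _ (lexx 0) om10.
have y14 : 0 < F om1 / 4 by rewrite divr_gt0.
have y12 : 0 < F om1 / 2 by rewrite divr_gt0.
have [r /andP[r0 rK] Fr] := shape_small_level shape y14.
have s00 : 0 <= (0 : R) <= s0.
  by apply/andP; split; [exact: lexx | exact: le_trans (ltW q00) qs].
have [dX dX0 HX] := continuous_at_eps (side_contX side s00) r0.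
have [dY dY0 HY] := continuous_at_eps (side_contY side s00) y12.
pose p0 := Num.min (Num.min (dX / 2) (dY / 2)) a.
have p00 : 0 < p0 by rewrite !lt_min a0 !divr_gt0.
have [p01 p02 p03] : [/\ p0 <= dX / 2, p0 <= dY / 2 & p0 <= a].
  by rewrite /p0 !ge_min !lexx !orbT.
clearbody p0.
have p0i : 0 < p0 <= s0 by rewrite p00 (le_trans p03) // ; case/andP: ai.
have [v v0 good] := side_good side p0i.
have Fgap : 0 < F om1 - F (om a) by rewrite subr_gt0; exact: shape_inc_pos shape _ _ (ltW oma) om1a.
(* If [a] lies under the curve then [X a > 0], and [v1] measures its abscissa and height; otherwise
   the start falls under the first alternative of [height_gap_lower] and [1] is arbitrary. *)
pose v1 := if 0 < F (X a) - Y a then Num.min (X a) (F (X a) - Y a) else 1.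
have Xa_pos : 0 < F (X a) - Y a -> 0 < X a.
  rewrite subr_gt0 => H; rewrite ltNge; apply/negP; rewrite le_eqVlt => /orP[/eqP E|Xa].
    move: H; rewrite E (shape0 shape) Ya ltNge => /negP; apply.
    exact: shape_ge0 shape _.
  by have := side_basin side ai Xa; rewrite ltNge ltW.
have v10 : 0 < v1.
  rewrite /v1; case: ifP => [H|_]; last exact: ltr01.
  by rewrite lt_min H Xa_pos.
have om1i : 0 < om1 < om q0 by rewrite om10.
have low2 := height_gap_lower shape kpos (side_primitive side) v0 v10 om1i (ltW omqK) e2.
have rKi : 0 < r <= K by rewrite r0.
move: (low_start_low shape ko y10 rKi Fr) => low1.
have := eventually_small_and low1 (eventually_small_and (good_orbit_low shape v0 Fgap) low2).
clear low1 low2.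
move=> /eventually_small_imply; apply=> nu d c rho sm [tiny [goodlow H]].
move=> p q h h' /andP[p1 p2] inside /andP[q1 q2].
move=> [T1 [tau1 [x1 [y1 [orb1 X1 Y1 <-]]]]] [T2 [tau2 [x2 [y2 [orb2 X2 Y2 <-]]]]].
have d0 : 0 < d by case: sm => /andP[].
have as0 : a <= s0 by case/andP: ai.
have Ypa : Y p <= Y a.
  have [->//|pa] := eqVneq p a.
  by apply/ltW/(side_Y_inc side) => //; rewrite lt_neqAle pa.
apply: (@le_trans _ _ (expR (- (J om1 - J 0 + e / 2) / d))).
  by rewrite ler_expR ler_pM2r ?invr_gt0 //; clear -Jom1; lra.
apply: (H _ _ _ _ _ _ _ _ orb1 orb2).
- by rewrite X2 Y2; apply: good; rewrite q2 (le_trans p03) // (le_trans (ltW aq)).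
- rewrite Y2 -Yq; have [->//|nq] := eqVneq q0 q.
  by apply/ltW/(side_Y_inc side) => //; [exact: ltW | rewrite lt_neqAle nq].
- move=> t ti xt; have [pp|pp] := leP p0 p.
    apply: le_trans (goodlow _ _ _ _ orb1 _ t ti) _.
      by rewrite X1 Y1; apply: good; rewrite pp (le_trans p2).
    by rewrite Y1; rewrite Ya in Ypa; clear -Ypa; lra.
  have pa : p < a by apply: lt_le_trans p03.
  apply: (tiny _ _ _ _ orb1) => //; rewrite ?X1 ?Y1.
  + have pX : 0 - dX < p < 0 + dX by clear -p1 pp p01 dX0; lra.
    by have := HX p pX; rewrite (side_X0 side) subr0 ltr_norml => /andP[].
  + have pY : 0 - dY < p < 0 + dY by clear -p1 pp p02 dY0; lra.
    by have := HY p pY; rewrite (side_Y0 side) subr0 ltr_norml => /andP[].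
  + by case: inside => [|E]; [rewrite subr_le0 | move: pa; rewrite E ltxx].
- rewrite X1 Y1; case: inside => [H1|->]; first by left; rewrite subr_le0.
  rewrite /v1; case: ifP => [_|/negbT]; last by rewrite -leNgt; left.
  by right; rewrite !ge_min !lexx orbT.
Qed.

(* A section point inside [y < F x] is met by the orbits landing further out
   before they cross. *)
Lemma side_inside (R : realType) (k : nat) (F dF : R -> R) (K C : R) (J : R -> R)
    (s0 : R) (X Y om : R -> R) (p q0 : R) :
  (0 < k)%N -> section_side k F dF K C J s0 X Y om -> 0 < p -> p < q0 -> q0 <= s0 ->
  Y p < F (X p) ->
  eventually_small k (fun d c rho => forall q h,
    q0 <= q <= s0 -> ~ reaches_first k F X Y s0 d c q h).
Proof.
move=> kpos side p0 pq qs outside.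
have shape := side_shape side; have K0 := shape_K shape.
have q00 : 0 < q0 by apply: lt_trans pq.
have pi : 0 < p <= s0 by rewrite p0 (le_trans (ltW pq)).
have qi : 0 < q0 <= s0 by rewrite q00.
have [/andP[omp ompK] Yp] := side_om side pi.
have [/andP[omq omqK] Yq] := side_om side qi.
have ompq := side_om_inc side p0 pq qs.
pose f s := F (X s) - Y s.
have cf s : 0 <= s <= s0 -> {for s, continuous f}.
  move=> si; apply: (@continuousB _ _ _ (F \o X) Y); last exact: (side_contY side).
  apply: continuous_comp; first exact: (side_contX side).
  exact: is_derive_continuous (shape_derive shape _).
have [e e0 germ] := side_germ side.
pose a := Num.min (e / 2) (p / 2).
have a0 : 0 < a by rewrite lt_min !divr_gt0.
have ae : a <= e / 2 by rewrite ge_min lexx.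
have ap : a <= p / 2 by rewrite ge_min lexx orbT.
(* The section starts above the curve; it meets it for the last time before [p] at [s1] and stays on
   or under it from [s1] to [p]. *)
have [||||s1 [/andP[as1 s1p] fs1 pos1]] := @last_zero _ f a p.
- move=> s /andP[sa sp]; apply: cf; rewrite (le_trans (ltW a0)) //=.
  by apply: le_trans sp _; case/andP: pi.
- by rewrite subr_ge0 ltW.
- by clear -ap p0; lra.
- by rewrite subr_le0 ltW // germ //; clear -a0 ae e0; lra.
have s10 : 0 < s1 by apply: lt_le_trans as1.
have ps0 : p <= s0 by case/andP: pi.
have s1i : 0 < s1 <= s0 by rewrite s10 (le_trans s1p).
have [/andP[om1 om1K] Y1] := side_om side s1i.
have Xpos s : s1 <= s <= p -> 0 < X s.
  move=> si; have si' : 0 < s <= s0 by clear -si s10 ps0; lra.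
  have fs := pos1 s si; rewrite subr_ge0 in fs.
  have [/andP[oms _] Ys] := side_om side si'.
  have Ypos : 0 < F (om s).
    by rewrite -(shape0 shape); exact: shape_inc_pos shape _ _ (lexx 0) oms.
  rewrite ltNge; apply/negP; rewrite le_eqVlt => /orP[/eqP E|Xs].
    by move: fs; rewrite E (shape0 shape) Ys leNgt Ypos.
  by have := side_basin side si' Xs; rewrite ltNge fs.
have Xlow s : s1 <= s <= p -> om s1 <= X s.
  move=> si; have fs := pos1 s si; rewrite subr_ge0 in fs.
  rewrite leNgt; apply/negP => Xs.
  have := shape_inc_pos shape (ltW (Xpos s si)) Xs; rewrite -Y1.
  have : Y s1 <= Y s.
    have [->//|ss] := eqVneq s1 s.
    have /andP[s1s sp] := si.
    by apply/ltW/(side_Y_inc side); [exact: ltW | rewrite lt_neqAle ss | exact: le_trans ps0].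
  by clear -fs; lra.
have X1 : X s1 <= om p.
  rewrite leNgt; apply/negP => H.
  have := shape_inc_pos shape (ltW omp) H; rewrite -Yp.
  have Fs1 : F (X s1) = Y s1 by apply/eqP; rewrite -subr_eq0; apply/eqP.
  rewrite Fs1 ltNge => /negP; apply.
  have [->//|ss] := eqVneq s1 p.
  by apply/ltW/(side_Y_inc side) => //; [exact: ltW | rewrite lt_neqAle ss].
pose b := (om p + om q0) / 2.
have [bp bq] : om p < b /\ b < om q0 by rewrite /b; split; clear -ompq; lra.
clearbody b.
(* The arc is cut where [X] reaches [b], because the slow graph is only available for abscissas
   below [b']; at the cut the section is still under the curve by a fixed amount. *)
have [s2 [/andP[s12 s2p] fs2 Xb]] : exists s2, [/\ s1 <= s2 <= p, 0 < f s2 &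
    forall s, s1 <= s <= s2 -> X s <= b].
  have [Xb|] := pselect (forall s, s1 <= s <= p -> X s <= b).
    by exists p; split; rewrite ?s1p ?lexx ?subr_gt0.
  move=> /existsNP [s /not_implyP [/andP[s1s sp] /negP]]; rewrite -ltNge => Xs.
  have [||||s2 [/andP[s12 s2s] Xs2 pos2]] := @first_zero _ (fun s => b - X s) s1 s.
  - move=> u /andP[u0 us]; apply: continuousB; first exact: cst_continuous.
    by apply: (side_contX side); clear -u0 us sp ps0 s10; lra.
  - by rewrite subr_ge0; clear -X1 bp; lra.
  - by [].
  - by rewrite subr_le0 ltW.
  have s2p : s2 <= p by apply: le_trans sp.
  exists s2; split; first by rewrite s12.
    have -> : f s2 = F b - Y s2 by rewrite /f; congr (F _ - _); clear -Xs2; lra.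
    rewrite subr_gt0; apply: (@le_lt_trans _ _ (Y p)); last first.
      by rewrite Yp; exact: shape_inc_pos shape _ _ (ltW omp) bp.
    have [->//|ss] := eqVneq s2 p.
    apply/ltW/(side_Y_inc side) => //; last by rewrite lt_neqAle ss.
    by apply: le_trans s12; exact: ltW.
  by move=> u /pos2; clear; lra.
have Xi s : s1 <= s <= s2 -> om s1 <= X s <= b.
  move=> /andP[u1 u2]; rewrite Xb ?u1 // Xlow // u1 /=.
  exact: le_trans s2p.
pose b' := (b + om q0) / 2.
have [bb' b'q] : b < b' /\ b' < om q0 by rewrite /b'; split; clear -bq; lra.
clearbody b'.
have b'i : 0 < b' < om q0.
  by rewrite b'q andbT (lt_trans _ bb') // (lt_trans _ bp).
have omK : om s1 <= K by exact: ltW.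
have [mu mu0 Hmu] := slope_min shape om1 omK.
have [v v0 good] := side_good side qi.
have half : 0 < 2^-1 :> R by rewrite invr_gt0.
have := slow_graph_exists shape kpos v0 b'i (ltW omqK) om1 (introT andP (conj half (lexx _))).
have p1 : 0 < f s2 * mu by rewrite mulr_gt0.
move=> /eventually_small_and /(_ (eventually_small_d k (2 * K ^+ k) p1)).
move=> /eventually_small_imply; apply=> nu d c rho sm [H d1].
move=> q h /andP[q1 q2] [T [tau [x [y [orb Xq Yq' _ nomeet]]]]].
have d0 : 0 < d by case: sm => /andP[].
have [||phi [sig [G _ pts]]] := H _ _ _ _ orb.
- by rewrite Xq Yq'; apply: good; rewrite q1.
- rewrite Yq' -Yq; have [->//|nq] := eqVneq q0 q.
  by apply/ltW/(side_Y_inc side) => //; [exact: ltW | rewrite lt_neqAle nq].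
have sig0 := graph_sig G.
have Xin s : s1 <= s <= s2 -> - sig < X s < b'.
  move=> /Xi /andP[u1 u2]; rewrite (le_lt_trans u2) // andbT.
  by clear -u1 om1 sig0; lra.
have cphi s : s1 <= s <= s2 -> {for s, continuous (fun s => phi (X s))}.
  move=> si; apply: (@continuous_comp _ _ _ X phi).
    by apply: (side_contX side); clear -si s10 s2p ps0; lra.
  by have [_ Dp] := graph_derive G (Xin s si); exact: is_derive_continuous Dp.
have cg s : s1 <= s <= s2 -> {for s, continuous (fun s => Y s - phi (X s))}.
  move=> si; apply: continuousB; last exact: cphi.
  by apply: (side_contY side); clear -si s10 s2p ps0; lra.
(* The graph of the orbit lies under the curve, by an amount of order [d]: the section is above it
   at [s1] and below it at [s2], so they intersect. *)
have [|||s [si gs _]] := first_zero cg.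
- have s1s : s1 <= s1 <= s2 by rewrite lexx.
  have [W _] := graph_derive G (Xin s1 s1s).
  by move: fs1 W; rewrite /f; clear; lra.
- by [].
- have s2s : s1 <= s2 <= s2 by rewrite s12 lexx.
  have /andP[u1 u2] := Xi s2 s2s.
  have Xs2 : om s1 <= X s2 < b' by rewrite u1 (le_lt_trans u2).
  have /andP[_ U] := graph_sharp G Xs2.
  have [W0 _] := graph_derive G (Xin s2 s2s).
  have X0 : 0 < X s2 by apply: lt_le_trans u1.
  have XK : X s2 <= K by clear -u2 bq omqK; lra.
  have h1 : mu * (F (X s2) - phi (X s2)) <= dF (X s2) * (F (X s2) - phi (X s2)).
    by rewrite ler_pM2r // Hmu // u1.
  have h2 : (1 + 2^-1) * (d * X s2 ^+ k) <= 2 * (d * K ^+ k).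
    apply: ler_pM => //; rewrite ?mulr_ge0 ?exprn_ge0 ?(ltW d0) ?(ltW X0) //.
    - by clear; lra.
    - by rewrite ler_pM2l // lerXn2r // nnegrE ltW.
  have h3 : (F (X s2) - phi (X s2)) * mu < f s2 * mu by clear -U h1 h2 d1; lra.
  by rewrite ltr_pM2r // in h3; move: h3; rewrite /f; clear; lra.
have /andP[u1 u2] := Xi s si.
have Xs0 : 0 < X s by apply: lt_le_trans u1.
have [|t /andP[t0 ttau] [xt yt]] := pts (X s).
  by rewrite (ltW Xs0) (le_lt_trans u2).
have xtau := orbit_end orb.
apply: (nomeet t s).
- rewrite t0 lt_neqAle ttau andbT; apply/eqP => E.
  by move: xt; rewrite E xtau => E2; rewrite -E2 ltxx in Xs0.
- by clear -si s10 s2p ps0; lra.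
- by split=> //; rewrite yt; clear -gs; lra.
Qed.

(** * The slow divergence integral *)

(** The fundamental theorem is applied to integrals with a fixed lower bound; [- A] serves both
    orientations. *)
Lemma oriented_integral_primitive (R : realType) (g : R -> R) (A u : R) :
  continuous g -> - A <= u <= A -> 0 <= A ->
  oriented_integral 0 u g =
    \int[lebesgue_measure]_(x in `[(- A), u]) g x -
    \int[lebesgue_measure]_(x in `[(- A), 0]) g x.
Proof.
move=> cg /andP[Au uA] A0.
have ig a b : lebesgue_measure.-integrable `[a, b] (EFin \o g).
  apply: continuous_compact_integrable; first exact: segment_compact.
  exact: continuous_subspaceT.
have igo a b : lebesgue_measure.-integrable `]a, b] (EFin \o g).
  by apply: integrableS (ig a b) => //; apply: subset_itvr; rewrite bnd_simp.
rewrite /oriented_integral; case: ifP => [u0|/negbT]; last rewrite -ltNge => u0.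
  rewrite (@Rintegral_itvB _ g (BLeft (- A)) (BRight u) 0) ?bnd_simp //; last by lra.
  by rewrite Rintegral_itv_obnd_cbnd.
rewrite -[RHS]opprB; congr (- _).
rewrite (@Rintegral_itvB _ g (BLeft (- A)) (BRight 0) u) ?bnd_simp //; last exact: ltW.
by rewrite Rintegral_itv_obnd_cbnd.
Qed.

Lemma is_derive_oriented_integral (R : realType) (g : R -> R) (X : R) :
  continuous g -> is_derive X (1 : R) (fun u => oriented_integral 0 u g) (g X).
Proof.
move=> cg; pose A : R := `|X| + 1.
have A0 : 0 < A by rewrite ltr_wpDl.
have [XA1 XA2] : - A < X /\ X < A.
  by have := ler_norm X; have := ler_norm (- X); rewrite normrN /A; split; lra.
pose G (u : R) : R := \int[lebesgue_measure]_(x in `[(- A), u]) g x.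
have [DG GE] : derivable G X 1 /\ derive1 G X = g X.
  apply: (@continuous_FTC1_closed _ g (- A) X A) => //.
    apply: continuous_compact_integrable; first exact: segment_compact.
    exact: continuous_subspaceT.
  exact: cg.
have D : is_derive X (1 : R) (fun u => G u - G 0) (g X).
  have DG' : is_derive X (1 : R) G (g X) by rewrite -GE derive1E; exact/derivableP.
  by have := is_deriveB DG' (is_derive_cst (G 0) X (1 : R)); rewrite subr0.
apply: (near_eq_is_derive _ D).
near=> u; rewrite /G -oriented_integral_primitive //; last exact: ltW.
have : u \in `]- A, A[ by near: u; apply: near_in_itvoo; rewrite in_itv /= XA1.
by rewrite in_itv /= => /andP[? ?]; rewrite !ltW.
Unshelve. all: by end_near.
Qed.

Lemma smooth_derive (R : realType) (g : R -> R) (x : R) :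
  smooth g -> is_derive x (1 : R) g (derive1 g x).
Proof. by move=> sg; rewrite derive1E; apply/derivableP; exact: (sg 0%N x). Qed.

Lemma smooth_derive1_continuous (R : realType) (g : R -> R) :
  smooth g -> continuous (derive1 g).
Proof. by move=> sg x; apply/differentiable_continuous/derivable1_diffP; exact: (sg 1%N x). Qed.

Lemma critical_graph_derive (R : realType) (n : nat) (ft : R -> R) (x : R) :
  (0 < n)%N -> smooth ft ->
  is_derive x (1 : R) (critical_graph n ft)
    (x ^+ (2 * n - 1) * ((2 * n)%:R * ft x + x * derive1 ft x)).
Proof.
move=> n0 sft; have Dft := smooth_derive x sft.
have DX := is_deriveX (2 * n) (is_derive_id x (1 : R)).
apply: (is_derive_ext (is_deriveM DX Dft)).
  by move=> s; rewrite /critical_graph !fctE.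
have [m ->] : exists m, (2 * n)%N = m.+1.
  by exists (2 * n - 1)%N; rewrite subn1 prednK // muln_gt0.
by rewrite subSS subn0 /GRing.scale /= !fctE exprS mulr1; ring.
Qed.

Lemma critical_graph_derive1 (R : realType) (n : nat) (ft : R -> R) (x : R) :
  (0 < n)%N -> smooth ft ->
  derive1 (critical_graph n ft) x =
    x ^+ (2 * n - 1) * ((2 * n)%:R * ft x + x * derive1 ft x).
Proof.
move=> n0 sft; rewrite derive1E.
exact: (@derive_val _ _ _ _ _ _ _ (critical_graph_derive x n0 sft)).
Qed.

Lemma critical_slope_continuous (R : realType) (n : nat) (ft : R -> R) :
  smooth ft -> continuous (fun x => (2 * n)%:R * ft x + x * derive1 ft x).
Proof.
move=> sft x.
apply: (@continuousD _ _ _ (fun x => (2 * n)%:R * ft x) (fun x => x * derive1 ft x)).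
  apply: (@continuousM _ _ (fun=> (2 * n)%:R) ft); first exact: cst_continuous.
  exact: is_derive_continuous (smooth_derive x sft).
apply: (@continuousM _ _ id (derive1 ft)) => //.
exact: smooth_derive1_continuous.
Qed.

Lemma critical_graph_shape (R : realType) (n : nat) (ft : R -> R) (K : R) :
  (0 < n)%N -> smooth ft ->
  (forall x, 0 < x -> 0 < derive1 (critical_graph n ft) x) ->
  (forall x, x < 0 -> derive1 (critical_graph n ft) x < 0) -> 0 < K ->
  exists C, critical_shape (2 * n - 1) (critical_graph n ft)
    (derive1 (critical_graph n ft)) K C.
Proof.
move=> n0 sft fpos fneg K0.
(* The derivative is [x ^+ (2 * n - 1) * g x] with [g] continuous; [C] is the maximum of its
   absolute value on [[- K, K]], plus [1] to be positive. *)
pose g x := (2 * n)%:R * ft x + x * derive1 ft x.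
have cg : continuous g by exact: critical_slope_continuous.
have KK : - K <= K by lra.
have cw : {within `[(- K), K], continuous (fun x => `|g x|)}.
  by apply: continuous_subspaceT => x; apply: continuous_comp; [exact: cg | exact: norm_continuous].
have [z _ Hz] := EVT_max KK cw.
exists (`|g z| + 1); split.
- by move=> x; rewrite critical_graph_derive1 //; exact: critical_graph_derive.
- move=> x; rewrite (_ : derive1 _ = fun x => x ^+ (2 * n - 1) * g x).
    by apply: cvgM; [exact: exprn_continuous | exact: cg].
  by apply/funext => y; exact: critical_graph_derive1.
- by rewrite /critical_graph expr0n muln_eq0 /= eqn0Ngt n0 mul0r.
- exact: fpos.
- exact: fneg.
- exact: K0.
- by rewrite ltr_wpDl.
move=> x; rewrite ler_norml => xK; rewrite critical_graph_derive1 // normrM normrX mulrC.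
apply: ler_wpM2r; first exact: exprn_ge0.
by apply: (@le_trans _ _ `|g z|); [apply: Hz; rewrite in_itv | rewrite lerDl].
Qed.

Lemma slow_divergence_continuous (R : realType) (n : nat) (ft : R -> R) :
  (0 < n)%N -> smooth ft -> continuous (slow_divergence n ft).
Proof.
move=> n0 sft.
rewrite (_ : slow_divergence n ft = fun x => x ^+ (2 * n - 1) *
    ((2 * n)%:R * ft x + x * derive1 ft x) ^+ 2).
  move=> x; apply: cvgM; first exact: exprn_continuous.
  apply: (@continuous_comp _ _ _ (fun x => (2 * n)%:R * ft x + x * derive1 ft x)
    (fun x => x ^+ 2)); [exact: critical_slope_continuous | exact: exprn_continuous].
apply/funext => x; rewrite /slow_divergence critical_graph_derive1 //.
have k0 : (2 * n - 1 != 0)%N by rewrite subn_eq0 -ltnNge (leq_trans _ (leq_mul (leqnn 2) n0)).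
have [->|x0] := eqVneq x 0.
  by rewrite !expr0n (negbTE k0) !mul0r expr0n /= mul0r.
by field; rewrite expf_neq0.
Qed.

(** * Orbits of the fast subsystem *)

Definition fast_orbit (R : realType) (F : R -> R) (x0 y0 om : R) : Prop :=
  exists x y : R -> R, [/\ x 0 = x0, y 0 = y0,
    (forall t : R, 0 <= t -> is_derive t (1 : R) x (y t - F (x t)) /\
       is_derive t (1 : R) y 0),
    x t @[t --> +oo] --> om & y t @[t --> +oo] --> F om].

Lemma fast_orbit_level (R : realType) (F : R -> R) (x0 y0 om : R) :
  fast_orbit F x0 y0 om -> y0 = F om.
Proof.
move=> [x [y [_ <- D _ ly]]].
have yc t : 0 <= t -> y t = y 0.
  rewrite le_eqVlt => /orP[/eqP <- //|t0].
  have Dy s : 0 <= s <= t -> is_derive s (1 : R) y ((fun=> 0) s).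
    by move=> /andP[s0 _]; exact: (D s s0).2.
  have [s _ E] := MVT_cc Dy t0.
  by apply/eqP; rewrite -subr_eq0 E mul0r.
have ly' : y t @[t --> +oo] --> y 0.
  apply: cvg_near_cst; exists 0; split; first exact: num_real.
  by move=> t t0; apply: yc; exact: ltW.
by apply: (cvg_unique _ ly' ly).
Qed.

(** From a point on or under the curve with [x0 < 0] the orbit cannot move to the right: between
    [x0] and [0] one has [x' <= L * (x - x0)], so [(x - x0) * expR (- (L * t))] cannot grow from
    [0], and [om > 0] is never approached. *)
Lemma fast_orbit_basin (R : realType) (k : nat) (F dF : R -> R) (K C x0 y0 om : R) :
  critical_shape k F dF K C -> fast_orbit F x0 y0 om -> 0 < om -> - K <= x0 ->
  x0 < 0 -> F x0 < y0.
Proof.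
move=> shape [x [y [X0 Y0 D lx ly]]] om0 Kx0 x00.
have K0 := shape_K shape; have C0 := shape_C shape.
rewrite ltNge; apply/negP => Fx0.
have yc t : 0 <= t -> y t = y0.
  rewrite -Y0 le_eqVlt => /orP[/eqP <- //|t0].
  have Dy s : 0 <= s <= t -> is_derive s (1 : R) y ((fun=> 0) s).
    by move=> /andP[s0 _]; exact: (D s s0).2.
  have [s _ E] := MVT_cc Dy t0.
  by apply/eqP; rewrite -subr_eq0 E mul0r.
have [t1 [t10 xt1]] : exists t1, 0 <= t1 /\ 0 < x t1.
  have /cvgrPdist_lt /(_ om om0) [M [_ HM]] := lx.
  exists (Num.max M 0 + 1); have M1 : M <= Num.max M 0 by rewrite le_max lexx.
  have M2 : 0 <= Num.max M 0 by rewrite le_max lexx orbT.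
  split; first by lra.
  have /= := HM (Num.max M 0 + 1); rewrite ltr_norml => H.
  have M3 : M < Num.max M 0 + 1 by clear -M1; lra.
  by have /andP[_] := H M3; clear; lra.
have cx t : 0 <= t -> {for t, continuous x}.
  by move=> t0; exact: is_derive_continuous (D t t0).1.
have [||||t0 [/andP[t00 t01] xt0 pos0]] := @last_zero _ (fun t => x t - x0) 0 t1.
- move=> t /andP[tp _]; apply: continuousB; last exact: cst_continuous.
  exact: cx.
- by lra.
- by [].
- by rewrite X0 subrr.
have [||||t2 [/andP[t02 t21] xt2 pos2]] := @first_zero _ (fun t => x0 / 2 - x t) t0 t1.
- move=> t /andP[tp _]; apply: continuousB; first exact: cst_continuous.
  by apply: cx; lra.
- by lra.
- by [].
- by lra.
pose L := C * K ^+ k.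
have lip u : x0 <= u <= 0 -> F x0 - F u <= L * (u - x0).
  move=> /andP[]; rewrite le_eqVlt => /orP[/eqP <- _|ux u0]; first by rewrite !subrr mulr0.
  have [xi /andP[xi1 xi2] E] := MVT_cc (fun t _ => shape_derive shape t) ux.
  rewrite -opprB E -mulNr ler_pM2r ?subr_gt0 //.
  have xiK : `|xi| <= K by rewrite ler_norml; clear -xi1 xi2 u0 Kx0 K0; lra.
  apply: le_trans (ler_norm _) _; rewrite normrN.
  apply: le_trans (shape_bound shape xiK) _; rewrite /L ler_pM2l //.
  by rewrite lerXn2r // nnegrE ltW.
pose h t := - ((x t - x0) * expR (- (L * t))).
have : h t0 <= h t2.
  apply: (@nondecreasing_is_derive _ h
    (fun t => - ((y t - F (x t) - L * (x t - x0)) * expR (- (L * t))))) => //.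
    move=> t /andP[tt0 _]; have tp : 0 <= t by apply: le_trans tt0.
    have D1 := is_deriveB (D t tp).1 (is_derive_cst x0 t (1 : R)).
    have D2 := is_deriveN (is_deriveZ L (is_derive_id t (1 : R))).
    have D3 := @is_derive1_comp _ expR (fun t => - (L * t)) t _ _ (is_derive_expR _) D2.
    apply: (is_derive_ext (is_deriveN (is_deriveM D1 D3))) => //.
    by rewrite /GRing.scale /= !fctE mulr1 subr0; ring.
  move=> t tt; rewrite -mulNr mulr_ge0 ?expR_ge0 // oppr_ge0.
  have p2 := pos2 t tt.
  have p0 : 0 <= x t - x0 by apply: pos0; clear -tt t21; lra.
  have tp : 0 <= t by clear -tt t00; lra.
  rewrite (yc t tp); have xi : x0 <= x t <= 0 by clear -p2 p0 x00; lra.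
  by have := lip _ xi; clear -Fx0; lra.
rewrite /h xt0 mul0r oppr0 oppr_ge0 pmulr_lle0 ?expR_gt0 //.
by clear -xt2 x00; lra.
Qed.

Lemma make_section_side (R : realType) (k : nat) (F dF J X dX Y dY om : R -> R) (s0 : R) :
  (0 < k)%N -> (forall K, 0 < K -> exists C, critical_shape k F dF K C) ->
  (forall u, is_derive u (1 : R) J (dF u ^+ 2 / u ^+ k)) ->
  0 < s0 -> (forall s, is_derive s (1 : R) X (dX s)) ->
  (forall s, is_derive s (1 : R) Y (dY s)) -> continuous dY ->
  X 0 = 0 -> Y 0 = 0 -> (forall s, 0 <= s <= s0 -> dY s != 0) ->
  (forall s, 0 < s <= s0 -> 0 < om s /\ fast_orbit F (X s) (Y s) (om s)) ->
  exists K C, section_side k F dF K C J s0 X Y om.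
Proof.
move=> kpos hs DJ s00 DX DY cdY X0 Y0 dYn fast.
have cX s : {for s, continuous X} by exact: is_derive_continuous (DX s).
have cY s : {for s, continuous Y} by exact: is_derive_continuous (DY s).
have cw : {within `[0, s0], continuous (fun s => `|X s|)}.
  apply: continuous_subspaceT => s; apply: continuous_comp; first exact: cX.
  exact: norm_continuous.
have [z _ Hz] := EVT_max (ltW s00) cw.
have [|oms0 _] := fast s0; first by rewrite s00 lexx.
pose K := `|X z| + om s0 + 1.
have K0 : 0 < K by rewrite /K; have := normr_ge0 (X z); lra.
have [C shape] := hs K K0.
have XK s : 0 <= s <= s0 -> - K <= X s <= K.
  move=> si; rewrite -ler_norml; apply: (@le_trans _ _ `|X z|).
    by apply: Hz; rewrite in_itv.
  by rewrite /K; lra.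
have lvl s : 0 < s <= s0 -> Y s = F (om s).
  by move=> si; have [_ /fast_orbit_level] := fast s si.
have Ypos s : 0 < s <= s0 -> 0 < Y s.
  move=> si; rewrite lvl // -(shape0 shape).
  by apply: (shape_inc_pos shape) => //; have [] := fast s si.
have s0i : 0 <= (0 : R) <= s0 by apply/andP; split; [exact: lexx | exact: ltW].
(* Transversality gives only [dY != 0]; the sign comes from [Y > 0] on []0, s0]], where [Y s] is the
   landing level [F (om s)]. *)
have dY0 : 0 < dY 0.
  rewrite lt_neqAle eq_sym dYn //= leNgt; apply/negP => neg.
  have [|e e0 [H _]] := is_derive_gt0 (is_deriveN (DY 0)); first by rewrite oppr_gt0.
  pose s := Num.min s0 (e / 2).
  have s1 : 0 < s by rewrite lt_min s00 divr_gt0.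
  have s2 : s <= s0 by rewrite ge_min lexx.
  have s3 : s <= e / 2 by rewrite ge_min lexx orbT.
  have /= := H s; rewrite !fctE Y0 oppr0 oppr_gt0 => Hs.
  have : Y s < 0 by apply: Hs; clear -s1 s3 e0; lra.
  have := Ypos s; rewrite s1 s2 => /(_ isT); clear; lra.
have dYpos s : 0 <= s <= s0 -> 0 < dY s.
  apply: (@positivity_persists _ dY 0 s0).
  - by move=> t _; exact: cdY.
  - by [].
  - by move=> t ti _; exact: dYn.
have Yinc s t : 0 <= s -> s < t -> t <= s0 -> Y s < Y t.
  move=> a1 a2 a3; apply: (@increasing_is_derive _ Y dY) => // u /andP[u1 u2].
  by apply: dYpos; clear -a1 a3 u1 u2; lra.
exists K, C; split=> //.
- move=> s si; have [om0 _] := fast s si; split; last exact: lvl.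
  rewrite om0 /=; apply: (@le_lt_trans _ _ (om s0)); last first.
    by rewrite /K; have := normr_ge0 (X z); clear; lra.
  rewrite leNgt; apply/negP => H.
  have := shape_inc_pos shape (ltW oms0) H.
  have s0i' : 0 < s0 <= s0 by rewrite s00 lexx.
  rewrite -(lvl _ s0i') -(lvl _ si) ltNge => /negP; apply.
  have /andP[s1 s2] := si; have [->//|ns] := eqVneq s s0.
  by apply/ltW/Yinc => //; [exact: ltW | rewrite lt_neqAle ns].
- move=> s si Xs; have [om0 fo] := fast s si.
  apply: (fast_orbit_basin shape fo om0) => //.
  by have [|] := andP (XK s _) => //; case/andP: si => ? ->; rewrite ltW.
(* By flatness of [F], the derivative of [Y - F \o X] at [0] is [dY 0 > 0]: this is the germ
   condition. *)
have dF0 : dF 0 = 0.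
  have := shape_bound shape (x := 0); rewrite normr0 expr0n gtn_eqF // mulr0.
  by move=> /(_ (ltW K0)); rewrite normr_le0 => /eqP.
have DFX := @is_derive1_comp _ F X 0 _ _ (shape_derive shape (X 0)) (DX 0).
have DG := is_deriveB (DY 0) DFX.
rewrite X0 dF0 mul0r subr0 in DG.
have [e e0 [H _]] := is_derive_gt0 DG dY0.
exists e => // s /andP[s1 s2].
have /= := H s; rewrite !fctE /= Y0 X0 (shape0 shape) subr0 add0r s1 s2 subr_gt0.
exact.
Qed.

Lemma cvg_pair1 (R : realType) (g : R -> R * R) (q : R * R) (H : set_system R) :
  Filter H -> g t @[t --> H] --> q -> (g t).1 @[t --> H] --> q.1.
Proof.
move=> FH gq; apply: (cvg_comp _ _ gq).
by case: q {gq} => q1 q2; exact: cvg_fst.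
Qed.

Lemma cvg_pair2 (R : realType) (g : R -> R * R) (q : R * R) (H : set_system R) :
  Filter H -> g t @[t --> H] --> q -> (g t).2 @[t --> H] --> q.2.
Proof.
move=> FH gq; apply: (cvg_comp _ _ gq).
by case: q {gq} => q1 q2; exact: cvg_snd.
Qed.

Lemma omega_fast_orbit (R : realType) (n : nat) (ft : R -> R) (p : R * R) (om : R) :
  (0 < n)%N ->
  omega_limit_point (slow_fast_field n ft 0 0) p (om, critical_graph n ft om) ->
  fast_orbit (critical_graph n ft) p.1 p.2 om.
Proof.
move=> n0 [g [S g0 lim]].
exists (fun t => (g t).1), (fun t => (g t).2); split; rewrite ?g0 //.
- move=> t t0; have [Dx Dy] := S t t0; split=> //.
  by move: Dy; rewrite /= expr0n muln_eq0 /= eqn0Ngt n0 mul0r.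
- exact: (cvg_pair1 _ lim).
- exact: (cvg_pair2 _ lim).
Qed.

Lemma alpha_fast_orbit (R : realType) (n : nat) (ft : R -> R) (p : R * R) (al : R) :
  (0 < n)%N ->
  alpha_limit_point (slow_fast_field n ft 0 0) p (al, critical_graph n ft al) ->
  fast_orbit (fun u => critical_graph n ft (- u)) (- p.1) p.2 (- al).
Proof.
move=> n0 [g [S g0 lim]].
have lim' : (g (- t)) @[t --> +oo] --> (al, critical_graph n ft al).
  exact: (cvgNy_compNP _ _).1 lim.
exists (fun t => - (g (0 - t)).1), (fun t => (g (0 - t)).2); split; rewrite ?subr0 ?g0 //.
- move=> t t0; have [|Dx Dy] := S (0 - t); first by rewrite /= sub0r oppr_le0.
  split.
    have := is_deriveN (is_derive_reflect Dx).
    by rewrite /= !opprK.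
  have := is_derive_reflect Dy.
  by rewrite /= expr0n muln_eq0 /= eqn0Ngt n0 mul0r oppr0.
- apply: (@cvgN _ _ _ _ _ (fun t => (g (0 - t)).1)).
  under eq_fun do rewrite sub0r.
  exact: (cvg_pair1 _ lim').
- rewrite opprK; under eq_fun do rewrite sub0r.
  exact: (cvg_pair2 _ lim').
Qed.

(** * Limits of the transition maps *)

Lemma near_right0_lt (R : realType) (e : R) : 0 < e ->
  \forall x \near (0 : R)^'+, 0 < x < e.
Proof.
move=> e0; exists e => // x /=; rewrite sub0r normrN => xe x0.
by rewrite x0 -(gtr0_norm x0).
Qed.

(** The contact region has the scale [rho = nu' * eps]: then [rho ^+ k.+1] is a small multiple of
    [d], [d / rho ^+ k] is of order [eps], and [c] is dominated by [rho ^+ k] because [lam] tends to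
    [0]. *)
Lemma eventually_small_near (R : realType) (k : nat) (lam : R -> R)
    (P : R -> R -> R -> Prop) :
  (0 < k)%N -> (forall e : R, 0 < e -> \forall eps \near 0^'+, `|lam eps| < e) ->
  eventually_small k P ->
  \forall eps \near 0^'+, exists2 rho, 0 < eps & P (eps ^+ k.+1) (eps ^+ k * lam eps) rho.
Proof.
move=> kpos lam0 [nu nu0 H].
pose nu' := Num.min 1 nu.
have nu'0 : 0 < nu' by rewrite lt_min ltr01.
have nu'1 : nu' <= 1 by rewrite ge_min lexx.
have nu'nu : nu' <= nu by rewrite ge_min lexx orbT.
clearbody nu'.
have nk : 0 < nu' ^+ k by rewrite exprn_gt0.
have nk1 : nu' ^+ k <= 1 by rewrite exprn_ile1 // ltW.
have p1 : 0 < nu' ^+ k / 2 by rewrite divr_gt0.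
have p2 : 0 < nu * nu' ^+ k by rewrite mulr_gt0.
near=> eps.
have /andP[e0 e1] : 0 < eps < nu' by near: eps; apply: near_right0_lt.
have /andP[_ e2] : 0 < eps < nu * nu' ^+ k by near: eps; apply: near_right0_lt.
have l1 : `|lam eps| < nu' ^+ k / 2 by near: eps; apply: lam0.
have ek : 0 < eps ^+ k by rewrite exprn_gt0.
have ele1 : eps <= 1 by apply: le_trans nu'1; exact: ltW.
exists (nu' * eps) => //; apply: H; split.
- rewrite exprn_gt0 //=; apply: (@le_lt_trans _ _ eps); last exact: lt_le_trans nu'nu.
  by rewrite -[X in _ <= X]expr1 ler_wiXn2l // ltW.
- rewrite mulr_gt0 //=; apply: (@le_lt_trans _ _ eps); last exact: lt_le_trans nu'nu.
  by rewrite ler_piMl // ltW.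
- rewrite normrM (ger0_norm (ltW ek)) exprMn.
  have : eps ^+ k * `|lam eps| <= eps ^+ k * (nu' ^+ k / 2) by rewrite ler_pM2l // ltW.
  by clear; lra.
- rewrite exprMn ler_pM2r ?exprn_gt0 //; apply: le_trans nu'nu.
  by rewrite -[X in _ <= X]expr1 ler_wiXn2l // ltW.
- by rewrite exprSr exprMn mulrC mulrA ler_pM2r // ltW.
Unshelve. all: by end_near.
Qed.

(** The orbit is cut at its crossing of [{x = 0, y < 0}]. The second piece, run back from [T] and
    reflected, crosses at time [T - tau] at the same height. *)
Lemma passes_to_reaches (R : realType) (n : nat) (ft : R -> R) (eps lam s0 s p : R)
    (sigm sigp : R -> R * R) (Xm Ym Xp Yp : R -> R) :
  (0 < n)%N -> sigm s = (Xm s, Ym s) ->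
  (forall s', 0 <= s' <= s0 -> sigp s' = (Xp s', Yp s')) -> 0 <= p <= s0 ->
  passes_to (slow_fast_field n ft eps lam) (section_points s0 sigp) (sigm s) (sigp p) ->
  exists h, reaches (2 * n - 1) (critical_graph n ft) Xm Ym
      (eps ^+ (2 * n - 1).+1) (eps ^+ (2 * n - 1) * lam) s h /\
    reaches_first (2 * n - 1) (fun u => critical_graph n ft (- u)) (fun s => - Xp s) Yp s0
      (eps ^+ (2 * n - 1).+1) (- (eps ^+ (2 * n - 1) * lam)) p h.
Proof.
move=> n0 Es Ep pi [T [tau [g [/andP[tau0 tauT] S [g0 gT] [Eq nomeet] cross]]]].
have k1 : (2 * n - 1).+1 = (2 * n)%N by rewrite subn1 prednK // muln_gt0.
have ko : odd (2 * n - 1) by rewrite oddB ?muln_gt0 // oddM.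
have tauT' : 0 <= tau <= T by rewrite !ltW.
have [gx gy] := (cross tau tauT').2 erefl.
have sol : solution (2 * n - 1) (critical_graph n ft) (eps ^+ (2 * n - 1).+1)
    (eps ^+ (2 * n - 1) * lam) 0 T (fun t => (g t).1) (fun t => (g t).2).
  by move=> t /S; rewrite k1.
exists (g tau).2; split.
  exists T, tau, (fun t => (g t).1), (fun t => (g t).2); rewrite g0 Es; split=> //.
  split=> //; first by rewrite tau0.
  move=> t /andP[t1 t2] H.
  have tT : 0 <= t <= T by rewrite t1 (le_trans (ltW t2)) // ltW.
  by move: t2; rewrite ((cross t tT).1 H) ltxx.
have solR := solution_reverse (t0 := T) ko sol; rewrite subrr subr0 in solR.
exists T, (T - tau), (fun s => - (g (T - s)).1), (fun s => (g (T - s)).2).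
have E1 : T - (T - tau) = tau by ring.
split; rewrite ?subr0 ?gT ?Ep ?E1 //.
  split; rewrite ?E1 ?gx ?oppr0 //.
    by apply/andP; split; lra.
  move=> t /andP[t1 t2] [/eqP]; rewrite oppr_eq0 => /eqP xt yt.
  have tT : 0 <= T - t <= T by lra.
  have := (cross _ tT).1 (conj xt yt); lra.
move=> t s' t12 s'i [Ex Ey]; apply: (nomeet (T - t)); first lra.
exists s'; first by rewrite /= in_itv.
rewrite Ep //; have {}Ex : (g (T - t)).1 = Xp s' by apply: oppr_inj.
by rewrite -Ex -Ey; case: (g _).
Qed.

Lemma expR_gap (R : realType) (d u v : R) : 0 < d -> expR (- u / d) <= expR (- v / d) -> v <= u.
Proof. by move=> d0; rewrite ler_expR ler_pM2r ?invr_gt0 // lerN2. Qed.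

Section TransitionLimit.
Variables (R : realType) (k : nat) (lam : R -> R) (eps0 : R).
Variables (F dF : R -> R) (K C : R) (J : R -> R) (s0m : R) (X Y om : R -> R).
Variables (F' dF' : R -> R) (K' C' : R) (J' : R -> R) (s0p : R) (X' Y' om' : R -> R).
Variables (scm scp s : R) (Se : R -> R).
Hypothesis ko : odd k.
Hypothesis lam0 : forall e : R, 0 < e -> \forall eps \near 0^'+, `|lam eps| < e.
Hypothesis eps00 : 0 < eps0.
Hypothesis sideM : section_side k F dF K C J s0m X Y om.
Hypothesis sideP : section_side k F' dF' K' C' J' s0p X' Y' om'.
Hypothesis si : 0 < s < scm.
Hypothesis scmi : scm <= s0m.
Hypothesis scpi : 0 < scp <= s0p.
Hypothesis connection : forall eps, 0 < eps < eps0 -> exists h,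
  reaches k F X Y (eps ^+ k.+1) (eps ^+ k * lam eps) scm h /\
  reaches_first k F' X' Y' s0p (eps ^+ k.+1) (- (eps ^+ k * lam eps)) scp h.
Hypothesis transition : forall eps, 0 < eps < eps0 -> 0 <= Se eps <= s0p /\ exists h,
  reaches k F X Y (eps ^+ k.+1) (eps ^+ k * lam eps) s h /\
  reaches_first k F' X' Y' s0p (eps ^+ k.+1) (- (eps ^+ k * lam eps)) (Se eps) h.

Let kpos : (0 < k)%N. Proof. by case: k ko. Qed.

Lemma near_entry (P : R -> R -> R -> Prop) : eventually_small k P ->
  \forall eps \near 0^'+, exists2 rho, 0 < eps < eps0 &
    P (eps ^+ k.+1) (eps ^+ k * lam eps) rho.
Proof.
move=> /(eventually_small_near kpos lam0) H; near=> eps.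
have [rho e0 Prho] : exists2 rho, 0 < eps & P (eps ^+ k.+1) (eps ^+ k * lam eps) rho.
  by near: eps.
by exists rho => //; near: eps; exact: near_right0_lt.
Unshelve. all: by end_near.
Qed.

Lemma near_exit (P : R -> R -> R -> Prop) : eventually_small k P ->
  \forall eps \near 0^'+, exists2 rho, 0 < eps < eps0 &
    P (eps ^+ k.+1) (- (eps ^+ k * lam eps)) rho.
Proof.
have lam0' e : 0 < e -> \forall eps \near 0^'+, `|(fun eps => - lam eps) eps| < e.
  by move=> e0; near=> eps; rewrite normrN; near: eps; exact: lam0.
move=> /(eventually_small_near kpos lam0') H; near=> eps.
have [rho e0 Prho] : exists2 rho, 0 < eps & P (eps ^+ k.+1) (eps ^+ k * - lam eps) rho.
  by near: eps.
exists rho; first by near: eps; exact: near_right0_lt.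
by rewrite -mulrN.
Unshelve. all: by end_near.
Qed.

(** The connecting orbit meets the exit section first at [scp]; by [side_inside] a single small
    [eps] already rules out an earlier section point under the reflected curve. *)
Lemma exit_inside p : 0 <= p < scp -> F' (X' p) <= Y' p.
Proof.
move=> /andP[]; rewrite le_eqVlt => /orP[/eqP <- _|p0 pscp].
  by rewrite (side_X0 sideP) (side_Y0 sideP) (shape0 (side_shape sideP)).
rewrite leNgt; apply/negP => out.
have /andP[_ scp1] := scpi.
have ev := side_inside kpos sideP p0 pscp scp1 out.
have [eps [rho ei H]] := filter_ex (near_exit ev).
have [h [_ hr]] := connection ei.
by apply: (H scp h) hr; rewrite lexx.
Qed.

Lemma transition_lower a : 0 < a < scp -> J' (om' a) - J' 0 < J (om s) - J 0 ->
  \forall eps \near 0^'+, a < Se eps.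
Proof.
move=> /andP[a0 ascp] gap; have /andP[s0 sscm] := si; have /andP[_ scp1] := scpi.
pose e := (J (om s) - J 0 - (J' (om' a) - J' 0)) / 4.
have e0 : 0 < e by rewrite divr_gt0 // subr_gt0.
have si' : 0 < s <= s0m by rewrite s0 (le_trans (ltW sscm)).
have U := near_entry (side_gap_upper kpos sideM si' e0).
have L := near_exit (side_gap_lower ko sideP a0 ascp scp1 e0).
apply: (filterS2 _ _ U L) => eps [r1 ei HU] [r2 _ HL].
rewrite ltNge; apply/negP => Sa.
have [/andP[S0 S1] [h [h1 /reaches_first_reaches h2]]] := transition ei.
have [h' [h1' /reaches_first_reaches h2']] := connection ei.
have d0 : 0 < eps ^+ k.+1 by case/andP: ei => ? _; rewrite exprn_gt0.
have ins : F' (X' (Se eps)) <= Y' (Se eps).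
  by apply: exit_inside; rewrite S0 (le_lt_trans Sa).
have A1 : `|h - h'| <= expR (- (J (om s) - J 0 - e) / (eps ^+ k.+1)).
  by apply: HU h1 h1'; rewrite ?lexx /= ?scmi ?andbT ?(ltW sscm) // (le_trans (ltW sscm)).
have A2 : expR (- (J' (om' a) - J' 0 + e) / (eps ^+ k.+1)) <= `|h - h'|.
  by apply: HL h2 h2'; rewrite ?S0 ?lexx //; left.
have := expR_gap d0 (le_trans A2 A1); rewrite /e; lra.
Qed.

(** [b <= scp] puts both exit points beyond [b] once [Se eps >= b], so that the upper gap bound at
    [b] applies. On the entry side the lower start is the fixed [s], which may lie under the
    curve. *)
Lemma transition_upper b : 0 < b <= scp -> J (om s) - J 0 < J' (om' b) - J' 0 ->
  \forall eps \near 0^'+, Se eps < b.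
Proof.
move=> /andP[b0 bscp] gap; have /andP[s0 sscm] := si; have /andP[_ scp1] := scpi.
pose e := (J' (om' b) - J' 0 - (J (om s) - J 0)) / 4.
have e0 : 0 < e by rewrite divr_gt0 // subr_gt0.
have bi : 0 < b <= s0p by rewrite b0 (le_trans bscp).
have L := near_entry (side_gap_lower ko sideM s0 sscm scmi e0).
have U := near_exit (side_gap_upper kpos sideP bi e0).
apply: (filterS2 _ _ L U) => eps [r1 ei HL] [r2 _ HU].
rewrite ltNge; apply/negP => Sb.
have [/andP[S0 S1] [h [h1 /reaches_first_reaches h2]]] := transition ei.
have [h' [h1' /reaches_first_reaches h2']] := connection ei.
have d0 : 0 < eps ^+ k.+1 by case/andP: ei => ? _; rewrite exprn_gt0.
have A1 : `|h - h'| <= expR (- (J' (om' b) - J' 0 - e) / (eps ^+ k.+1)).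
  by apply: HU h2 h2'; rewrite ?Sb ?bscp.
have A2 : expR (- (J (om s) - J 0 + e) / (eps ^+ k.+1)) <= `|h - h'|.
  by apply: HL h1 h1'; rewrite ?lexx ?scmi ?(ltW s0) //; right.
have := expR_gap d0 (le_trans A2 A1); rewrite /e; lra.
Qed.

(** On the exit side the connecting orbit is now the inner one: it starts at [scp], and
    [Se eps >= b] lies further out. The exit gap is thus bounded below by the integral at [scp],
    however far [Se eps] is. *)
Lemma transition_upper_buffer b : scp < b -> J' (om' scp) - J' 0 < J (om s) - J 0 ->
  \forall eps \near 0^'+, Se eps < b.
Proof.
move=> scpb gap; have /andP[s0 sscm] := si; have /andP[scp0 scp1] := scpi.
have [bs|bs] := leP b s0p; last first.
  near=> eps; have ei : 0 < eps < eps0 by near: eps; exact: near_right0_lt.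
  by have [/andP[_ S1] _] := transition ei; apply: le_lt_trans bs.
pose e := (J (om s) - J 0 - (J' (om' scp) - J' 0)) / 4.
have e0 : 0 < e by rewrite divr_gt0 // subr_gt0.
have si' : 0 < s <= s0m by rewrite s0 (le_trans (ltW sscm)).
have U := near_entry (side_gap_upper kpos sideM si' e0).
have L := near_exit (side_gap_lower ko sideP scp0 scpb bs e0).
apply: (filterS2 _ _ U L) => eps [r1 ei HU] [r2 _ HL].
rewrite ltNge; apply/negP => Sb.
have [/andP[S0 S1] [h [h1 /reaches_first_reaches h2]]] := transition ei.
have [h' [h1' /reaches_first_reaches h2']] := connection ei.
have d0 : 0 < eps ^+ k.+1 by case/andP: ei => ? _; rewrite exprn_gt0.
have A1 : `|h' - h| <= expR (- (J (om s) - J 0 - e) / (eps ^+ k.+1)).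
  by apply: HU h1' h1; rewrite ?lexx /= ?scmi ?andbT ?(ltW sscm) // (le_trans (ltW sscm)).
have A2 : expR (- (J' (om' scp) - J' 0 + e) / (eps ^+ k.+1)) <= `|h' - h|.
  by apply: HL h2' h2; rewrite ?Sb ?lexx ?(ltW scp0) //; right.
have := expR_gap d0 (le_trans A2 A1); rewrite /e; lra.
Unshelve. all: by end_near.
Qed.

End TransitionLimit.

(** * Weak convergence of the push-forwards *)

(* [integral] only evaluates its set function on measurable sets, so it does not
   see that [pushforward_on] fails to be a measure elsewhere. *)
Lemma eq_integral_measurable (d : measure_display) (T : measurableType d) (R : realType)
    (m1 m2 : set T -> \bar R) (f : T -> \bar R) :
  (forall A, measurable A -> m1 A = m2 A) ->
  (\int[m1]_x f x = \int[m2]_x f x)%E.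
Proof.
move=> m12.
have E (h : {nnsfun T >-> R}) : sintegral m1 h = sintegral m2 h.
  rewrite /sintegral; apply: eq_fsbigr => x _; congr (_ * _)%E.
  by apply: m12; exact: measurable_sfunP.
rewrite /integral; congr (_ - _)%E; congr ereal_sup; apply/seteqP.
  by split=> z [h hf <-]; exists h.
by split=> z [h hf <-]; exists h.
Qed.

(** Extends continuous maps from a segment to the line, so that their compositions with test
    functions are again test functions. *)
Definition clamp (R : realType) (l1 l2 s : R) : R := Num.max l1 (Num.min l2 s).

Lemma clamp_in (R : realType) (l1 l2 s : R) : l1 <= l2 -> l1 <= clamp l1 l2 s <= l2.
Proof. by move=> l12; rewrite /clamp le_max lexx ge_max l12 ge_min lexx. Qed.

Lemma clamp_id (R : realType) (l1 l2 s : R) : l1 <= s <= l2 -> clamp l1 l2 s = s.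
Proof. by move=> /andP[s1 s2]; rewrite /clamp min_r // max_r. Qed.

Lemma clamp_continuous (R : realType) (l1 l2 : R) : continuous (clamp l1 l2).
Proof.
move=> s; apply: (@continuous_max _ _ (fun=> l1) (fun s => Num.min l2 s) s).
  exact: cst_continuous.
by apply: (@continuous_min _ _ (fun=> l2) id s); first exact: cst_continuous.
Qed.

Lemma bounded_continuous_integrable (R : realType) (m : probability (measurableTypeR R) R)
    (f : R -> R) (M : R) :
  continuous f -> (forall x, `|f x| <= M) -> m.-integrable setT (EFin \o f).
Proof.
move=> cf bf; apply: measurable_bounded_integrable => //.
- by apply: le_lt_trans (probability_le1 m measurableT) (ltry _).
- exact: continuous_measurable_fun.
- by exists M; split; [exact: num_real | move=> y My x _ /=; rewrite (le_trans (bf x)) // ltW].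
Qed.

Lemma integral_pushforward_on (R : realType) (m : probability (measurableTypeR R) R)
    (l1 l2 : R) (G chi : R -> R) (M : R) :
  l1 <= l2 -> supported_on `[l1, l2] m -> continuous (G \o clamp l1 l2) ->
  continuous chi -> (forall x, `|chi x| <= M) ->
  (\int[pushforward_on `[l1, l2] m G]_x (chi x)%:E =
   \int[m]_x (chi (G (clamp l1 l2 x)))%:E)%E.
Proof.
move=> l12 sup cG cchi bchi.
pose H : measurableTypeR R -> measurableTypeR R := G \o clamp l1 l2.
have mH : measurable_fun setT H by exact: continuous_measurable_fun.
have -> : (\int[m]_x (chi (G (clamp l1 l2 x)))%:E = \int[pushforward m H]_x (chi x)%:E)%E.
  rewrite integral_pushforward //.
    have mchi : measurable_fun (setT : set (measurableTypeR R)) chi.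
      exact: continuous_measurable_fun.
    exact: measurableT_comp mchi.
  rewrite preimage_setT; apply: (@bounded_continuous_integrable _ m (chi \o H) M).
    by move=> x; apply: continuous_comp; [exact: cG | exact: cchi].
  by move=> x; exact: bchi.
apply: eq_integral_measurable => A mA.
have mHA : measurable (H @^-1` A) by rewrite -[X in measurable X]setTI; exact: mH.
have mL : measurable (`[l1, l2] : set (measurableTypeR R)) by exact: measurable_itv.
rewrite /pushforward_on /pushforward.
have -> : `[l1, l2] `&` G @^-1` A = (H @^-1` A) `&` `[l1, l2].
  apply/seteqP; split=> x /=; rewrite in_itv /= => -[].
    by move=> xL GA; split=> //; rewrite /H /= clamp_id.
  by move=> GA xL; split=> //; move: GA; rewrite /H /= clamp_id.
(* The part of the preimage outside the segment is null by the support condition. *)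
rewrite -[RHS]/(m (H @^-1` A)) (@measureDI _ _ _ m _ _ mHA mL) -[LHS]add0e.
congr (_ + _)%E; apply/esym/(@subset_measure0 _ _ _ m _ (~` `[l1, l2])) => //.
- exact: measurableD.
- exact: measurableC.
Qed.

(** Replacing [S eps] by [G] costs at most the uniform distance of their compositions with [chi], as
    [mu eps] has mass [1]; replacing [mu eps] by [mu0] is weak convergence tested on
    [chi \o G \o clamp l1 l2]. *)
Lemma weak_cvg_pushforward (R : realType) (mu : R -> probability (measurableTypeR R) R)
    (mu0 : probability (measurableTypeR R) R) (l1 l2 eps0 : R)
    (S : R -> R -> R) (G : R -> R) :
  l1 <= l2 -> 0 < eps0 ->
  (forall eps : R, 0 < eps < eps0 -> supported_on `[l1, l2] (mu eps)) ->
  supported_on `[l1, l2] mu0 -> weak_cvg (fun eps => mu eps) mu0 ->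
  (forall eps : R, 0 < eps < eps0 -> continuous (S eps \o clamp l1 l2)) ->
  continuous (G \o clamp l1 l2) ->
  (forall chi : R -> R, continuous chi -> forall e : R, 0 < e -> \forall eps \near 0^'+,
     forall s, l1 <= s <= l2 -> `|chi (S eps s) - chi (G s)| <= e) ->
  weak_cvg (fun eps => pushforward_on `[l1, l2] (mu eps) (S eps))
           (pushforward_on `[l1, l2] mu0 G).
Proof.
move=> l12 eps00 sup sup0 wc cS cG unif chi cchi [M bchi].
rewrite (integral_pushforward_on l12 sup0 cG cchi bchi).
have cchiG : continuous (chi \o (G \o clamp l1 l2)).
  by move=> x; apply: continuous_comp; [exact: cG | exact: cchi].
have bchiG x : `|(chi \o (G \o clamp l1 l2)) x| <= M by exact: bchi.
have lim := wc _ cchiG (ex_intro _ M bchiG).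
have intG (m : probability (measurableTypeR R) R) :
    m.-integrable setT (EFin \o (chi \o (G \o clamp l1 l2))).
  exact: bounded_continuous_integrable bchiG.
have fin0 : (\int[mu0]_x (chi (G (clamp l1 l2 x)))%:E)%E =
    (\int[mu0]_x (chi (G (clamp l1 l2 x))))%:E.
  by rewrite /Rintegral fineK //; exact: integrable_fin_num (intG mu0).
rewrite fin0; rewrite [X in _ --> X]fin0 in lim.
have /fine_cvgP [_ /cvgrPdist_le lim'] := lim.
have pos : \forall eps \near (0 : R)^'+, 0 < eps < eps0 by exact: near_right0_lt.
apply/fine_cvgP; split.
  near=> eps; have ei : 0 < eps < eps0 by near: eps.
  rewrite (integral_pushforward_on l12 (sup _ ei) (cS _ ei) cchi bchi).
  apply: integrable_fin_num => //.
  apply: (@bounded_continuous_integrable _ _ (chi \o (S eps \o clamp l1 l2)) M).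
    by move=> x; apply: continuous_comp; [exact: cS | exact: cchi].
  by move=> x; exact: bchi.
apply/cvgrPdist_le => e e0.
have e20 : 0 < e / 2 by rewrite divr_gt0.
have near1 := lim' _ e20; have near2 := unif chi cchi _ e20.
apply: (filterS3 _ _ near1 near2 pos) => eps H1 H2 ei.
rewrite /= (integral_pushforward_on l12 (sup _ ei) (cS _ ei) cchi bchi).
have intS : (mu eps).-integrable setT (EFin \o (chi \o (S eps \o clamp l1 l2))).
  apply: (@bounded_continuous_integrable _ _ _ M).
    by move=> x; apply: continuous_comp; [exact: cS | exact: cchi].
  by move=> x; exact: bchi.
set A := fine _; set b := \int[mu0]_x _ in H1 *.
set B := fine (\int[mu eps]_x (chi (G (clamp l1 l2 x)))%:E)%E.
have {}H1 : `|b - B| <= e / 2 by exact: H1.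
have BA : B - A = \int[mu eps]_x (chi (G (clamp l1 l2 x)) - chi (S eps (clamp l1 l2 x))).
  by rewrite (RintegralB measurableT (intG (mu eps)) intS).
pose f x := chi (G (clamp l1 l2 x)) - chi (S eps (clamp l1 l2 x)).
have cchiS : continuous (chi \o (S eps \o clamp l1 l2)).
  by move=> x; apply: continuous_comp; [exact: cS | exact: cchi].
have cf : continuous f by move=> x; apply: cvgB; [exact: cchiG | exact: cchiS].
have fe x : `|f x| <= e / 2 by rewrite distrC; apply: H2; exact: clamp_in.
have H3 : `|B - A| <= e / 2.
  rewrite BA; apply: le_trans (le_normr_Rintegral measurableT _) _.
    exact: bounded_continuous_integrable cf fe.
  have c1 : \int[mu eps]_x (e / 2) = e / 2.
    have p1 : mu eps [set: measurableTypeR R] = 1%E by exact: probability_setT.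
    rewrite Rintegral_cst // -[RHS]mulr1; congr (_ * _).
    exact: (congr1 fine p1).
  rewrite -[X in _ <= X]c1; apply: le_Rintegral => //.
  - apply: (@bounded_continuous_integrable _ _ (fun x => `|f x|) (e / 2)).
      by move=> x; apply: continuous_comp; [exact: cf | exact: norm_continuous].
    by move=> x; rewrite normr_id.
  - by apply: (@bounded_continuous_integrable _ _ _ (e / 2)) => x;
      [exact: cst_continuous | rewrite ger0_norm // ltW].
  by move=> x _; exact: fe.
have bA : `|(b - B) + (B - A)| <= e.
  apply: le_trans (ler_normD _ _) _; rewrite [X in _ <= X]splitr.
  by apply: lerD; [exact: H1 | exact: H3].
by rewrite addrA subrK in bA.
Unshelve. all: by end_near.
Qed.

(** Near each [x] monotonicity squeezes [S eps u] between the values at two neighbours [sm] and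
    [sp], where pointwise convergence is available; compactness leaves finitely many such pairs. *)
Lemma near_uniform_monotone (R : realType) (l1 l2 : R) (S : R -> R -> R) (G : R -> R) :
  l1 <= l2 -> continuous (G \o clamp l1 l2) ->
  (\forall eps \near 0^'+, forall s t, l1 <= s -> s <= t -> t <= l2 -> S eps s <= S eps t) ->
  (forall s, l1 <= s <= l2 -> forall e : R, 0 < e ->
     \forall eps \near 0^'+, `|S eps s - G s| < e) ->
  forall chi : R -> R, continuous chi -> forall e : R, 0 < e -> \forall eps \near 0^'+,
    forall s, l1 <= s <= l2 -> `|chi (S eps s) - chi (G s)| <= e.
Proof.
move=> l12 cG mono ptw chi cchi e e0.
have := (compact_near_coveringP `[l1, l2]).1 (@segment_compact _ l1 l2).
move/(near_covering_withinP `[l1, l2]).2.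
move=> /(_ R (0^'+) (fun eps u => `|chi (S eps u) - chi (G u)| <= e)).
move=> /(_ (at_right_proper_filter _)) [].
  move=> x; rewrite /= in_itv /= => xi; have /andP[x1 x2] := xi.
  have e2 : 0 < e / 2 by rewrite divr_gt0.
  have [dl dl0 Hchi] := continuous_at_eps (cchi (G x)) e2.
  have dl2 : 0 < dl / 2 by rewrite divr_gt0.
  have [r r0 HG] := continuous_at_eps (cG x) dl2.
  rewrite /= (clamp_id xi) in HG.
  have Gclose u : l1 <= u <= l2 -> x - r < u < x + r -> `|G u - G x| < dl / 2.
    by move=> ui /HG; rewrite (clamp_id ui).
  pose sm := Num.max l1 (x - r / 2); pose sp := Num.min l2 (x + r / 2).
  have smi : l1 <= sm <= l2 by rewrite le_max lexx /= ge_max l12; lra.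
  have spi : l1 <= sp <= l2 by rewrite ge_min lexx /= andbT le_min l12; lra.
  have smr : x - r < sm < x + r.
    rewrite lt_max gt_max; apply/andP; split; [apply/orP; right; lra | apply/andP; split; lra].
  have spr : x - r < sp < x + r.
    rewrite gt_min lt_min; apply/andP; split; [apply/andP; split; lra | apply/orP; right; lra].
  have n1 := ptw sm smi _ dl2; have n2 := ptw sp spi _ dl2.
  have n3 : \forall eps \near (0 : R)^'+, [/\ `|S eps sm - G sm| < dl / 2,
      `|S eps sp - G sp| < dl / 2 &
      forall s t, l1 <= s -> s <= t -> t <= l2 -> S eps s <= S eps t].
    by apply: (filterS3 _ _ n1 n2 mono) => eps h1 h2 h3.
  exists (ball x (r / 2), [set eps | [/\ `|S eps sm - G sm| < dl / 2,
      `|S eps sp - G sp| < dl / 2 &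
      forall s t, l1 <= s -> s <= t -> t <= l2 -> S eps s <= S eps t]]).
    by split=> //; apply: nbhsx_ballx; rewrite divr_gt0.
  move=> [u eps] /= [bu [h1 h2 h3]]; rewrite in_itv /= => ui; have /andP[u1 u2] := ui.
  move: bu; rewrite /ball /= ltr_norml => /andP[bu1 bu2].
  have smu : sm <= u by rewrite ge_max u1 /=; clear -bu2; lra.
  have usp : u <= sp by rewrite le_min u2 /=; clear -bu1; lra.
  have Su1 : S eps sm <= S eps u by apply: h3 => //; case/andP: smi.
  have Su2 : S eps u <= S eps sp by apply: h3 => //; case/andP: spi.
  have Gm := Gclose _ smi smr; have Gp := Gclose _ spi spr.
  have Gu : `|G u - G x| < dl / 2 by apply: Gclose => //; clear -bu1 bu2 r0; lra.
  have c1 : `|chi (S eps u) - chi (G x)| < e / 2.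
    apply: Hchi; move: h1 h2 Gm Gp; rewrite !ltr_norml.
    by clear -Su1 Su2; lra.
  have c2 : `|chi (G u) - chi (G x)| < e / 2.
    by apply: Hchi; move: Gu; rewrite !ltr_norml; clear -dl0; lra.
  by move: c1 c2; rewrite !ltr_norml ler_norml; clear; lra.
by move=> r /= r0 H; exists r.
Qed.

(** * The given slow-fast family *)

Lemma oriented_integral00 (R : realType) (g : R -> R) : oriented_integral 0 0 g = 0.
Proof. by rewrite /oriented_integral lexx set_itv1 Rintegral_set1. Qed.

Lemma I_minusE (R : realType) (n : nat) (ft om : R -> R) (s : R) : 0 < om s ->
  - I_minus n ft om s = oriented_integral 0 (om s) (slow_divergence n ft).
Proof. by move=> o; rewrite /I_minus /oriented_integral leNgt o /= (ltW o) opprK. Qed.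

Lemma is_derive_slow_divergence (R : realType) (n : nat) (ft : R -> R) (u : R) :
  (0 < n)%N -> smooth ft ->
  is_derive u (1 : R) (fun v => oriented_integral 0 v (slow_divergence n ft))
    (derive1 (critical_graph n ft) u ^+ 2 / u ^+ (2 * n - 1)).
Proof.
move=> n0 sft; exact: is_derive_oriented_integral (slow_divergence_continuous n0 sft).
Qed.

Lemma transverse_section_derive (R : realType) (s0 : R) (sigma : R -> R * R) :
  transverse_section s0 sigma -> 0 < s0 ->
  exists X Y : R -> R, [/\ smooth X, smooth Y, X 0 = 0, Y 0 = 0 &
    forall s, 0 <= s <= s0 -> sigma s = (X s, Y s) /\ derive1 Y s != 0].
Proof.
move=> [sig0 [X [Y [sX sY H]]]] s00.
have [E _] := H 0 (introT andP (conj (lexx 0) (ltW s00))).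
have [X0 Y0] : X 0 = 0 /\ Y 0 = 0 by move: E; rewrite sig0 => -[<- <-].
by exists X, Y.
Qed.

Section Family.
Variables (R : realType) (n : nat) (ft : R -> R).
Hypothesis n0 : (0 < n)%N.
Hypothesis sft : smooth ft.
Hypothesis f_inc : forall x, 0 < x -> 0 < derive1 (critical_graph n ft) x.
Hypothesis f_dec : forall x, x < 0 -> derive1 (critical_graph n ft) x < 0.

Let f := critical_graph n ft.
Let k := (2 * n - 1)%N.
Let J u := oriented_integral 0 u (slow_divergence n ft).

Let k_odd : odd k.
Proof. by rewrite /k mul2n oddB ?odd_double // -mul2n muln_gt0. Qed.

Let k_gt0 : (0 < k)%N.
Proof. by case: k k_odd. Qed.

Lemma entry_side (s0 : R) (sigma : R -> R * R) (om : R -> R) :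
  entry_section n ft s0 sigma om -> 0 < s0 ->
  exists X Y K C, (forall s, 0 <= s <= s0 -> sigma s = (X s, Y s)) /\
    section_side k f (derive1 f) K C J s0 X Y om.
Proof.
move=> [ts attr] s00.
have [X [Y [sX sY X0 Y0 H]]] := transverse_section_derive ts s00.
have sig s si := (H s si).1; have dY0 s si := (H s si).2.
have [K [C side]] : exists K C, section_side k f (derive1 f) K C J s0 X Y om.
  apply: (@make_section_side R k f (derive1 f) J X (derive1 X) Y (derive1 Y) om s0 k_gt0).
  - by move=> K; exact: critical_graph_shape.
  - by move=> u; exact: is_derive_slow_divergence.
  - exact: s00.
  - by move=> s; exact: smooth_derive.
  - by move=> s; exact: smooth_derive.
  - exact: smooth_derive1_continuous.
  - exact: X0.
  - exact: Y0.
  - exact: dY0.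
  - move=> s si; have [om0 l] := attr s si; split=> //.
    have := omega_fast_orbit n0 l; rewrite sig //=.
    by case/andP: si => /ltW -> ->.
by exists X, Y, K, C.
Qed.

(** The primitive [J (- u)], taken at the reflected landing abscissa [- al s], is the integral
    [I_plus]; oddness of [k] restores the sign of its derivative. *)
Lemma exit_side (s0 : R) (sigma : R -> R * R) (al : R -> R) :
  exit_section n ft s0 sigma al -> 0 < s0 ->
  exists X Y K C, (forall s, 0 <= s <= s0 -> sigma s = (X s, Y s)) /\
    section_side k (fun u => f (- u)) (fun u => - derive1 f (- u)) K C
      (fun u => J (- u)) s0 (fun s => - X s) Y (fun s => - al s).
Proof.
move=> [ts attr] s00.
have [X [Y [sX sY X0 Y0 H]]] := transverse_section_derive ts s00.
have sig s si := (H s si).1; have dY0 s si := (H s si).2.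
have [K [C side]] : exists K C,
    section_side k (fun u => f (- u)) (fun u => - derive1 f (- u)) K C
      (fun u => J (- u)) s0 (fun s => - X s) Y (fun s => - al s).
  apply: (@make_section_side R k (fun u => f (- u)) (fun u => - derive1 f (- u))
    (fun u => J (- u)) (fun s => - X s) (fun s => - derive1 X s) Y (derive1 Y)
    (fun s => - al s) s0 k_gt0).
  - move=> K K0; have [C sh] := critical_graph_shape n0 sft f_inc f_dec K0.
    by exists C; exact: shape_reflect.
  - move=> u.
    have := @is_derive_reflect _ J u 0 _ (is_derive_slow_divergence (0 - u) n0 sft).
    move=> D; apply: is_derive_ext D _ _; first by move=> s; rewrite sub0r.
    by rewrite sub0r sqrrN exprNn -signr_odd k_odd expr1 mulN1r invrN mulrN opprK.
  - exact: s00.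
  - by move=> s; apply: is_deriveN; exact: smooth_derive.
  - by move=> s; exact: smooth_derive.
  - exact: smooth_derive1_continuous.
  - by rewrite X0 oppr0.
  - exact: Y0.
  - exact: dY0.
  - move=> s si; have [om0 l] := attr s si; rewrite oppr_gt0; split=> //.
    have := alpha_fast_orbit n0 l; rewrite sig //=.
    by case/andP: si => /ltW -> ->.
by exists X, Y, K, C.
Qed.

Lemma J_decreasing (u v : R) : v <= 0 -> u < v -> J v < J u.
Proof.
move=> v0 uv; rewrite -ltrN2.
apply: (@increasing_is_derive _ (fun t => - J t)
  (fun t => - (derive1 f t ^+ 2 / t ^+ k))) => //.
  by move=> t _; apply: is_deriveN; exact: is_derive_slow_divergence.
move=> t /andP[_ tv]; have t0 := lt_le_trans tv v0.
rewrite -mulrN -invrN; apply: divr_gt0.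
  by rewrite exprn_even_gt0 //= lt_eqF // f_dec.
rewrite oppr_gt0 -oppr_gt0 -[t]opprK exprNn -signr_odd k_odd expr1 mulN1r opprK.
by rewrite exprn_gt0 // oppr_gt0.
Qed.

End Family.

Section Passage.
Variables (R : realType) (n : nat) (ft : R -> R) (s0m s0p : R).
Variables (sigmam sigmap : R -> R * R) (om al : R -> R) (scm scp eps0 : R).
Variables (lam : R -> R) (l1 l2 : R) (S0 : R -> R) (S : R -> R -> R).
Hypothesis n0 : (0 < n)%N.
Hypothesis sft : smooth ft.
Hypothesis f_inc : forall x, 0 < x -> 0 < derive1 (critical_graph n ft) x.
Hypothesis f_dec : forall x, x < 0 -> derive1 (critical_graph n ft) x < 0.
Hypothesis entry : entry_section n ft s0m sigmam om.
Hypothesis exit : exit_section n ft s0p sigmap al.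
Hypothesis scmi : 0 < scm < s0m.
Hypothesis scpi : 0 < scp < s0p.
Hypothesis eps00 : 0 < eps0.
Hypothesis control : control_curve n ft s0p sigmam sigmap scm scp eps0 lam.
Hypothesis l10 : 0 < l1.
Hypothesis l2scm : l2 < scm.
Hypothesis slow : slow_relation n ft om al `[l1, l2] S0.
Hypothesis trans : transition_maps n ft s0p sigmam sigmap eps0 lam `[l1, l2] S.

Let Im := I_minus n ft om.
Let Ip := I_plus n ft al.

Let s0m0 : 0 < s0m. Proof. by case/andP: scmi; exact: lt_trans. Qed.
Let s0p0 : 0 < s0p. Proof. by case/andP: scpi; exact: lt_trans. Qed.

Lemma control_cvg0 (e : R) : 0 < e -> \forall eps \near 0^'+, `|lam eps| < e.
Proof.
move=> e0; have [[g sg Eg] lam00 _] := control.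
have g0 : g 0 = 0 by rewrite -Eg //= in_itv /= lexx ltW.
have cg : {for 0, continuous g} := is_derive_continuous (smooth_derive 0 sg).
have [d d0 H] := continuous_at_eps cg e0.
have near1 := near_right0_lt d0; have near2 := near_right0_lt eps00.
apply: (filterS2 _ _ near1 near2) => eps /andP[e1 e2] /andP[_ e3].
rewrite Eg /= ?in_itv /= ?(ltW e1) ?(ltW e3) //.
by have := H eps; rewrite g0 subr0; apply; lra.
Qed.

Lemma I_plus_increasing (s t : R) : 0 < s -> s < t -> t <= s0p -> Ip s < Ip t.
Proof.
move=> s1 st t1.
have [X [Y [K [C [_ side]]]]] := exit_side n0 sft f_inc f_dec exit s0p0.
have s2 : s <= s0p by rewrite ltW // (lt_le_trans st).
apply: (J_decreasing n0 sft f_dec).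
  by apply: ltW; have [] := exit.2 s; rewrite ?s1.
by have := side_om_inc side s1 st t1; rewrite ltrN2.
Qed.

Lemma transition_bounds (s : R) : l1 <= s <= l2 ->
  [/\ forall a, 0 < a < scp -> Ip a < - Im s -> \forall eps \near 0^'+, a < S eps s,
      forall b, 0 < b <= scp -> - Im s < Ip b -> \forall eps \near 0^'+, S eps s < b &
      forall b, scp < b -> Ip scp < - Im s -> \forall eps \near 0^'+, S eps s < b].
Proof.
move=> si; have /andP[sl1 sl2] := si.
have [X [Y [K [C [sigm sideM]]]]] := entry_side n0 sft f_inc f_dec entry s0m0.
have [Xp [Yp [K' [C' [sigp sideP]]]]] := exit_side n0 sft f_inc f_dec exit s0p0.
have /andP[scm0 scm1] := scmi; have /andP[scp0 scp1] := scpi.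
have s00 : 0 < s := lt_le_trans l10 sl1.
have sscm : 0 < s < scm by rewrite s00 (le_lt_trans sl2).
have ss0 : s <= s0m := ltW (lt_trans (le_lt_trans sl2 l2scm) scm1).
have om0 : 0 < om s by have [] := entry.2 s; rewrite ?s00.
have ko : odd (2 * n - 1) by rewrite mul2n oddB ?odd_double // -mul2n muln_gt0.
have connection (eps : R) : 0 < eps < eps0 -> exists h,
    reaches (2 * n - 1) (critical_graph n ft) X Y
      (eps ^+ (2 * n - 1).+1) (eps ^+ (2 * n - 1) * lam eps) scm h /\
    reaches_first (2 * n - 1) (fun u => critical_graph n ft (- u)) (fun s => - Xp s) Yp s0p
      (eps ^+ (2 * n - 1).+1) (- (eps ^+ (2 * n - 1) * lam eps)) scp h.
  have [_ _ H] := control => /H; apply: passes_to_reaches => //; last by lra.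
  by apply: sigm; lra.
have transition (eps : R) : 0 < eps < eps0 -> 0 <= S eps s <= s0p /\ exists h,
    reaches (2 * n - 1) (critical_graph n ft) X Y
      (eps ^+ (2 * n - 1).+1) (eps ^+ (2 * n - 1) * lam eps) s h /\
    reaches_first (2 * n - 1) (fun u => critical_graph n ft (- u)) (fun s => - Xp s) Yp s0p
      (eps ^+ (2 * n - 1).+1) (- (eps ^+ (2 * n - 1) * lam eps)) (S eps s) h.
  move=> /trans[_ /(_ s)]; rewrite /= in_itv /= => /(_ si)[Si pass]; split=> //.
  apply: passes_to_reaches pass => //.
  by apply: sigm; lra.
have scmi' : scm <= s0m by lra.
have scpi' : 0 < scp <= s0p by lra.
have E : oriented_integral 0 (om s) (slow_divergence n ft) -
    oriented_integral 0 0 (slow_divergence n ft) = - Im s.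
  by rewrite oriented_integral00 subr0 I_minusE.
have E' t : oriented_integral 0 (- - al t) (slow_divergence n ft) -
    oriented_integral 0 (- 0) (slow_divergence n ft) = Ip t.
  by rewrite oppr0 oriented_integral00 subr0 opprK.
split.
- move=> a ai; rewrite -E -E' => H.
  exact: (transition_lower ko control_cvg0 eps00 sideM sideP sscm scmi' scpi'
    connection transition ai H).
- move=> b bi; rewrite -E -E' => H.
  exact: (transition_upper ko control_cvg0 eps00 sideM sideP sscm scmi' scpi'
    connection transition bi H).
- move=> b bi; rewrite -E -E' => H.
  exact: (transition_upper_buffer ko control_cvg0 eps00 sideM sideP sscm scmi' scpi'
    connection transition bi H).
Qed.

Let slowE (s : R) : l1 <= s <= l2 -> - Im s = Ip (S0 s).
Proof.
move=> si; have [_ _ H] := slow; apply/eqP; rewrite eq_sym -subr_eq0 opprK addrC.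
by apply/eqP; apply: H; rewrite /= in_itv.
Qed.

Lemma transition_cvg_slow (s e : R) : l1 <= s <= l2 -> 0 < S0 s < scp -> 0 < e ->
  \forall eps \near 0^'+, `|S eps s - S0 s| < e.
Proof.
move=> si /andP[S1 S2] e0; have [lower upper _] := transition_bounds si.
have /andP[_ scp1] := scpi.
(* The cap at [scp] and the floor [S0 s / 2] keep [a] and [b] in the range where the comparisons of
   [transition_bounds] apply. *)
pose a := Num.max (S0 s - e) (S0 s / 2); pose b := Num.min (S0 s + e) scp.
have a1 : S0 s - e <= a by rewrite le_max lexx.
have a2 : 0 < a by rewrite lt_max; apply/orP; right; lra.
have a3 : a < S0 s by rewrite gt_max; apply/andP; split; lra.
have b1 : b <= S0 s + e by rewrite ge_min lexx.
have b2 : b <= scp by rewrite ge_min lexx orbT.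
have b3 : S0 s < b by rewrite lt_min S2 andbT; lra.
clearbody a b.
have near1 : \forall eps \near 0^'+, a < S eps s.
  apply: lower; first by lra.
  by rewrite slowE //; apply: I_plus_increasing; lra.
have near2 : \forall eps \near 0^'+, S eps s < b.
  apply: upper; first by lra.
  by rewrite slowE //; apply: I_plus_increasing; lra.
apply: (filterS2 _ _ near1 near2) => eps h1 h2.
by rewrite ltr_norml; lra.
Qed.

Lemma transition_increasing (eps s t : R) : 0 < eps < eps0 ->
  l1 <= s -> s <= t -> t <= l2 -> S eps s <= S eps t.
Proof.
move=> ei s1 st t2; have [[g sg H] _] := trans ei.
have Hs u : l1 <= u <= l2 -> S eps u = g u /\ 0 < derive1 g u.
  by move=> ui; apply: H; rewrite /= in_itv.
rewrite (Hs s _).1 ?s1 ?(le_trans st) // (Hs t _).1 ?(le_trans s1) //.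
apply: (@nondecreasing_is_derive _ g (derive1 g)) => // u ui.
  exact: smooth_derive.
by apply: ltW; apply: (Hs u _).2; lra.
Qed.

Lemma transition_clamp_continuous (eps : R) : l1 <= l2 -> 0 < eps < eps0 ->
  continuous (S eps \o clamp l1 l2).
Proof.
move=> l12 ei; have [[g sg H] _] := trans ei.
have -> : S eps \o clamp l1 l2 = g \o clamp l1 l2.
  apply/funext => u /=; apply: (H _ _).1.
  by rewrite /= in_itv; exact: clamp_in.
move=> u; apply: continuous_comp; first exact: clamp_continuous.
exact: is_derive_continuous (smooth_derive _ sg).
Qed.

(** [I_plus] is injective on []0, s0p]], and both points balance [I_minus] at [sb]. *)
Lemma buffer_image (sb : R) : l1 < sb < l2 -> (forall s, l1 <= s <= l2 -> 0 < S0 s <= s0p) ->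
  Im sb + Ip scp = 0 -> S0 sb = scp.
Proof.
move=> sbi Si E; have sbi' : l1 <= sb <= l2 by lra.
have /andP[S1 S2] := Si sb sbi'; have /andP[scp0 scp1] := scpi.
have E' : Ip (S0 sb) = Ip scp by rewrite -slowE //; lra.
have [lt|lt|//] := ltgtP (S0 sb) scp.
  by have := I_plus_increasing S1 lt (ltW scp1); rewrite E' ltxx.
by have := I_plus_increasing scp0 lt S2; rewrite E' ltxx.
Qed.

Lemma transition_cvg_buffered (sb s e : R) : l1 < sb < l2 ->
  (forall s, l1 <= s <= l2 -> 0 < S0 s <= s0p) -> Im sb + Ip scp = 0 ->
  l1 <= s <= l2 -> 0 < e ->
  \forall eps \near 0^'+, `|S eps s - buffered S0 sb scp s| < e.
Proof.
move=> sbi Si E si e0; rewrite /buffered.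
have Esb := buffer_image sbi Si E.
have /andP[sb1 sb2] := sbi; have /andP[s1 s2] := si.
have [_ S0inc _] := slow.
have S0lt u v : l1 <= u -> u < v -> v <= l2 -> S0 u < S0 v.
  by move=> *; apply: S0inc => //; rewrite /= in_itv /=; apply/andP; split; lra.
case: (ltP s sb) => [ssb|sbs].
  apply: transition_cvg_slow => //; rewrite -Esb S0lt ?andbT; [|lra..].
  by have /andP[] := Si s si.
have /andP[scp0 scp1] := scpi.
have scpIm u : sb <= u -> u <= l2 -> Ip scp <= - Im u.
  rewrite le_eqVlt => /orP[/eqP <- _|sbu u2]; first by lra.
  rewrite slowE; last by lra.
  by apply: ltW; apply: I_plus_increasing; [lra | rewrite -Esb S0lt //; lra |];
    have /andP[] : 0 < S0 u <= s0p by apply: Si; lra.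
pose a := Num.max (scp - e) (scp / 2).
have a1 : scp - e <= a by rewrite le_max lexx.
have a2 : 0 < a by rewrite lt_max; apply/orP; right; lra.
have a3 : a < scp by rewrite gt_max; apply/andP; split; lra.
clearbody a.
have near1 : \forall eps \near 0^'+, a < S eps s.
  have [lower _ _] := transition_bounds si; apply: lower; first by lra.
  apply: lt_le_trans (scpIm s sbs s2).
  by apply: I_plus_increasing; lra.
have l2i : l1 <= l2 <= l2 by lra.
have near2 : \forall eps \near 0^'+, S eps l2 < scp + e.
  have [_ _ upper] := transition_bounds l2i; apply: upper; first by lra.
  rewrite slowE //; apply: I_plus_increasing; first by lra.
    by rewrite -Esb S0lt; lra.
  by have /andP[] := Si l2 l2i.
have near3 := near_right0_lt eps00.
apply: (filterS3 _ _ near1 near2 near3) => eps h1 h2 h3.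
have := transition_increasing h3 s1 s2 (lexx l2).
by rewrite ltr_norml; lra.
Qed.

Lemma slow_clamp_continuous : l1 <= l2 -> continuous (S0 \o clamp l1 l2).
Proof.
move=> l12; have [[g sg H] _ _] := slow.
have -> : S0 \o clamp l1 l2 = g \o clamp l1 l2.
  by apply/funext => u /=; apply: H; rewrite /= in_itv; exact: clamp_in.
move=> u; apply: continuous_comp; first exact: clamp_continuous.
exact: is_derive_continuous (smooth_derive _ sg).
Qed.

(** Since [S0 sb = scp], buffering amounts to stopping the argument at [sb], which reduces its
    continuity to that of [S0]. *)
Lemma buffered_clampE (sb s : R) : l1 < sb < l2 -> S0 sb = scp -> l1 <= s <= l2 ->
  buffered S0 sb scp s = S0 (clamp l1 l2 (Num.min s sb)).
Proof.
move=> sbi Esb si; rewrite /buffered; case: ltP => h.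
  by rewrite clamp_id.
by rewrite clamp_id ?Esb //; lra.
Qed.

Lemma buffered_clamp_continuous (sb : R) : l1 < sb < l2 -> S0 sb = scp ->
  continuous (buffered S0 sb scp \o clamp l1 l2).
Proof.
move=> sbi Esb; have l12 : l1 <= l2 by lra.
have -> : buffered S0 sb scp \o clamp l1 l2 =
    (S0 \o clamp l1 l2) \o (fun s => Num.min (clamp l1 l2 s) sb).
  by apply/funext => u /=; rewrite buffered_clampE // clamp_in.
move=> u; apply: continuous_comp; last exact: slow_clamp_continuous.
apply: (@continuous_min _ _ (clamp l1 l2) (fun=> sb)); first exact: clamp_continuous.
exact: cst_continuous.
Qed.

End Passage.

Unset Implicit Arguments.
Theorem theorem4 (R : realType) (n1 : nat) (ftilde : R -> R)
    (s0m s0p : R) (sigmam sigmap : R -> R * R) (omega1 alpha1 : R -> R)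
    (scm scp eps0 : R) (lambda_c : R -> R)
    (l1 l2 : R) (S0 : R -> R) (S : R -> R -> R)
    (mu : R -> probability (measurableTypeR R) R)
    (mu0 : probability (measurableTypeR R) R) :
  (1 <= n1)%N ->
  smooth ftilde ->
  0 < ftilde 0 ->
  (forall x, 0 < x -> 0 < derive1 (critical_graph n1 ftilde) x) ->
  (forall x, x < 0 -> derive1 (critical_graph n1 ftilde) x < 0) ->
  entry_section n1 ftilde s0m sigmam omega1 ->
  exit_section n1 ftilde s0p sigmap alpha1 ->
  0 < scm < s0m ->
  0 < scp < s0p ->
  0 < eps0 ->
  control_curve n1 ftilde s0p sigmam sigmap scm scp eps0 lambda_c ->
  0 < l1 -> l1 <= l2 -> l2 < scm ->
  slow_relation n1 ftilde omega1 alpha1 `[l1, l2] S0 ->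
  transition_maps n1 ftilde s0p sigmam sigmap eps0 lambda_c `[l1, l2] S ->
  (forall eps, 0 < eps < eps0 -> supported_on `[l1, l2] (mu eps)) ->
  supported_on `[l1, l2] mu0 ->
  weak_cvg (fun eps => mu eps) mu0 ->
  (- I_minus n1 ftilde omega1 scm <= I_plus n1 ftilde alpha1 scp ->
   (forall s, l1 <= s <= l2 -> 0 < S0 s < scp) ->
   weak_cvg (fun eps => pushforward_on `[l1, l2] (mu eps) (S eps))
            (pushforward_on `[l1, l2] mu0 S0))
  /\
  (I_plus n1 ftilde alpha1 scp < - I_minus n1 ftilde omega1 scm ->
   (forall s, l1 <= s <= l2 -> 0 < S0 s <= s0p) ->
   forall sb : R,
     I_minus n1 ftilde omega1 sb + I_plus n1 ftilde alpha1 scp = 0 ->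
     l1 < sb < l2 ->
     [/\ {within `[l1, l2], continuous (buffered S0 sb scp)},
         buffered S0 sb scp @` `[l1, l2] `<=` (S0 @` `[l1, l2]) `&` `]-oo, scp]
       & weak_cvg (fun eps => pushforward_on `[l1, l2] (mu eps) (S eps))
                  (pushforward_on `[l1, l2] mu0 (buffered S0 sb scp))]).
Proof.
move=> n0 sft ft0 f_inc f_dec entry exit scmi scpi eps00 control l10 l12 l2scm slow trans
  sup sup0 wc.
have nearpos := near_right0_lt eps00.
have cS (eps : R) := transition_clamp_continuous trans (eps := eps) l12.
have mono : \forall eps \near (0 : R)^'+, forall s t, l1 <= s -> s <= t -> t <= l2 ->
    S eps s <= S eps t.
  apply: filterS nearpos => eps ei s t s1 st t2.
  exact: (transition_increasing trans ei s1 st t2).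
split=> [_ S0i|_ S0i sb E sbi].
  have cG := slow_clamp_continuous slow l12.
  apply: (weak_cvg_pushforward l12 eps00 sup sup0 wc cS cG).
  apply: near_uniform_monotone => // s si e e0.
  exact: (transition_cvg_slow n0 sft f_inc f_dec entry exit scmi scpi eps00 control l10
    l2scm slow trans si (S0i s si) e0).
have Esb := buffer_image n0 sft f_inc f_dec exit scpi slow sbi S0i E.
have cG := buffered_clamp_continuous slow sbi Esb.
split.
- apply: (@subspace_eq_continuous _ _ _ (buffered S0 sb scp \o clamp l1 l2)).
    by move=> u; rewrite inE /= in_itv /= => ui; rewrite clamp_id.
  exact: continuous_subspaceT.
- move=> _ [s /= + <-]; rewrite in_itv /= => si.
  have [_ S0inc _] := slow.
  have sbL : `[l1, l2]%classic sb by rewrite /= in_itv /=; lra.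
  have sL : `[l1, l2]%classic s by rewrite /= in_itv.
  rewrite /buffered; case: ltP => [ssb|_]; rewrite in_itv /=.
    split; first by exists s.
    by rewrite -Esb; apply: ltW; exact: S0inc.
  by split; [exists sb | exact: lexx].
- apply: (weak_cvg_pushforward l12 eps00 sup sup0 wc cS cG).
  apply: near_uniform_monotone => // s si e e0.
  exact: (transition_cvg_buffered n0 sft f_inc f_dec entry exit scmi scpi eps00 control l10
    l2scm slow trans sbi S0i E si e0).
Qed.
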